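(* Let $X$ be a fractional Brownian motion in $\mathbb R^n$ with Hurst parameter $H\le\frac12$, and consider it on the interval $[0,T]$. Then, for every $\theta>H$, the sample paths of $X$ are almost surely $\theta$-H\''older rough. Moreover, there exist constants $M$ and $c$ independent of $X$ such that $$\mathbb P\big(L_\theta(X)\le\varepsilon\,\big|\,\mathcal F_0^X\big)\le M\exp\big(-c\,\varepsilon^{-2}\big)$$ for all $\varepsilon\in(0,1)$. In particular, $\mathbb E\big(L_\theta(X)^{-p}\,\big|\,\mathcal F^X_0\big)<\infty$ for every $p>0$.
   Context: $X=(X_t)_{t\in\mathbb R}$ is a two-sided fractional Brownian motion with i.i.d. components, $X_0=0$, $\mathbb E|X^i_t-X^i_s|^2=|t-s|^{2H}$; $\mathcal F_0^X$ is the $\sigma$-algebra generated by $\{X_r\}_{r\le0}$. The constants are positive and deterministic, and the conditional bounds hold almost surely. A path $X$ in $\mathbb R^n$ is $\theta$-H\''older rough on $[0,T]$, $\theta\in(0,1)$, if there is a constant $L>0$ such that for every $s\in[0,T]$, every $\varepsilon\in(0,T/2]$ and every $\phi\in\mathbb R^n$ with $\|\phi\|=1$ there exists $t\in[0,T]$ with $|t-s|\le\varepsilon$ and $|\langle\phi,X_t-X_s\rangle|>L\varepsilon^\theta$. The largest such $L$ (the supremum; $0$ if there is none) is denoted $L_\theta(X)$. *)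

(* Defs.v *)
From HB Require Import structures.
From mathcomp Require Import all_boot all_order all_algebra.
From mathcomp Require Import all_classical all_reals all_analysis.
From mathcomp Require Import measurable_realfun.

Set Implicit Arguments.
Unset Strict Implicit.
Unset Printing Implicit Defensive.

Import Order.TTheory GRing.Theory Num.Theory.
Import numFieldNormedType.Exports.

Local Open Scope classical_set_scope.
Local Open Scope ring_scope.

(* The library norm on 'rV[R]_n is the sup norm, hence the explicit Euclidean
   structure. *)
Definition dotp (R : realType) (n : nat) (u v : 'rV[R]_n) : R :=
  \sum_(i < n) u ord0 i * v ord0 i.

Definition enorm (R : realType) (n : nat) (u : 'rV[R]_n) : R :=
  Num.sqrt (dotp u u).

Definition rough_const (R : realType) (n : nat) (theta T : R)
    (x : R -> 'rV[R]_n) (L : R) : Prop :=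
  forall (s e : R) (phi : 'rV[R]_n),
    0 <= s <= T -> 0 < e <= T / 2 -> enorm phi = 1 ->
    exists t : R, [/\ 0 <= t <= T, `|t - s| <= e &
                      L * e `^ theta < `|dotp phi (x t - x s)|].

Definition holder_rough (R : realType) (n : nat) (theta T : R)
    (x : R -> 'rV[R]_n) : Prop :=
  exists L : R, 0 < L /\ rough_const theta T x L.

(* The maximum with 0 only matters when no admissible constant exists, where
   the supremum of the empty set is -oo. *)
Definition roughness (R : realType) (n : nat) (theta T : R)
    (x : R -> 'rV[R]_n) : \bar R :=
  maxe 0%E
    (ereal_sup [set L%:E | L in [set L | 0 < L /\ rough_const theta T x L]]).

(* L^{-p} in [0, +oo].  The library has 0 `^ (- p) = 0 but 0^-1 = +oo in \bar R,
   so the inverse is taken last: the value is +oo at 0 and 0 at +oo. *)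
Definition neg_powe (R : realType) (L : \bar R) (p : R) : \bar R :=
  ((L `^ p)^-1)%E.

Definition sigma_process (R : realType) (n : nat) (Omega : Type) (D : set R)
    (I : set 'I_n) (X : R -> Omega -> 'rV[R]_n) : set (set Omega) :=
  <<s [set A | exists t i (B : set R), [/\ D t, I i, measurable B &
                 A = (fun w => X t w ord0 i) @^-1` B]] >>.

(* normal_prob takes the standard deviation as second argument and is not a
   point mass when that is 0, so the degenerate case is separate. *)
Definition centered_gaussian (R : realType) (d : measure_display)
    (Omega : measurableType d) (P : probability Omega R) (Y : Omega -> R)
    : Prop :=
  exists sigma : R, forall A : set R, measurable A ->
    P (Y @^-1` A) = if sigma == 0 then \d_(0 : R) A else normal_prob 0 sigma A.

Record is_scalar_fbm (R : realType) (d : measure_display)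
    (Omega : measurableType d) (P : probability Omega R) (H : R)
    (Z : R -> Omega -> R) : Prop := {
  fbm_measurable : forall t, measurable_fun setT (Z t);
  fbm_continuous : forall w, continuous (fun t => Z t w);
  fbm_start : forall w, Z 0 w = 0;
  fbm_gaussian : forall (m : nat) (a t : 'I_m -> R),
    centered_gaussian P (fun w => \sum_(k < m) a k * Z (t k) w);
  fbm_increment : forall s t,
    ('E_P[(fun w => (`|Z t w - Z s w| ^+ 2)%R)])%E = (`|t - s| `^ (2 * H))%:E
}.

(* The law of a scalar fractional Brownian motion is determined by H, so the
   components are automatically identically distributed. *)
Record is_fbm (R : realType) (n : nat) (d : measure_display)
    (Omega : measurableType d) (P : probability Omega R) (H : R)
    (X : R -> Omega -> 'rV[R]_n) : Prop := {
  fbm_component : forall i : 'I_n,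
    is_scalar_fbm P H (fun t w => X t w ord0 i);
  fbm_indep : forall A : 'I_n -> set Omega,
    (forall i, sigma_process setT [set i] X (A i)) ->
    P (\bigcap_(i in [set: 'I_n]) A i) = (\prod_(i < n) P (A i))%E
}.

Definition past (R : realType) (n : nat) (Omega : Type)
    (X : R -> Omega -> 'rV[R]_n) : set (set Omega) :=
  sigma_process [set r | r <= 0] setT X.

(* Conditional expectation of a [0, +oo]-valued random variable; integrability
   is not required. *)
Record is_cond_expectation (R : realType) (d : measure_display)
    (Omega : measurableType d) (P : probability Omega R)
    (G : set (set Omega)) (f Y : Omega -> \bar R) : Prop := {
  cexp_measurable : measurable_fun setT f;
  cexp_ge0 : forall w, (0 <= f w)%E;
  cexp_version_ge0 : forall w, (0 <= Y w)%E;
  cexp_version_measurable : forall B : set (\bar R),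
    measurable B -> G (Y @^-1` B);
  cexp_integral : forall A : set Omega, G A ->
    (\int[P]_(w in A) Y w = \int[P]_(w in A) f w)%E
}.

(* "E(f | G) satisfies Q almost surely": the conditional expectation exists and
   each of its versions satisfies Q outside a null set. *)
Definition cond_expectation_as (R : realType) (d : measure_display)
    (Omega : measurableType d) (P : probability Omega R)
    (G : set (set Omega)) (f : Omega -> \bar R) (Q : \bar R -> Prop) : Prop :=
  (exists Y, is_cond_expectation P G f Y) /\
  (forall Y, is_cond_expectation P G f Y -> {ae P, forall w, Q (Y w)}).

Definition cond_probability_as (R : realType) (d : measure_display)
    (Omega : measurableType d) (P : probability Omega R)
    (G : set (set Omega)) (E : set Omega) (Q : \bar R -> Prop) : Prop :=
  cond_expectation_as P G (fun w => (\1_E w)%:E) Q.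

(* Main.v *)
Require Import Defs.
From HB Require Import structures.
From mathcomp Require Import all_boot all_order all_algebra.
From mathcomp Require Import all_classical all_reals all_analysis.
From mathcomp Require Import measurable_realfun.
From mathcomp Require Import ring lra zify.

Import Order.TTheory GRing.Theory Num.Theory.
Import numFieldNormedType.Exports.

Local Open Scope classical_set_scope.
Local Open Scope ring_scope.

Set Implicit Arguments.
Unset Strict Implicit.
Unset Printing Implicit Defensive.

(** A path has small roughness only if, at some time and scale, some unit
    direction [phi] makes [<phi, X>] nearly constant. If the roughness is at
    most [eps], there are a dyadic interval of length [D = T / 2 ^+ m] and a unit
    vector [phi] such that [<phi, X>] oscillates by at most [8 eps D ^ theta] on
    it ([not_rough_dyadic]). Cut the interval into [N] pieces of length
    [h = D / N], with [N] of order [eps ^ -2 * 2 ^ (m (theta / H - 1))]: as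
    [1 / H >= 2], the oscillation is then a small multiple of [h ^ H], the typical
    size of an increment over a piece ([mesh_window]). Thus [N] increments that
    are far from being determined by one another lie in one thin slab, which
    costs a factor [(3 / 4) ^ N] up to a power of [N] ([flat_prob]); as
    [theta > H], the sum over the [2 ^ m] intervals and over [m] is at most
    [M exp (- c eps ^ -2)] ([roughness_tail]).

    Conditioning on the past is expressed by inequalities
    [P (A `&` E) <= k * P A] for all [A] in the past. Three ideas give them.

    Local nondeterminism ([cov_lnd]): given all the values of a component outside
    an interval of length [h], the increment over that interval keeps a standard
    deviation of order [h ^ H]. Indeed [u ^ (2H)] is a positive mixture of the
    functions [min u r], so that the variance of a linear combination of values is
    a mixture over the scales [r] of the mean-square oscillations of a step
    function; if this function is [1] on an interval and [0] far away, its
    oscillations cannot all be small.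

    Functional analysis instead of conditional laws ([one_increment_cst]): the
    finite sums of terms [c 1_C cos (l + th)], where [l] is a linear combination of
    values of the component that does not involve a given increment and [C] is an
    event of the other components, form an algebra on which the conditional
    characteristic function of the increment is computed by an orthogonal
    projection. The events whose indicators are mean-square limits of elements of
    this algebra form a sigma-algebra that contains the past, the other components
    and the other increments.

    A random direction ([small_kernel_minor]): [phi] may depend on everything. If the
    matrix of increments nearly annihilates a unit vector, one of its minors is
    almost maximal among its extensions by a row [k] and a fixed column [i].
    Expanding the extended minor, the increment [k] of the component [i] is close
    to a centre computed from the pivot rows and the other columns. Each
    remaining row then costs a factor [3 / 4], and there are only polynomially
    many minors.

    The conditional expectations exist by the Radon-Nikodym theorem, once the
    roughness is known to be measurable ([roughness_measurable], by continuity of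
    the paths), and the inequalities pass to all their versions. The tail bound
    implies that the roughness is almost surely positive and that its negative
    moments are finite, hence so are their conditional expectations. *)

(** * Local nondeterminism on a grid *)

Section power.
Context {R : realType}.
Implicit Types (a x z : R).

Lemma powR_le_tangent a x : 0 < a <= 1 -> 0 <= x -> x `^ a <= 1 + a * (x - 1).
Proof.
move=> /andP[a0 a1] x0; have [->|an1] := eqVneq a 1.
  by rewrite powRr1 // mul1r addrC subrK.
have a1' : a < 1 by rewrite lt_neqAle an1.
have h := @conjugate_powR R (x `^ a) 1 a^-1 (1 - a)^-1 (powR_ge0 _ _) ler01.
have := h _ _ _; rewrite !invrK !invr_gt0 subr_gt0 => /(_ a0 a1').
rewrite addrC subrK => /(_ erefl).
rewrite -powRrM mulfV ?gt_eqF// powRr1// mulr1 powR1 mul1r => /le_trans; apply.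
by rewrite le_eqVlt; apply/orP; left; apply/eqP; ring.
Qed.

(** Bounding both factors of [1 + z = (1 + z / 2) * (1 + z / (2 + z))] by the
    tangent at [1] gains the quadratic term that the tangent alone misses. *)
Lemma powR_le_tangent2 a z : 0 < a <= 1 -> 0 <= z <= 1 ->
  (1 + z) `^ a <= 1 + a * z - a * (1 - a) / 6 * z ^+ 2.
Proof.
move=> a01 /andP[z0 z1]; have /andP[a0 a1] := a01.
have e : 1 + z = (1 + z / 2) * (1 + z / (2 + z)) by field; lra.
have q0 : 0 <= z / (2 + z) by apply: divr_ge0; lra.
rewrite e powRM; [|lra|lra].
have h1 := @powR_le_tangent a (1 + z / 2) a01 ltac:(lra).
have h2 := @powR_le_tangent a (1 + z / (2 + z)) a01 ltac:(lra).
apply: le_trans (ler_pM (powR_ge0 _ _) (powR_ge0 _ _) h1 h2) _.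
rewrite -subr_ge0.
have -> : 1 + a * z - a * (1 - a) / 6 * z ^+ 2 -
  (1 + a * (1 + z / 2 - 1)) * (1 + a * (1 + z / (2 + z) - 1)) =
  a * (1 - a) * z ^+ 2 * ((1 - z) / (6 * (2 + z))) by field; lra.
apply: mulr_ge0; first by rewrite !mulr_ge0 ?sqr_ge0//; lra.
by apply: divr_ge0; lra.
Qed.

Definition pow_nat a (u : nat) : R := u%:R `^ a.

(** Minus the second difference of [u `^ a]: the weight of [minn u r] in the
    decomposition of [u `^ a] into concave kinks. *)
Definition kink a (r : nat) : R :=
  2 * pow_nat a r - pow_nat a r.+1 - pow_nat a r.-1.

Lemma kink_ge a (r : nat) : 0 < a <= 1 -> (0 < r)%N ->
  a * (1 - a) / 6 * r%:R `^ (a - 2) <= kink a r.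
Proof.
move=> a01 r0; have /andP[a0 a1] := a01.
have rp : 0 < r%:R :> R by rewrite ltr0n.
set z : R := r%:R^-1.
have z0 : 0 < z by rewrite invr_gt0.
have z1 : z <= 1 by rewrite invf_le1// ler1n.
have E1 : r.+1%:R = r%:R * (1 + z) :> R.
  by rewrite mulrDr mulr1 mulfV ?gt_eqF// -natr1.
have E2 : r.-1%:R = r%:R * (1 - z) :> R.
  by rewrite mulrBr mulr1 mulfV ?gt_eqF// -subn1 natrB.
have F1 := @powR_le_tangent2 a z a01 ltac:(by rewrite ltW).
have F2 := @powR_le_tangent a (1 - z) a01 ltac:(by rewrite subr_ge0).
have zm : 0 <= 1 - z by rewrite subr_ge0.
have zp : 0 <= 1 + z by rewrite addr_ge0// ltW.
have rp' := ltW rp.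
rewrite /kink /pow_nat E1 E2 !powRM//.
have -> : r%:R `^ (a - 2) = r%:R `^ a * z ^+ 2 :> R.
  rewrite powRD; last by rewrite (gt_eqF rp) implybT.
  by rewrite powRN -[2]/(2%:R) powR_mulrn// /z exprVn.
have P := powR_ge0 (r%:R : R) a.
rewrite -subr_ge0.
rewrite [X in 0 <= X](_ : _ = r%:R `^ a * (2 - (1 + z) `^ a - (1 - z) `^ a
  - a * (1 - a) / 6 * z ^+ 2)); last by ring.
apply: mulr_ge0 => //; lra.
Qed.

Lemma kink_ge0 a (r : nat) : 0 < a <= 1 -> (0 < r)%N -> 0 <= kink a r.
Proof.
move=> a01 r0; apply: le_trans (kink_ge a01 r0).
apply: mulr_ge0; last exact: powR_ge0.
case/andP: a01 => a0 a1; nra.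
Qed.

(** Summation by parts: a concave function vanishing at [0] is a positive
    mixture of the functions [minn r]. *)
Lemma pow_nat_kinks a (K u : nat) : 0 < a -> (u <= K.+1)%N ->
  pow_nat a u = \sum_(1 <= r < K.+1) kink a r * (minn r u)%:R
    + (pow_nat a K.+1 - pow_nat a K) * (minn K.+1 u)%:R.
Proof.
move=> a0; have f0 : pow_nat a 0 = 0 by rewrite /pow_nat powR0// gt_eqF.
elim: K u => [|K IH] u uK.
  rewrite big_geq// add0r f0 subr0.
  by case: u uK => [|[|]]//= _; rewrite ?minn0 ?f0 ?mulr0 ?minnn ?mulr1.
rewrite big_nat_recr//=.
have step v : (v <= K.+1)%N -> pow_nat a v =
  \sum_(1 <= i < K.+1) kink a i * (minn i v)%:R + kink a K.+1 * v%:R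
   + (pow_nat a K.+2 - pow_nat a K.+1) * v%:R.
  move=> vK; rewrite (IH v vK) (minn_idPr vK) /kink /=; ring.
move: uK; rewrite leq_eqVlt => /orP[/eqP->|uK]; last first.
  by rewrite step// (minn_idPr _)// (minn_idPr _)// ltnW.
rewrite minnn (minn_idPl _)//.
rewrite (eq_big_nat _ _ (F2 := fun i => kink a i * (minn i K.+1)%:R)); last first.
  move=> i /andP[i1 i2]; rewrite !(minn_idPl _)//; first exact: ltnW.
  by rewrite ltnW// ltnW.
rewrite -[K.+2%:R]natr1 mulrDr mulr1 addrA -step//; ring.
Qed.

Lemma pow_nat_le a (u v : nat) : 0 < a -> (u <= v)%N -> pow_nat a u <= pow_nat a v.
Proof.
move=> a0 uv; apply: ge0_ler_powR; rewrite ?nnegrE ?ler_nat ?ler0n//.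
exact: ltW.
Qed.
End power.

Section grid_energy.
Context {R : realType}.
Implicit Types (l : seq (R * nat)) (M r x : nat).

(** [u - v] is truncated, so this is the distance. *)
Definition dist_nat (u v : nat) : nat := ((u - v) + (v - u))%N.

(** A combination with total mass [0], as a list of pairs (coefficient,
    position), is minus the derivative of this step function,
    which vanishes at both ends. *)
Definition cum l x : R := \sum_(y <- l) y.1 * (x < y.2)%N%:R.

Definition osc l M r : R := \sum_(0 <= x < M) (cum l (x + r) - cum l x) ^+ 2.

Definition grid_energy (a : R) l : R :=
  - \sum_(y <- l) \sum_(y' <- l) y.1 * y'.1 * pow_nat a (dist_nat y.2 y'.2).

Lemma cumB l x r :
  cum l x - cum l (x + r) = \sum_(y <- l) y.1 * (x < y.2 <= x + r)%N%:R.
Proof.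
rewrite /cum -sumrB; apply: eq_bigr => y _; rewrite -mulrBr; congr (_ * _).
case: (ltnP x y.2) => h1; case: (ltnP (x + r) y.2) => h2 /=;
  rewrite ?subrr ?subr0//.
by move: (leq_ltn_trans (leq_trans h1 (leq_addr r x)) h2); rewrite ltnn.
Qed.

Lemma sum_itv M (lo hi : nat) : (hi <= M)%N ->
  \sum_(0 <= x < M) (lo <= x < hi)%N%:R = (hi - lo)%:R :> R.
Proof.
move=> hM; rewrite -natr_sum; congr (_%:R).
rewrite -big_mkcond /= -[RHS]muln1 -sum_nat_const_nat.
have [lh|hl] := leqP lo hi; last first.
  rewrite [RHS]big_geq ?(ltnW hl)// big_pred0// => x.
  by apply/negbTE/negP => /andP[h1 h2]; lia.
rewrite (big_cat_nat _ _ (n := lo))//=; last exact: leq_trans hM.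
rewrite (big_cat_nat _ _ (n := hi) (m := lo))//=.
rewrite [X in (X + _)%N]big_nat_cond [X in (X + _)%N]big_pred0 ?add0n; last by move=> x; lia.
rewrite [X in (_ + X)%N]big_nat_cond [X in (_ + X)%N]big_pred0 ?addn0; last by move=> x; lia.
rewrite big_nat_cond [RHS]big_nat_cond; apply: eq_bigl => x; lia.
Qed.

(** Two windows of length [r] overlap on a length given by a tent function; the
    lower bound [r] on the positions keeps both windows in the range of the sum. *)
Lemma sum_tent M r (u v : nat) : (r <= u <= M)%N -> (r <= v <= M)%N ->
  \sum_(0 <= x < M) (x < u <= x + r)%N%:R * (x < v <= x + r)%N%:R
    = (r - minn r (dist_nat u v))%N%:R :> R.
Proof.
move=> /andP[u1 u2] /andP[v1 v2].
rewrite (eq_bigr (fun x => (maxn (u - r) (v - r) <= x < minn u v)%N%:R)); last first.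
  by move=> x _; rewrite -natrM mulnb; congr (_%:R); congr nat_of_bool; lia.
rewrite sum_itv; last lia.
by congr (_%:R); rewrite /dist_nat; lia.
Qed.

Lemma osc_tent l M r : (forall y, y \in l -> (r <= y.2 <= M)%N) ->
  osc l M r = \sum_(y <- l) \sum_(y' <- l)
    y.1 * y'.1 * (r - minn r (dist_nat y.2 y'.2))%N%:R.
Proof.
move=> hl; rewrite /osc.
under eq_bigr do rewrite -sqrrN opprB cumB expr2 mulr_suml.
rewrite exchange_big big_seq [RHS]big_seq; apply: eq_bigr => y yl /=.
under eq_bigr do rewrite mulr_sumr.
rewrite exchange_big big_seq [RHS]big_seq; apply: eq_bigr => y' yl' /=.
rewrite -(@sum_tent M) ?hl// mulr_sumr; apply: eq_bigr => x _; ring.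
Qed.

Lemma osc_min l M r : (forall y, y \in l -> (r <= y.2 <= M)%N) ->
  \sum_(y <- l) y.1 = 0 ->
  osc l M r = - \sum_(y <- l) \sum_(y' <- l)
    y.1 * y'.1 * (minn r (dist_nat y.2 y'.2))%:R.
Proof.
move=> hl l0; rewrite osc_tent//.
under eq_bigr do under eq_bigr do rewrite natrB ?geq_minl// mulrBr.
under eq_bigr do rewrite sumrB -mulr_suml -mulr_sumr l0 mulr0 mul0r sub0r.
by rewrite sumrN.
Qed.

Lemma osc_ge0 l M r : 0 <= osc l M r.
Proof. by apply: sumr_ge0 => x _; exact: sqr_ge0. Qed.

(** The energy is a mixture, with nonnegative weights, of the mean-square
    oscillations of the step function at all scales. This replaces the spectral
    representation of the fractional covariance. *)
Lemma grid_energyE (a : R) l M K : 0 < a ->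
  (forall y, y \in l -> (K.+1 <= y.2 <= M)%N) ->
  (forall y y', y \in l -> y' \in l -> (dist_nat y.2 y'.2 <= K.+1)%N) ->
  \sum_(y <- l) y.1 = 0 ->
  grid_energy a l = \sum_(1 <= r < K.+1) kink a r * osc l M r +
    (pow_nat a K.+1 - pow_nat a K) * osc l M K.+1.
Proof.
move=> a0 hl dl l0.
rewrite osc_min// [in RHS](eq_big_nat _ _ (F2 := fun r => - (\sum_(y <- l)
  \sum_(y' <- l) y.1 * y'.1 * (kink a r * (minn r (dist_nat y.2 y'.2))%:R)))); last first.
  move=> r /andP[r1 rK]; rewrite osc_min//; last first.
    by move=> y /hl /andP[h1 ->]; rewrite andbT (leq_trans _ h1)// ltnW.
  rewrite mulrN; congr (- _); rewrite mulr_sumr; apply: eq_bigr => y _.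
  by rewrite mulr_sumr; apply: eq_bigr => y' _; ring.
rewrite sumrN mulrN -opprD /grid_energy; congr (- _).
rewrite [X in _ = X + _]exchange_big mulr_sumr -big_split /= big_seq [RHS]big_seq.
apply: eq_bigr => y yl; rewrite [X in _ = X + _]exchange_big mulr_sumr -big_split /=.
rewrite big_seq [RHS]big_seq; apply: eq_bigr => y' yl'.
rewrite (@pow_nat_kinks _ a K)//; last exact: dl.
rewrite mulrDr mulr_sumr; congr (_ + _); ring.
Qed.
End grid_energy.

Section grid_bound.
Context {R : realType}.
Implicit Types (l : seq (R * nat)) (M r x : nat).

Lemma cum_eq0 l M x : (forall y, y \in l -> (y.2 <= M)%N) -> (M <= x)%N ->
  cum l x = 0.
Proof.
move=> hl Mx; rewrite /cum big_seq big1// => y yl.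
by rewrite ltnNge (leq_trans (hl _ yl) Mx) mulr0.
Qed.

Lemma sum_shift (n k : nat) (f : nat -> R) :
  \sum_(0 <= i < n) f (i + k)%N = \sum_(k <= z < n + k) f z.
Proof. by have := big_addn 0 (n + k) k xpredT f; rewrite add0n addnK => ->. Qed.

Lemma osc_subadd l M r s : (forall y, y \in l -> (y.2 <= M)%N) ->
  osc l M (r + s) <= 2 * osc l M r + 2 * osc l M s.
Proof.
move=> hl; have h x : (cum l (x + (r + s)) - cum l x) ^+ 2 <=
  2 * (cum l (x + r) - cum l x) ^+ 2 + 2 * (cum l (x + r + s) - cum l (x + r)) ^+ 2.
  rewrite addnA; set u := cum l (x + r + s); set v := cum l (x + r); set w := cum l x.
  rewrite -subr_ge0; have -> : 2 * (v - w) ^+ 2 + 2 * (u - v) ^+ 2 - (u - w) ^+ 2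
    = (2 * v - u - w) ^+ 2 by ring.
  exact: sqr_ge0.
apply: le_trans (ler_sum _ (fun x _ => h x)) _.
rewrite big_split/= -!mulr_sumr; apply: lerD => //.
rewrite ler_pM2l//.
have -> : \sum_(0 <= i < M) (cum l (i + r + s) - cum l (i + r)) ^+ 2 =
  \sum_(r <= z < M + r) (cum l (z + s) - cum l z) ^+ 2.
  by rewrite (sum_shift M r (fun z => (cum l (z + s) - cum l z) ^+ 2)).
have zero z : (M <= z)%N -> (cum l (z + s) - cum l z) ^+ 2 = 0.
  by move=> Mz; rewrite !(cum_eq0 hl)// ?subrr ?expr0n// (leq_trans Mz)// leq_addr.
have [Mr|rM] := leqP M r.
  rewrite big_nat big1 ?osc_ge0// => z /andP[rz _]; exact/zero/(leq_trans Mr).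
rewrite (big_cat_nat _ _ (n := M))/=; [|exact: ltnW|exact: leq_addr].
rewrite [X in _ + X]big_nat [X in _ + X]big1 ?addr0; last first.
  by move=> z /andP[rz _]; exact: zero.
rewrite /osc [leRHS](big_cat_nat _ _ (n := r))//=; last exact: ltnW.
by rewrite lerDr sumr_ge0// => z _; exact: sqr_ge0.
Qed.

(** Subadditivity, applied to [r = s + (r - s)] for every [s], compares the
    oscillation at one scale with its average over the smaller scales. *)
Lemma osc_avg l M r : (forall y, y \in l -> (y.2 <= M)%N) -> (0 < r)%N ->
  r%:R * osc l M r <= 4 * \sum_(1 <= s < r.+1) osc l M s.
Proof.
move=> hl r0; rewrite big_nat_recr//= mulrDr.
have -> : r%:R = r.-1%:R + 1 :> R by rewrite natr1 prednK.
rewrite mulrDl; apply: lerD; last by have := osc_ge0 l M r; lra.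
have -> : 4 * \sum_(1 <= i < r) osc l M i =
  \sum_(1 <= i < r) (2 * osc l M i + 2 * osc l M (r - i)).
  rewrite big_split/= -!mulr_sumr.
  have <- : \sum_(1 <= i < r) osc l M i = \sum_(1 <= i < r) osc l M (r - i).
    rewrite big_nat_rev/=; apply: eq_big_nat => i /andP[i1 i2].
    by congr (osc _ _ _); lia.
  by rewrite -mulrDl; congr (_ * _); ring.
rewrite mulr_natl -subn1 -(sumr_const_nat r 1).
apply: ler_sum_nat => i /andP[i1 i2].
by rewrite -[X in osc l M X <= _](subnKC (ltnW i2)) osc_subadd.
Qed.

Lemma sqr_sum_le (n : nat) (f : nat -> R) :
  (\sum_(0 <= x < n) f x) ^+ 2 <= n%:R * \sum_(0 <= x < n) f x ^+ 2.
Proof.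
have [->|n0] := posnP n; first by rewrite !big_geq// mulr0 expr0n.
set S := \sum_(0 <= x < n) f x.
have : 0 <= \sum_(0 <= x < n) (n%:R * f x - S) ^+ 2.
  by apply: sumr_ge0 => x _; exact: sqr_ge0.
under eq_bigr do rewrite sqrrB exprMn.
rewrite big_split/= sumrB -mulr_sumr sumr_const_nat subn0.
have -> : \sum_(0 <= i < n) n%:R * f i * S *+ 2 = n%:R * S * S *+ 2.
  by rewrite sumrMnl -mulr_suml -mulr_sumr.
have -> : S ^+ 2 *+ n = n%:R * S ^+ 2 by rewrite mulr_natl.
have -> : n%:R ^+ 2 * \sum_(0 <= i < n) f i ^+ 2 - n%:R * S * S *+ 2 + n%:R * S ^+ 2
  = n%:R * (n%:R * \sum_(0 <= i < n) f i ^+ 2 - S ^+ 2) by ring.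
by rewrite pmulr_rge0 ?ltr0n// subr_ge0.
Qed.

Definition avg l (p n : nat) : R := n%:R^-1 * \sum_(0 <= x < n) cum l (p + x).

(** Doubling the window changes the mean of the step function by an average of
    increments at scale [n]. *)
Lemma avg_double l M p n : (0 < n)%N -> (forall y, y \in l -> (y.2 <= M)%N) ->
  (avg l p n - avg l p (n + n)) ^+ 2 <= (4 * n%:R)^-1 * osc l M n.
Proof.
move=> n0 hl; have np : 0 < n%:R :> R by rewrite ltr0n.
have -> : avg l p n - avg l p (n + n) =
  - (2 * n%:R)^-1 * \sum_(0 <= x < n) (cum l (p + x + n) - cum l (p + x)).
  rewrite /avg (big_cat_nat _ _ (n := n) (p := n + n))//=; last exact: leq_addr.
  rewrite -(sum_shift n n (fun x => cum l (p + x))) sumrB natrD.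
  have -> : \sum_(0 <= i < n) cum l (p + (i + n)) = \sum_(0 <= i < n) cum l (p + i + n).
    by apply: eq_bigr => i _; rewrite addnA.
  by field; lra.
rewrite exprMn sqrrN.
apply: le_trans (ler_wpM2l (sqr_ge0 _) (sqr_sum_le _ _)) _.
rewrite mulrA.
have -> : (2 * n%:R)^-1 ^+ 2 * n%:R = (4 * n%:R)^-1 :> R by field; lra.
rewrite ler_pM2l; last by rewrite invr_gt0; lra.
have -> : \sum_(0 <= i < n) (cum l (p + i + n) - cum l (p + i)) ^+ 2 =
  \sum_(p <= z < n + p) (cum l (z + n) - cum l z) ^+ 2.
  rewrite -(sum_shift n p (fun z => (cum l (z + n) - cum l z) ^+ 2)).
  by apply: eq_bigr => i _; rewrite [(p + i)%N]addnC.
have zero z : (M <= z)%N -> (cum l (z + n) - cum l z) ^+ 2 = 0.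
  by move=> Mz; rewrite !(cum_eq0 hl)// ?subrr ?expr0n// (leq_trans Mz)// leq_addr.
apply: (@le_trans _ _ (\sum_(0 <= z < M + (n + p)) (cum l (z + n) - cum l z) ^+ 2)).
  rewrite [leRHS](big_cat_nat _ _ (n := p))//=; last lia.
  rewrite [X in _ <= _ + X](big_cat_nat _ _ (n := (n + p)%N))//=; [|lia|lia].
  rewrite addrCA lerDl addr_ge0// sumr_ge0// => z _; exact: sqr_ge0.
rewrite [leLHS](big_cat_nat _ _ (n := M))//=; last exact: leq_addr.
rewrite [X in _ + X]big_nat [X in _ + X]big1 ?addr0// => z /andP[rz _]; exact: zero.
Qed.

(** The weights of the scales below [r] are at least of order [r `^ (a - 2)], so
    the energy controls the average oscillation below [r], hence the one at [r]. *)
Lemma osc_le_energy (a : R) l M K r : 0 < a < 1 ->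
  (forall y, y \in l -> (K.+1 <= y.2 <= M)%N) ->
  (forall y y', y \in l -> y' \in l -> (dist_nat y.2 y'.2 <= K.+1)%N) ->
  \sum_(y <- l) y.1 = 0 -> (0 < r <= K)%N ->
  (4 * r%:R)^-1 * osc l M r <=
    r%:R `^ (- a) * (a * (1 - a) / 6)^-1 * grid_energy a l.
Proof.
move=> /andP[a0 a1] hl dl l0 /andP[r0 rK].
have a01 : 0 < a <= 1 by rewrite a0 ltW.
have hl' y : y \in l -> (y.2 <= M)%N by move=> /hl/andP[].
have rp : 0 < r%:R :> R by rewrite ltr0n.
set c := a * (1 - a) / 6; have c0 : 0 < c by rewrite /c; nra.
have le1 : c * r%:R `^ (a - 2) * \sum_(1 <= s < r.+1) osc l M s <= grid_energy a l.
  rewrite (grid_energyE a0 hl dl l0).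
  apply: (@le_trans _ _ (\sum_(1 <= s < K.+1) kink a s * osc l M s)); last first.
    rewrite lerDl mulr_ge0 ?osc_ge0// subr_ge0; exact: pow_nat_le.
  rewrite [leRHS](big_cat_nat _ _ (n := r.+1))//=.
  apply: (@le_trans _ _ (\sum_(1 <= s < r.+1) kink a s * osc l M s)); last first.
    rewrite lerDl big_nat sumr_ge0// => s /andP[s1 s2].
    rewrite mulr_ge0 ?osc_ge0// kink_ge0//; exact: leq_trans s1.
  rewrite mulr_sumr; apply: ler_sum_nat => s /andP[s1 s2].
  apply: ler_wpM2r; first exact: osc_ge0.
  apply: le_trans (kink_ge a01 s1); apply: ler_wpM2l; first exact: ltW.
  rewrite -(opprK (a - 2)) !(powRN _ (- (a - 2))) lef_pV2 ?posrE ?powR_gt0 ?ltr0n//.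
  by apply: ge0_ler_powR; rewrite ?nnegrE ?ler0n ?ler_nat//; lra.
clearbody c; have le2 := osc_avg hl' r0.
have P : 0 < r%:R `^ (a - 2) :> R by exact: powR_gt0.
have E : r%:R `^ (- a) * c^-1 = (4 * r%:R)^-1 * (4 * r%:R^-1 * (c * r%:R `^ (a - 2))^-1) :> R.
  have -> : r%:R `^ (a - 2) = r%:R `^ a * (r%:R^-1) ^+ 2 :> R.
    rewrite powRD; last by rewrite (gt_eqF rp) implybT.
    by rewrite powRN -[2]/(2%:R) powR_mulrn ?ltW// exprVn.
  have Pa : 0 < r%:R `^ a :> R by exact: powR_gt0.
  rewrite powRN; field; rewrite !gt_eqF//.
rewrite E -[leRHS]mulrA ler_pM2l; last by rewrite invr_gt0 mulr_gt0.
have Q : osc l M r <= r%:R^-1 * (4 * \sum_(1 <= s < r.+1) osc l M s).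
  by rewrite ler_pdivlMl.
have cP : 0 < c * r%:R `^ (a - 2) by exact: mulr_gt0.
apply: le_trans Q _; rewrite [4 / r%:R]mulrC -!mulrA !ler_pM2l ?invr_gt0//.
by rewrite ler_pdivlMl.
Qed.

End grid_bound.

Section grid_lnd.
Context {R : realType}.
Implicit Types (l : seq (R * nat)) (M r x : nat).

Definition shift_grid K l : seq (R * nat) := [seq (y.1, (y.2 + K)%N) | y <- l].

Lemma cum_shift K l x : cum (shift_grid K l) (x + K) = cum l x.
Proof.
by rewrite /cum big_map; apply: eq_bigr => y _ /=; rewrite ltn_add2r.
Qed.

Lemma grid_energy_shift a K l : grid_energy a (shift_grid K l) = grid_energy a l.
Proof.
rewrite /grid_energy big_map; congr (- _); apply: eq_bigr => y _.
rewrite big_map; apply: eq_bigr => y' _ /=; congr (_ * pow_nat _ _).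
by rewrite /dist_nat; lia.
Qed.

Lemma grid_ub l : exists B : nat, forall y, y \in l -> (y.2 <= B)%N.
Proof.
exists (\max_(y <- l) y.2)%N => y yl; exact: (@leq_bigmax_seq _ l xpredT snd).
Qed.

(** The grid is translated far to the right, so that all the scales up to [n]
    are available in the kink decomposition. *)
Lemma avg_double_energy a l p n : 0 < a < 1 -> \sum_(y <- l) y.1 = 0 -> (0 < n)%N ->
  (avg l p n - avg l p (n + n)) ^+ 2 <=
    n%:R `^ (- a) * (a * (1 - a) / 6)^-1 * grid_energy a l.
Proof.
move=> a01 l0 n0; have [B hB] := grid_ub l.
pose K := maxn n B; pose l' := shift_grid K.+1 l; pose M := (B + K.+1)%N.
have hl' y : y \in l' -> (K.+1 <= y.2 <= M)%N.
  move=> /mapP[z zl ->] /=; rewrite leq_addl /M leq_add2r; exact: hB.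
rewrite -(grid_energy_shift a K.+1 l).
have av m : avg l p m = avg l' (p + K.+1) m.
  rewrite /avg; congr (_ * _); apply: eq_bigr => x _.
  by rewrite -(cum_shift K.+1) addnAC.
rewrite !av.
apply: le_trans (@avg_double _ l' M _ _ n0 _) _.
  by move=> y /hl' /andP[].
apply: (osc_le_energy a01 hl'); last by rewrite n0 leq_maxl.
- move=> y y' /mapP[z zl ->] /mapP[z' zl' ->] /=.
  have BK : (B <= K)%N by exact: leq_maxr.
  move: (hB _ zl) (hB _ zl') BK; rewrite /dist_nat.
  by move: (z.2) (z'.2) (K) => u v k; lia.
- by rewrite big_map.
Qed.

Lemma grid_energy_ge0 a l : 0 < a <= 1 -> \sum_(y <- l) y.1 = 0 ->
  0 <= grid_energy a l.
Proof.
move=> a01 l0; have [B hB] := grid_ub l.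
have /andP[a0 _] := a01.
rewrite -(grid_energy_shift a B.+1 l).
rewrite (@grid_energyE _ a _ (B + B.+1) B)//; last by rewrite big_map.
- apply: addr_ge0; last first.
    rewrite mulr_ge0 ?osc_ge0// subr_ge0; exact: pow_nat_le.
  rewrite big_nat sumr_ge0// => r /andP[r1 _].
  by rewrite mulr_ge0 ?osc_ge0 ?kink_ge0.
- by move=> y /mapP[z zl ->] /=; rewrite leq_addl leq_add2r hB.
- move=> y y' /mapP[z zl ->] /mapP[z' zl' ->] /=.
  move: (hB _ zl) (hB _ zl'); rewrite /dist_nat.
  by move: (z.2) (z'.2) => u v; lia.
Qed.

Lemma avg_small l p : exists2 B : R, 0 <= B & forall n, (0 < n)%N ->
  `|avg l p n| <= B / n%:R.
Proof.
have [M hM] := grid_ub l.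
exists (\sum_(0 <= x < M) `|cum l (p + x)|) => [|n n0].
  by apply: sumr_ge0.
rewrite /avg normrM ger0_norm ?invr_ge0// mulrC ler_wpM2r ?invr_ge0//.
apply: le_trans (ler_norm_sum _ _ _) _.
apply: (@le_trans _ _ (\sum_(0 <= x < M + n) `|cum l (p + x)|)).
  by rewrite [leRHS](big_cat_nat _ _ (n := n))//= ?leq_addl// lerDl sumr_ge0.
rewrite [leLHS](big_cat_nat _ _ (n := M))//= ?leq_addr//.
rewrite [X in _ + X]big_nat [X in _ + X]big1 ?addr0// => x /andP[x1 _].
by rewrite (cum_eq0 hM) ?normr0// (leq_trans x1)// leq_addl.
Qed.

Lemma geo_sum_le (rho : R) n : 0 <= rho < 1 ->
  \sum_(0 <= j < n) rho ^+ j <= (1 - rho)^-1.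
Proof.
move=> /andP[r0 r1]; have p : 0 < 1 - rho by rewrite subr_gt0.
rewrite -[leRHS]mul1r ler_pdivlMr// big_mkord.
have -> : (\sum_(i < n) rho ^+ i) * (1 - rho) = 1 - rho ^+ n.
  by rewrite -[RHS]opprB subrX1 -mulNr opprB mulrC.
by rewrite lerBlDr lerDl exprn_ge0.
Qed.

Definition lnd_ratio a : R := 2 `^ (- (a / 2)).

Lemma lnd_ratio01 a : 0 < a -> 0 <= lnd_ratio a < 1.
Proof.
move=> a0; rewrite powR_ge0/= /lnd_ratio powRN invf_lt1 ?powR_gt0//.
have : 1 `^ (a / 2) < 2 `^ (a / 2) :> R.
  by rewrite gt0_ltr_powR ?nnegrE ?ltr1n// divr_gt0.
by rewrite powR1.
Qed.

(** The step function equals [1] on a window of length [d], and its means over the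
    windows of length [2 ^ j * d] tend to [0]; the increments of these means
    form a geometric series controlled by the energy. *)
Lemma grid_lnd_lt1 a l p d : 0 < a < 1 -> (0 < d)%N -> \sum_(y <- l) y.1 = 0 ->
  (forall x, (p <= x < p + d)%N -> cum l x = 1) ->
  a * (1 - a) / 6 * (1 - lnd_ratio a) ^+ 2 * d%:R `^ a <= grid_energy a l.
Proof.
move=> a01 d0 l0 h1; have /andP[a0 a1] := a01.
have dp : 0 < d%:R :> R by rewrite ltr0n.
have E0 : 0 <= grid_energy a l by apply: grid_energy_ge0; rewrite ?a0 ?ltW.
set c := a * (1 - a) / 6; have c0 : 0 < c by rewrite /c; nra.
have /andP[r0 r1] := lnd_ratio01 a0; set rho := lnd_ratio a in r0 r1 *.
pose e := Num.sqrt (c^-1 * grid_energy a l).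
have avd : avg l p d = 1.
  rewrite /avg (eq_big_nat _ _ (F2 := fun=> 1)); last first.
    by move=> x /andP[_ xd]; rewrite h1// leq_addr ltn_add2l.
  by rewrite sumr_const_nat subn0 mulVf// gt_eqF.
have step n : (0 < n)%N -> `|avg l p n - avg l p (n + n)| <= n%:R `^ (- (a / 2)) * e.
  move=> n0; rewrite -(ler_pXn2r (n := 2))// ?nnegrE ?mulr_ge0 ?powR_ge0 ?sqrtr_ge0//.
  rewrite real_normK ?num_real// exprMn sqr_sqrtr; last first.
    by rewrite mulr_ge0// invr_ge0 ltW.
  rewrite -(powR_mulrn 2 (powR_ge0 n%:R _)) -powRrM mulNr divfK// mulrA.
  exact: avg_double_energy.
pose N j := (2 ^ j * d)%N.
have N0 j : (0 < N j)%N by rewrite muln_gt0 expn_gt0.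
have Npow j : (N j)%:R `^ (- (a / 2)) = rho ^+ j * d%:R `^ (- (a / 2)) :> R.
  rewrite natrM natrX powRM ?exprn_ge0 ?ler0n//; congr (_ * _).
  by rewrite /rho /lnd_ratio -(powR_mulrn j (powR_ge0 2 _)) -(powR_mulrn j (ler0n R 2)) -!powRrM mulrC.
have tel J : `|1 - avg l p (N J)| <=
    (\sum_(0 <= j < J) rho ^+ j) * (d%:R `^ (- (a / 2)) * e).
  elim: J => [|J IH]; first by rewrite big_geq// mul0r /N expn0 mul1n avd subrr normr0.
  rewrite big_nat_recr//= mulrDl.
  have -> : 1 - avg l p (N J.+1) = (1 - avg l p (N J)) + (avg l p (N J) - avg l p (N J.+1)).
    by ring.
  apply: le_trans (ler_normD _ _) _; apply: lerD => //.
  have -> : N J.+1 = (N J + N J)%N by rewrite /N expnS -mulnA mul2n addnn.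
  by rewrite mulrA -Npow; exact: step.
have bd J : `|1 - avg l p (N J)| <= (1 - rho)^-1 * (d%:R `^ (- (a / 2)) * e).
  apply: le_trans (tel J) _; apply: ler_wpM2r.
    by rewrite mulr_ge0 ?powR_ge0 ?sqrtr_ge0.
  by apply: geo_sum_le; rewrite r0.
have one : 1 <= (1 - rho)^-1 * (d%:R `^ (- (a / 2)) * e).
  apply/ler_addgt0Pr => eta eta0; have [B B0 hB] := avg_small l p.
  have Be : 0 <= B / eta by rewrite divr_ge0// ltW.
  set J := Num.bound (B / eta).
  have JB : B / eta < J%:R by apply: archi_boundP.
  apply: (@le_trans _ _ (`|1 - avg l p (N J)| + `|avg l p (N J)|)).
    by rewrite -[X in X <= _](normr1 R) -{1}(subrK (avg l p (N J)) 1) ler_normD.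
  apply: lerD => //; apply: le_trans (hB _ (N0 J)) _.
  rewrite ler_pdivrMr ?ltr0n// mulrC -ler_pdivrMr//; apply: (le_trans (ltW JB)).
  rewrite ler_nat /N; apply: (@leq_trans (2 ^ J)); first by rewrite ltnW// ltn_expl.
  by rewrite leq_pmulr.
have r1' : 0 < 1 - rho by rewrite subr_gt0.
have dd : 0 < d%:R `^ (a / 2) :> R by exact: powR_gt0.
have le2 : (1 - rho) * d%:R `^ (a / 2) <= e.
  by move: one; rewrite ler_pdivlMl// mulr1 powRN ler_pdivlMl// mulrC.
have : ((1 - rho) * d%:R `^ (a / 2)) ^+ 2 <= e ^+ 2.
  by rewrite ler_pXn2r ?nnegrE ?sqrtr_ge0// mulr_ge0 ?ltW.
rewrite exprMn /e sqr_sqrtr; last by rewrite mulr_ge0// invr_ge0 ltW.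
rewrite -(powR_mulrn 2 (ltW dd)) -powRrM divfK//.
by rewrite ler_pdivlMl// mulrA.
Qed.

(** For [a = 1] the kinks have weight [0]. Only the largest scale remains, and it
    compares the step function with [0]. *)
Lemma grid_lnd_eq1 l p d : (0 < d)%N -> \sum_(y <- l) y.1 = 0 ->
  (forall x, (p <= x < p + d)%N -> cum l x = 1) -> d%:R <= grid_energy 1 l.
Proof.
move=> d0 l0 h1; have [B hB] := grid_ub l.
rewrite -(grid_energy_shift 1 B.+1 l).
rewrite (@grid_energyE _ 1 _ (B + B.+1) B)//; last by rewrite big_map.
- rewrite big_nat big1 ?add0r; last first.
    move=> r /andP[r1 _]; rewrite /kink /pow_nat !powRr1//.
    case: r r1 => // r _ /=; rewrite -!natr1; ring.
  rewrite /pow_nat !powRr1// -natr1 addrAC subrr add0r mul1r.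
  have pdB : (p + d <= B)%N.
    rewrite leqNgt; apply/negP => Bpd.
    have pd : (p <= (p + d).-1 < p + d)%N by lia.
    have := h1 _ pd; rewrite (cum_eq0 hB); last lia.
    by move/eqP; rewrite eq_sym oner_eq0.
  rewrite /osc.
  rewrite (big_cat_nat _ _ (n := (p + B.+1)%N))//=; last lia.
  rewrite (big_cat_nat _ _ (n := (p + d + B.+1)%N) (m := (p + B.+1)%N))//=; [|lia|lia].
  rewrite addrCA; apply: (@le_trans _ _ (\sum_(p + B.+1 <= i < p + d + B.+1) (1 : R))).
    by rewrite sumr_const_nat (_ : _ - _ = d)%N//; lia.
  rewrite -[leLHS]addr0; apply: lerD; last first.
    by apply: addr_ge0; apply: sumr_ge0 => x _; exact: sqr_ge0.
  apply: ler_sum_nat => x /andP[x1 x2].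
  have -> : (x = (x - B.+1) + B.+1)%N by lia.
  rewrite !cum_shift (cum_eq0 hB); last lia.
  by rewrite h1 ?sub0r ?sqrrN ?expr1n//; lia.
- by move=> y /mapP[z zl ->] /=; rewrite leq_addl leq_add2r hB.
- move=> y y' /mapP[z zl ->] /mapP[z' zl' ->] /=.
  move: (hB _ zl) (hB _ zl'); rewrite /dist_nat.
  by move: (z.2) (z'.2) => u v; lia.
Qed.

Lemma grid_lnd a : 0 < a <= 1 -> exists2 c : R, 0 < c &
  forall l p d, (0 < d)%N -> \sum_(y <- l) y.1 = 0 ->
  (forall x, (p <= x < p + d)%N -> cum l x = 1) ->
  c * d%:R `^ a <= grid_energy a l.
Proof.
move=> /andP[a0]; rewrite le_eqVlt => /orP[/eqP ->|a1].
  by exists 1 => // l p d d0 l0 h1; rewrite mul1r powRr1//; exact: (@grid_lnd_eq1 l p).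
have /andP[r0 r1] := lnd_ratio01 a0.
exists (a * (1 - a) / 6 * (1 - lnd_ratio a) ^+ 2).
  by rewrite mulr_gt0 ?exprn_gt0 ?subr_gt0//; nra.
by move=> l p d d0 l0 h1; apply: (grid_lnd_lt1 _ d0 l0 h1); rewrite a0.
Qed.
End grid_lnd.

(** * Local nondeterminism of the fractional covariance *)

Section fbm_covariance.
Context {R : realType}.
Implicit Types (a s t : R) (l : seq (R * R)).

Lemma powR_subadd a s t : 0 < a <= 1 -> 0 <= s -> 0 <= t ->
  (s + t) `^ a <= s `^ a + t `^ a.
Proof.
move=> /andP[a0 a1]; rewrite le_eqVlt => /orP[/eqP <- _|s0].
  by rewrite add0r powR0 ?add0r// gt_eqF.
rewrite le_eqVlt => /orP[/eqP <-|t0].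
  by rewrite addr0 powR0 ?addr0// gt_eqF.
have st0 : 0 < s + t by exact: addr_gt0.
have P : 0 < (s + t) `^ a by exact: powR_gt0.
have h u : 0 < u -> u <= s + t -> u / (s + t) * (s + t) `^ a <= u `^ a.
  move=> u0 ust; have q0 : 0 < u / (s + t) by exact: divr_gt0.
  rewrite -[X in _ <= X `^ _](divfK (lt0r_neq0 st0) u).
  rewrite (powRM _ (ltW q0) (ltW st0)) ler_pM2r//; apply: ger1_powR => //.
  by rewrite q0 ler_pdivrMr// mul1r.
apply: le_trans (lerD (h s s0 _) (h t t0 _)); last 2 first.
- by rewrite lerDl ltW.
- by rewrite lerDr ltW.
by rewrite -mulrDl -mulrDl mulfV ?mul1r// gt_eqF.
Qed.

Lemma powR_dist_le a s t : 0 < a <= 1 -> 0 <= s -> 0 <= t ->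
  `|s `^ a - t `^ a| <= `|s - t| `^ a.
Proof.
move=> a01; wlog st : s t / s <= t => [H s0 t0|s0 t0].
  have [st|/ltW ts] := leP s t; first exact: H.
  by rewrite distrC [`|s - t|]distrC; exact: H.
have /andP[a0 _] := a01.
rewrite distrC [`|s - t|]distrC !ger0_norm ?subr_ge0//; last first.
  by apply: ge0_ler_powR; rewrite ?nnegrE// ltW.
rewrite lerBlDr -{1}(subrK s t).
by apply: powR_subadd; rewrite ?subr_ge0.
Qed.

Lemma dist_natE (u w : nat) : (dist_nat u w)%:R = `|u%:R - w%:R| :> R.
Proof.
rewrite /dist_nat; have [h|h] := leqP u w.
  by rewrite (eqP h) add0n natrB// distrC ger0_norm// subr_ge0 ler_nat.
have h' := ltnW h; rewrite [(w - u)%N](eqP h') addn0 natrB//.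
by rewrite ger0_norm// subr_ge0 ler_nat.
Qed.

(** The covariance of two finite linear combinations of values of a fractional
    Brownian motion of Hurst parameter [a / 2]; a combination is given by the
    list of its pairs (coefficient, time). *)
Definition cov a l l' : R := \sum_(x <- l) \sum_(y <- l') x.1 * y.1 *
  (2^-1 * (`|x.2| `^ a + `|y.2| `^ a - `|x.2 - y.2| `^ a)).

Definition energy a l : R :=
  - \sum_(x <- l) \sum_(y <- l) x.1 * y.1 * `|x.2 - y.2| `^ a.

Lemma cov_energy a l : 0 < a ->
  cov a l l = 2^-1 * energy a ((- \sum_(x <- l) x.1, 0) :: l).
Proof.
move=> a0; rewrite /energy /cov.
set S := \sum_(x <- l) x.1; set W := \sum_(x <- l) x.1 * `|x.2| `^ a.
set U := \sum_(x <- l) \sum_(y <- l) x.1 * y.1 * `|x.2 - y.2| `^ a.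
have -> : \sum_(x <- l) \sum_(y <- l) x.1 * y.1 *
   (2^-1 * (`|x.2| `^ a + `|y.2| `^ a - `|x.2 - y.2| `^ a)) =
   2^-1 * (W * S + S * W - U).
  rewrite /U /W /S !big_distrlr/= -big_split -sumrB mulr_sumr; apply: eq_bigr => x _ /=.
  by rewrite -big_split -sumrB mulr_sumr; apply: eq_bigr => y _ /=; ring.
congr (_ * _).
have z0 : `|(0 : R) - 0| `^ a = 0 by rewrite subrr normr0 powR0// gt_eqF.
rewrite big_cons big_cons/= z0 mulr0 add0r.
under eq_bigr do rewrite sub0r normrN -mulrA.
rewrite -mulr_sumr -/W.
have -> : \sum_(j <- l) \sum_(y <- (- S, 0) :: l) j.1 * y.1 * `|j.2 - y.2| `^ a
    = - S * W + U.
  rewrite /U /W mulr_sumr -big_split; apply: eq_bigr => x _ /=.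
  by rewrite big_cons/= subr0; congr (_ + _); ring.
ring.
Qed.

(** Real times are rounded to a grid of mesh [d / n]; as [n] grows the constant
    on the grid is kept and the energies converge. *)
Lemma energy_lnd a : 0 < a <= 1 -> exists2 c : R, 0 < c &
  forall l p d, 0 < d -> \sum_(x <- l) x.1 = 0 ->
  (forall x, x \in l -> x.2 <= p \/ p + d <= x.2) ->
  \sum_(x <- l | p + d <= x.2) x.1 = 1 ->
  c * d `^ a <= energy a l.
Proof.
move=> a01; have /andP[a0 a1] := a01.
have [c c0 Hc] := grid_lnd a01; exists c => // l p d d0 l0 hout h1.
have [L hL] : exists L : nat, forall x, x \in l -> 0 <= (x.2 - p) / d + L%:R.
  exists (Num.bound (\sum_(x <- l) `|(x.2 - p) / d|)) => x xl.
  have : `|(x.2 - p) / d| <= \sum_(x <- l) `|(x.2 - p) / d|.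
    by rewrite (big_rem x)//= lerDl sumr_ge0.
  have := archi_boundP (_ : 0 <= \sum_(x <- l) `|(x.2 - p) / d|) => /(_ _)/ltW h.
  move=> h2; have := le_trans h2 (h _); rewrite sumr_ge0// => /(_ isT).
  by rewrite ler_norml => /andP[]; lra.
pose v (x : R * R) := (x.2 - p) / d + L%:R.
pose gr n : seq (R * nat) := [seq (x.1, Num.truncn (n%:R * v x)) | x <- l].
pose W := \sum_(x <- l) \sum_(y <- l) `|x.1 * y.1|.
have tr n x : (0 < n)%N -> x \in l ->
   `|(Num.truncn (n%:R * v x))%:R / n%:R - v x| <= n%:R^-1.
  move=> n0 xl; have np : 0 < n%:R :> R by rewrite ltr0n.
  have nv : 0 <= n%:R * v x by rewrite mulr_ge0 ?hL.
  have /andP[t1 t2] := truncn_itv nv.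
  rewrite -natr1 in t2; set z := (Num.truncn _)%:R in t1 t2 *.
  have -> : z / n%:R - v x = (z - n%:R * v x) / n%:R by field; rewrite gt_eqF.
  rewrite normrM normfV (gtr0_norm np) -[leRHS]mul1r ler_pM2r ?invr_gt0//.
  by rewrite ler_norml; apply/andP; split; lra.
have step n : (0 < n)%N -> c <= d `^ (- a) * energy a l + W * (2 / n%:R) `^ a.
  move=> n0; have np : 0 < n%:R :> R by rewrite ltr0n.
  have npa : 0 < n%:R `^ a :> R by exact: powR_gt0.
  have := Hc (gr n) (n * L)%N n n0; rewrite big_map => /(_ l0).
  have H x : (n * L <= x < n * L + n)%N -> cum (gr n) x = 1.
    move=> /andP[x1 x2]; rewrite /cum big_map -[RHS]h1 [RHS]big_mkcond /=.
    rewrite big_seq [RHS]big_seq; apply: eq_bigr => y yl /=.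
    have nv : 0 <= n%:R * v y by rewrite mulr_ge0 ?hL.
    have /andP[t1 t2] := truncn_itv nv.
    have [yp|yp] := hout _ yl.
      rewrite ifF; last by apply/negbTE; rewrite -ltNge (le_lt_trans yp)// ltrDl.
      rewrite (_ : (x < _)%N = false) ?mulr0//; apply/negbTE; rewrite -leqNgt.
      apply: leq_trans x1; rewrite -(ler_nat R); apply: le_trans t1 _.
      rewrite natrM ler_pM2l// /v -[leRHS]add0r lerD2r.
      by rewrite ler_pdivrMr// mul0r subr_le0.
    rewrite yp (_ : (x < _)%N) ?mulr1//.
    rewrite -ltnS -(ltr_nat R); apply: le_lt_trans t2.
    apply: (@le_trans _ _ (n * L + n)%:R); first by rewrite ler_nat.
    rewrite natrD natrM -[X in _ + X]mulr1 -mulrDr ler_pM2l// addrC lerD2r.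
    by rewrite ler_pdivlMr// mul1r lerBrDr addrC.
  move=> /(_ H); rewrite mulrC -ler_pdivlMl// => /le_trans; apply.
  rewrite -powRN /grid_energy /energy big_map !mulrN -lerBlDl opprK addrC.
  apply: le_trans (ler_norm _) _.
  rewrite !mulr_sumr /W mulr_suml -sumrB.
  apply: le_trans (ler_norm_sum _ _ _) _.
  rewrite big_seq [leRHS]big_seq; apply: ler_sum => x xl.
  rewrite big_map !mulr_sumr mulr_suml -sumrB.
  apply: le_trans (ler_norm_sum _ _ _) _.
  rewrite big_seq [leRHS]big_seq; apply: ler_sum => y yl /=.
  set zx := Num.truncn _; set zy := Num.truncn _.
  have -> : d `^ (- a) * (x.1 * y.1 * `|x.2 - y.2| `^ a) -
    n%:R `^ (- a) * (x.1 * y.1 * pow_nat a (dist_nat zx zy)) =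
    x.1 * y.1 * (`|v x - v y| `^ a - `|zx%:R / n%:R - zy%:R / n%:R| `^ a).
    have -> : v x - v y = (x.2 - y.2) / d by rewrite /v; field; rewrite gt_eqF.
    rewrite -mulrBl !normrM !powRM// !normfV !(gtr0_norm np) !(gtr0_norm d0).
    have inv u : 0 < u -> u^-1 `^ a = u `^ (- a).
      by move=> u0; rewrite -powR_inv1 ?ltW// -powRrM mulN1r.
    rewrite !inv// /pow_nat.
    rewrite dist_natE.
    ring.
  rewrite normrM ler_wpM2l//; apply: le_trans (powR_dist_le _ _ _) _ => //.
  apply: ge0_ler_powR; rewrite ?nnegrE ?divr_ge0//; first exact: ltW.
  apply: le_trans (ler_dist_dist _ _) _.
  have := tr n x n0 xl; have := tr n y n0 yl; rewrite -/zx -/zy => hy hx.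
  have -> : v x - v y - (zx%:R / n%:R - zy%:R / n%:R) =
    (zy%:R / n%:R - v y) - (zx%:R / n%:R - v x) by ring.
  apply: le_trans (ler_normB _ _) _.
  apply: le_trans (lerD hy hx) _; rewrite -[X in _ <= X * _]natr1; lra.
have dp : 0 < d `^ a by exact: powR_gt0.
suff : c <= d `^ (- a) * energy a l by rewrite powRN ler_pdivlMl// mulrC.
have W0 : 0 <= W by apply: sumr_ge0 => x _; apply: sumr_ge0.
apply/ler_addgt0Pr => e e0.
have e' : 0 < e / (W + 1) by apply: divr_gt0 => //; lra.
pose n := (Num.bound (2 * (e / (W + 1)) `^ (- a^-1))).+1.
apply: le_trans (step n _) _ => //; rewrite lerD2l.
apply: (@le_trans _ _ (W * (e / (W + 1)))); last first.
  rewrite mulrA ler_pdivrMr; [|lra]; rewrite mulrC ler_pM2l//; lra.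
apply: ler_wpM2l => //.
have -> : e / (W + 1) = ((e / (W + 1)) `^ a^-1) `^ a.
  by rewrite -powRrM mulVf ?powRr1 ?ltW// gt_eqF.
apply: ge0_ler_powR; rewrite ?nnegrE ?divr_ge0 ?powR_ge0//; first exact: ltW.
rewrite ler_pdivrMr// -ler_pdivrMl ?powR_gt0// -powRN mulrC.
apply: le_trans (_ : _ <= (Num.bound (2 * (e / (W + 1)) `^ (- a^-1)))%:R) _.
  by apply/ltW/archi_boundP; rewrite mulr_ge0 ?powR_ge0.
by rewrite ler_nat.
Qed.

(** Local nondeterminism, with conditioning on both sides: given all the values
    outside the open interval [(p, p + d)], the increment over it keeps a
    standard deviation at least of order [d `^ (a / 2)]. The value at time [0],
    which is [0], absorbs the total mass of the combination. *)
Lemma cov_lnd a : 0 < a <= 1 -> exists2 c : R, 0 < c &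
  forall l p d, 0 <= p -> 0 < d ->
  (forall x, x \in l -> x.2 <= p \/ p + d <= x.2) ->
  \sum_(x <- l | p + d <= x.2) x.1 = 1 ->
  c * d `^ a <= cov a l l.
Proof.
move=> a01; have [c c0 H] := energy_lnd a01.
have /andP[a0 _] := a01.
exists (2^-1 * c); first by rewrite mulr_gt0// invr_gt0.
move=> l p d p0 d0 hout h1; rewrite cov_energy// -mulrA ler_pM2l ?invr_gt0//.
apply: (H _ p) => //.
- by rewrite big_cons/= addrC subrr.
- move=> x; rewrite inE => /orP[/eqP->/=|]; [by left|exact: hout].
- rewrite big_cons/= ifF//; apply/negbTE; rewrite -ltNge.
  by apply: le_lt_trans p0 _; rewrite ltrDl.
Qed.
End fbm_covariance.

(** * Gaussian integrals *)

Section integral_of_derivative.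
Context {R : realType}.
Notation mu := (@lebesgue_measure R).

(** The fundamental theorem of calculus on the two half-lines. *)
Lemma integral_derive_eq0 (h h' : R -> R) :
  (forall x : R, is_derive x (1 : R) h (h' x)) -> continuous h' ->
  mu.-integrable setT (EFin \o h') ->
  h x @[x --> +oo] --> (0 : R) -> h x @[x --> -oo] --> (0 : R) ->
  \int[mu]_x h' x = 0.
Proof.
move=> dh ch' ih' hp hm.
pose D (n : nat) : set R := `[- n.+1%:R, n.+1%:R]%classic.
pose f_ n : R -> \bar R := (EFin \o h') \_ (D n).
have mh' : measurable_fun setT (EFin \o h') by case/integrableP: ih'.
have mD n : measurable (D n) by exact: measurable_itv.
have ch : continuous h.
  by move=> x; apply/differentiable_continuous/derivable1_diffP; have [] := dh x.
have E n : (\int[mu]_x f_ n x = (h n.+1%:R - h (- n.+1%:R))%:E)%E.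
  rewrite /f_ -integral_mkcond (@continuous_FTC2 _ h' h)//.
  - by rewrite -subr_gt0 opprK addr_gt0.
  - exact: continuous_subspaceT.
  - split=> [x _||].
    + by have [] := dh x.
    + exact/cvg_at_right_filter/ch.
    + exact/cvg_at_left_filter/ch.
  - by move=> x _; rewrite derive1E; have [_ ->] := dh x.
have mf n : measurable_fun setT (f_ n).
  by apply/(measurable_restrictT _ _).1 => //; exact: measurable_funTS.
have cvf : {ae mu, forall x, setT x -> f_ n x @[n --> \oo] --> (EFin \o h') x}.
  apply/aeW => x _; apply: cvg_near_cst; near=> n.
  rewrite /f_ patchE ifT// inE /D /= in_itv/=.
  rewrite -ler_norml; apply: (@le_trans _ _ n%:R); last by rewrite ler_nat.
  near: n; exact: nbhs_infty_ger.
have df : {ae mu, forall x, forall n, setT x -> (`|f_ n x| <= (abse \o (EFin \o h')) x)%E}.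
  apply/aeW => x n _; rewrite /f_ patchE; case: ifPn => _ //=.
  by rewrite normr0 lee_fin.
have [_ _ cv] := @dominated_convergence _ _ R mu setT measurableT f_ (EFin \o h')
  (abse \o (EFin \o h')) mf mh' cvf (integrable_abse ih') df.
have {}cv : (h n.+1%:R - h (- n.+1%:R))%:E @[n --> \oo] --> (\int[mu]_x (h' x)%:E)%E.
  by under eq_fun do rewrite -E.
have cv0 : (h n.+1%:R - h (- n.+1%:R))%:E @[n --> \oo] --> (0 : R)%:E.
  apply: cvg_EFin; first by apply: nearW.
  have cS : (n.+1%:R : R) @[n --> \oo] --> +oo.
    by rewrite (cvg_shiftS (fun n : nat => n%:R : R)); exact: cvgr_idn.
  rewrite -(subr0 0); apply: cvgB.
  - exact: (cvg_comp _ _ cS hp).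
  - by move/cvgNy_compNP : hm => hm; exact: (cvg_comp _ _ cS hm).
by rewrite /Rintegral (cvg_unique _ cv cv0).
Unshelve. all: end_near. Qed.
End integral_of_derivative.

Section gaussian_integrals.
Context {R : realType} (sigma : R).
Hypothesis s0 : sigma != 0.
Notation mu := (@lebesgue_measure R).
Notation g := (normal_pdf 0 sigma).

Let mulr2n_natl (v : R) : 2 * v = v *+ 2. Proof. by rewrite mulr_natl. Qed.
Let s2 : 0 < sigma ^+ 2. Proof. by rewrite exprn_even_gt0. Qed.

Lemma normal_pdf_exp x : g x = normal_peak sigma * expR (- (x ^+ 2 / (sigma ^+ 2 *+ 2))).
Proof. by rewrite normal_pdfE//= /normal_fun subr0 mulNr. Qed.

Lemma is_derive_normal_pdf (x : R) :
  is_derive x (1 : R) g (- (x / sigma ^+ 2) * g x).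
Proof.
have -> : g = (fun x => normal_peak sigma * expR (- (x ^+ 2 / (sigma ^+ 2 *+ 2)))).
  by apply/funext => y; exact: normal_pdf_exp.
apply: is_derive_eq.
rewrite /GRing.scale /= -(mulr_natl (sigma ^+ 2) 2).
by field.
Qed.

(** A Gaussian density with doubled deviation absorbs the factor [x ^+ 2], which
    gives all the integrability that is needed. *)
Lemma sqr_normal_pdf_le x : x ^+ 2 * g x <=
  (8 * sigma ^+ 2 * (normal_peak sigma / normal_peak (2 * sigma))) * normal_pdf 0 (2 * sigma) x.
Proof.
have t0 : 2 * sigma != 0 by rewrite mulf_neq0.
rewrite normal_pdf_exp [in leRHS]normal_pdfE//= /normal_fun subr0 mulNr.
have p0 := normal_peak_gt0 s0; have p1 := normal_peak_gt0 t0.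
set k := normal_peak sigma in p0 *; set k' := normal_peak _ in p1 *.
set y := x ^+ 2 / (8 * sigma ^+ 2).
have y0 : 0 <= y by rewrite divr_ge0 ?sqr_ge0// mulr_ge0// ltW.
have -> : x ^+ 2 / ((2 * sigma) ^+ 2 *+ 2) = y by rewrite /y -mulr2n_natl; field.
have -> : expR (- (x ^+ 2 / (sigma ^+ 2 *+ 2))) = expR (- y) * expR (- y) * expR (- (2 * y)).
  by rewrite -!expRD; congr expR; rewrite /y -mulr2n_natl; field.
have -> : x ^+ 2 = y * (8 * sigma ^+ 2) by rewrite /y divfK// gt_eqF// mulr_gt0.
have -> : 8 * sigma ^+ 2 * (k / k') * (k' * expR (- y)) = 8 * sigma ^+ 2 * k * expR (- y).
  by field; rewrite gt_eqF.
have -> : y * (8 * sigma ^+ 2) * (k * (expR (- y) * expR (- y) * expR (- (2 * y)))) =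
  8 * sigma ^+ 2 * k * expR (- y) * (y * expR (- y) * expR (- (2 * y))) by ring.
rewrite -[leRHS]mulr1 ler_wpM2l//.
  by rewrite mulr_ge0 ?expR_ge0// mulr_ge0 ?(ltW p0)// mulr_ge0 ?(ltW s2).
clearbody y; rewrite -[leRHS]mulr1 ler_pM ?mulr_ge0 ?expR_ge0//.
  rewrite expRN ler_pdivrMr ?expR_gt0// mul1r.
  by apply: le_trans (expR_ge1Dx y); rewrite lerDr.
by rewrite -[leRHS]expR0 ler_expR oppr_le0 mulr_ge0.
Qed.

Lemma continuous_g : continuous (g : R -> R). Proof. exact: continuous_normal_pdf. Qed.

Lemma integrable_le_sqr (f : R -> R) : continuous f ->
  (forall x, `|f x| <= 1 + x ^+ 2) ->
  mu.-integrable setT (EFin \o (fun x => f x * g x)).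
Proof.
move=> cf fle.
set K := 8 * sigma ^+ 2 * (normal_peak sigma / normal_peak (2 * sigma)).
apply: (@le_integrable _ _ R mu setT measurableT _
  (EFin \o (fun x => g x + K * normal_pdf 0 (2 * sigma) x))).
- apply/measurable_EFinP; apply: continuous_measurable_fun => x.
  by apply: cvgM; [exact: cf|exact: continuous_g].
- move=> x _ /=; rewrite lee_fin.
  have h : 0 <= g x by exact: normal_pdf_ge0.
  have h2 := sqr_normal_pdf_le x.
  have h3 : 0 <= x ^+ 2 * g x by rewrite mulr_ge0// sqr_ge0.
  have P : 0 <= g x + K * normal_pdf 0 (2 * sigma) x by rewrite addr_ge0// (le_trans h3).
  rewrite (ger0_norm P) normrM (ger0_norm h).
  by apply: le_trans (ler_wpM2r h (fle x)) _; rewrite mulrDl mul1r lerD2l.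
- rewrite (_ : _ \o _ = (fun x => (g x)%:E + K%:E * (normal_pdf 0 (2 * sigma) x)%:E)%E).
    apply: integrableD => //; first exact: integrable_normal_pdf.
    apply: integrableZl => //; exact: integrable_normal_pdf.
  by apply/funext => x /=; rewrite EFinD EFinM.
Qed.

Lemma mul_pdf_small (f : R -> R) : (forall x, `|f x| <= 1 + `|x|) ->
  exists2 C : R, 0 < C & forall x, 1 <= `|x| -> `|f x * g x| <= C / `|x|.
Proof.
move=> fle.
pose K := 8 * sigma ^+ 2 * (normal_peak sigma / normal_peak (2 * sigma)) * normal_peak (2 * sigma).
have t0 : 2 * sigma != 0 by rewrite mulf_neq0.
have p0 := normal_peak_gt0 s0; have p1 := normal_peak_gt0 t0.
have K0 : 0 < K by apply: mulr_gt0 => //; apply: mulr_gt0; [exact: mulr_gt0|exact: divr_gt0].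
exists (2 * K); first by rewrite mulr_gt0.
move=> x x1; have xp : 0 < `|x| by exact: lt_le_trans x1.
have h : 0 <= g x by exact: normal_pdf_ge0.
rewrite ler_pdivlMr// normrM (ger0_norm h).
have h2 : x ^+ 2 * g x <= K.
  apply: le_trans (sqr_normal_pdf_le x) _; apply: ler_wpM2l; last exact: normal_pdf_ub.
  by apply/ltW; apply: mulr_gt0; [exact: mulr_gt0|exact: divr_gt0].
rewrite -(real_normK (num_real x)) in h2.
have h3 : `|f x| <= 2 * `|x| by apply: le_trans (fle x) _; lra.
apply: (@le_trans _ _ (2 * `|x| * g x * `|x|)).
  by rewrite ler_wpM2r// ler_wpM2r.
rewrite (_ : _ * _ * _ * _ = 2 * (`|x| ^+ 2 * g x)); last by ring.
by rewrite ler_pM2l.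
Qed.

Lemma mul_pdf_cvgy (f : R -> R) : (forall x, `|f x| <= 1 + `|x|) ->
  f x * g x @[x --> +oo] --> (0 : R).
Proof.
move=> /mul_pdf_small [C C0 hC]; apply/cvgrPdist_le => e e0; near=> x.
have x1 : 1 <= x by near: x; exact: nbhs_pinfty_ge.
have xC : C / e <= x by near: x; apply: nbhs_pinfty_ge; rewrite num_real.
have xp : 0 < x by exact: lt_le_trans x1.
rewrite sub0r normrN; apply: le_trans (hC x _) _; rewrite ger0_norm ?(ltW xp)//.
by rewrite ler_pdivrMr// mulrC -ler_pdivrMr.
Unshelve. all: end_near. Qed.

Lemma mul_pdf_cvgNy (f : R -> R) : (forall x, `|f x| <= 1 + `|x|) ->
  f x * g x @[x --> -oo] --> (0 : R).
Proof.
move=> /mul_pdf_small [C C0 hC]; apply/cvgrPdist_le => e e0; near=> x.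
have x1 : x <= -1 by near: x; exact: nbhs_ninfty_le.
have xC : x <= - (C / e) by near: x; apply: nbhs_ninfty_le; rewrite num_real.
have xp : x < 0 by exact: le_lt_trans x1 _.
rewrite sub0r normrN; apply: le_trans (hC x _) _; rewrite ltr0_norm//; [lra|].
by rewrite ler_pdivrMr ?oppr_gt0// mulrC -ler_pdivrMr// lerNr.
Unshelve. all: end_near. Qed.

Lemma is_derive_mul_pdf (f f' : R -> R) (x : R) : is_derive x (1 : R) f (f' x) ->
  is_derive x (1 : R) (fun x => f x * g x) ((f' x - x / sigma ^+ 2 * f x) * g x).
Proof.
move=> df; have dg := is_derive_normal_pdf x.
apply: is_derive_eq; rewrite /GRing.scale /=; ring.
Qed.

(** Integration by parts: the integrand is the derivative of [f * g]. *)
Lemma gauss_ibp (f f' : R -> R) :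
  (forall x : R, is_derive x (1 : R) f (f' x)) -> continuous f' ->
  (forall x, `|f x| <= 1 + `|x|) ->
  mu.-integrable setT (EFin \o (fun x => (f' x - x / sigma ^+ 2 * f x) * g x)) ->
  \int[mu]_x ((f' x - x / sigma ^+ 2 * f x) * g x) = 0.
Proof.
move=> df cf' fle int; apply: (integral_derive_eq0 (h := fun x => f x * g x)) => //.
- by move=> x; exact: is_derive_mul_pdf.
- have cf : continuous f.
    by move=> x; apply/differentiable_continuous/derivable1_diffP; have [] := df x.
  move=> x; apply: cvgM; last exact: continuous_g.
  apply: cvgB; first exact: cf'.
  by apply: cvgM; [apply: cvgMl; exact: cvg_id|exact: cf].
- exact: mul_pdf_cvgy.
- exact: mul_pdf_cvgNy.
Qed.

Lemma Rintegral_normal_pdf : \int[mu]_x g x = 1.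
Proof. by rewrite /Rintegral integral_normal_pdf. Qed.

Lemma gauss_second_moment : \int[mu]_x (x ^+ 2 * g x) = sigma ^+ 2.
Proof.
have i2 : mu.-integrable setT (EFin \o (fun x : R => x ^+ 2 * g x)).
  apply: integrable_le_sqr; first exact: exprn_continuous.
  by move=> x; rewrite ger0_norm ?sqr_ge0// lerDr.
have i1 := @integrable_normal_pdf R 0 sigma.
have i2' : mu.-integrable setT (EFin \o (fun x : R => (sigma ^+ 2)^-1 * (x ^+ 2 * g x))).
  rewrite (_ : _ \o _ = (fun x => ((sigma ^+ 2)^-1)%:E * (x ^+ 2 * g x)%:E)%E); last first.
    by apply/funext.
  exact: integrableZl.
have := @gauss_ibp id (cst 1).
have -> : (fun x : R => (cst 1 x - x / sigma ^+ 2 * id x) * g x) =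
   (fun x => g x - (sigma ^+ 2)^-1 * (x ^+ 2 * g x)).
  by apply/funext => x /=; ring.
rewrite RintegralB// RintegralZl// Rintegral_normal_pdf => H.
have /eqP : 1 - (sigma ^+ 2)^-1 * \int[mu]_x (x ^+ 2 * g x) = 0.
  apply: H.
  - by move=> x; exact: cvg_cst.
  - by move=> x; rewrite lerDr.
  - under [EFin \o _]eq_fun do rewrite /= EFinB.
    exact: (integrableB measurableT i1 i2').
by rewrite subr_eq0 => /eqP e; rewrite -[RHS]mulr1 e mulrA mulfV ?mul1r// gt_eqF.
Qed.

(** Differentiation under the integral, then integration by parts, turn the
    characteristic function into the solution of a linear equation. *)
Lemma is_derive_gauss_cos (th xi : R) :
  is_derive xi (1 : R) (fun xi => \int[mu]_x (cos (xi * x + th) * g x))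
    (- (sigma ^+ 2 * xi * \int[mu]_x (cos (xi * x + th) * g x))).
Proof.
pose f (xi x : R) := cos (xi * x + th) * g x.
pose C (xi : R) := \int[mu]_x f xi x.
have ccos (y : R) : continuous (fun x : R => cos (y * x + th)).
  move=> x; apply: (@continuous_comp _ _ _ (fun x => y * x + th) cos); last exact: continuous_cos.
  by apply: cvgD; [apply: cvgMr; exact: cvg_id|exact: cvg_cst].
have csin (y : R) : continuous (fun x : R => sin (y * x + th)).
  move=> x; apply: (@continuous_comp _ _ _ (fun x => y * x + th) sin); last exact: continuous_sin.
  by apply: cvgD; [apply: cvgMr; exact: cvg_id|exact: cvg_cst].
have intf y : mu.-integrable setT (EFin \o f y).
  apply: integrable_le_sqr; first exact: ccos.
  by move=> x; rewrite (le_trans (cos_max _))// lerDl sqr_ge0.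
have df y x : is_derive y (1 : R) (f ^~ x) (- sin (y * x + th) * x * g x).
  apply: is_derive_eq; rewrite /GRing.scale /=; ring.
have intxs y : mu.-integrable setT (EFin \o (fun x => (x * sin (y * x + th)) * g x)).
  apply: integrable_le_sqr.
    by move=> x; apply: cvgM; [exact: cvg_id|exact: csin].
  move=> x; rewrite normrM; apply: (@le_trans _ _ `|x|).
    by rewrite ler_piMr// sin_max.
  rewrite -(real_normK (num_real x)); have := sqr_ge0 (`|x| - 1); nra.
have intcos y : mu.-integrable setT (EFin \o (fun x => y * f y x)).
  rewrite (_ : _ \o _ = (fun x => y%:E * (f y x)%:E)%E); last exact/funext.
  exact: (integrableZl measurableT _ (intf y)).
have intG : mu.-integrable setT (EFin \o (fun x : R => `|x| * g x)).
  apply: integrable_le_sqr; first exact: norm_continuous.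
  move=> x; rewrite normr_id -(real_normK (num_real x)).
  by have := sqr_ge0 (`|x| - 1); have := normr_ge0 x; nra.
have G0 (x : R) : 0 <= `|x| * g x by rewrite mulr_ge0// normal_pdf_ge0.
have D1 y x : partial1of2 f y x = - sin (y * x + th) * x * g x.
  by rewrite partial1of2E; have [_ ->] := df y x.
have xin : `]xi - 1, xi + 1[%classic xi.
  by rewrite /= in_itv /= ltrBlDr ltrDl ltr01.
have Gub (y x : R) : `]xi - 1, xi + 1[%classic y -> setT x ->
    `|partial1of2 f y x| <= `|x| * g x.
  move=> _ _; rewrite D1 normrM (ger0_norm (normal_pdf_ge0 _ _ _)).
  rewrite ler_wpM2r ?normal_pdf_ge0// normrM normrN ler_piMl//.
  exact: sin_max.
have dC : derivable (C : R -> R) xi (1 : R).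
  apply: (@derivable_under_integral R _ _ mu f setT measurableT xi _ _ xin
     (fun y _ => intf y) _ _ G0 intG Gub).
  by move=> y x _ _; have [] := df y x.
have vC : (C : R -> R)^`()%classic xi = \int[mu]_x (- sin (xi * x + th) * x * g x).
  rewrite (@differentiation_under_integral R _ _ mu f setT measurableT xi _ _ xin
     (fun y _ => intf y) _ _ G0 intG Gub).
    by apply: eq_Rintegral => x _; exact: D1.
  by move=> y x _ _; have [] := df y x.
have ints2 : mu.-integrable setT (EFin \o (fun x : R => (sigma ^+ 2)^-1 * ((x * sin (xi * x + th)) * g x))).
  rewrite (_ : _ \o _ = (fun x => ((sigma ^+ 2)^-1)%:E * ((x * sin (xi * x + th)) * g x)%:E)%E); last exact/funext.
  exact: (integrableZl measurableT _ (intxs xi)).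
have ibp := @gauss_ibp (fun x => sin (xi * x + th)) (fun x => xi * cos (xi * x + th)).
have E : (fun x : R => (xi * cos (xi * x + th) - x / sigma ^+ 2 * sin (xi * x + th)) * g x) =
  (fun x => xi * f xi x - (sigma ^+ 2)^-1 * ((x * sin (xi * x + th)) * g x)).
  by apply/funext => x; rewrite /f; ring.
rewrite E RintegralB// !RintegralZl// in ibp.
have {}ibp : xi * C xi = (sigma ^+ 2)^-1 * \int[mu]_x ((x * sin (xi * x + th)) * g x).
  apply/eqP; rewrite -subr_eq0; apply/eqP; apply: ibp.
  - by move=> x; apply: is_derive_eq; rewrite /GRing.scale /=; ring.
  - by move=> x; apply: cvgMr; exact: ccos.
  - by move=> x; rewrite (le_trans (sin_max _))// lerDl.
  - under [EFin \o _]eq_fun do rewrite /= EFinB.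
    exact: (integrableB measurableT (intcos xi) ints2).
apply: DeriveDef => //.
rewrite -derive1E vC.
have -> : \int[mu]_x (- sin (xi * x + th) * x * g x) =
    (- 1) * \int[mu]_x ((x * sin (xi * x + th)) * g x).
  rewrite -RintegralZl//; apply: eq_Rintegral => x _; ring.
have -> : \int[mu]_x (x * sin (xi * x + th) * g x) = sigma ^+ 2 * (xi * C xi).
  by rewrite ibp mulrA mulfV ?mul1r// gt_eqF.
by rewrite mulN1r mulrA.
Qed.

Lemma gauss_cos (th xi : R) :
  \int[mu]_x (cos (xi * x + th) * g x) = cos th * expR (- (xi ^+ 2 * sigma ^+ 2 / 2)).
Proof.
pose C (xi : R) := \int[mu]_x (cos (xi * x + th) * g x).
pose F (xi : R) : R := C xi * expR (xi ^+ 2 * sigma ^+ 2 / 2).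
have dF (y : R) : is_derive y (1 : R) F 0.
  have dC : is_derive y (1 : R) C (- (sigma ^+ 2 * y * C y)).
    exact: is_derive_gauss_cos.
  by apply: is_derive_eq; rewrite /GRing.scale /=; field.
have := is_derive_0_is_cst xi 0 dF.
rewrite /F expr0n/= !mul0r expR0 mulr1.
have -> : C 0 = cos th.
  rewrite -[RHS]mulr1 -Rintegral_normal_pdf -RintegralZl//; last exact: integrable_normal_pdf.
  by apply: eq_Rintegral => x _; rewrite mul0r add0r.
rewrite expRN -/(C xi); set w := expR _ => e.
have wn : w != 0 by rewrite gt_eqF// expR_gt0.
by apply: (mulIf wn); rewrite e divfK.
Qed.

End gaussian_integrals.

Lemma continuous_cos_affine (R : realType) (a b : R) :
  continuous (fun x : R => cos (a * x + b)).
Proof.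
move=> x; apply: (@continuous_comp _ _ _ (fun x => a * x + b) cos); last exact: continuous_cos.
by apply: cvgD; [apply: cvgMr; exact: cvg_id|exact: cvg_cst].
Qed.

Lemma continuous_cosD (R : realType) (b : R) : continuous (fun x : R => cos (x + b)).
Proof.
rewrite (_ : (fun _ => _) = (fun x => cos (1 * x + b))).
  exact: continuous_cos_affine.
by apply/funext => x; rewrite mul1r.
Qed.

Section integral_law.
Context {R : realType}.
Notation mu := (@lebesgue_measure R).

Lemma ge0_integral_normal_prob (s : R) (f : R -> \bar R) :
  measurable_fun setT f -> (forall x, (0 <= f x)%E) ->
  (\int[normal_prob 0 s]_x f x = \int[mu]_x (f x * (normal_pdf 0 s x)%:E))%E.
Proof.
move=> mf f0; have dom := @normal_prob_dominates R 0 s.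
rewrite -(@Radon_Nikodym_SigmaFinite.change_of_variables _ _ R (normal_prob 0 s) mu dom f setT f0 measurableT mf).
have h2 := @Radon_Nikodym_SigmaFinite.f_integrable _ _ R (normal_prob 0 s) mu dom.
have h3 := @Radon_Nikodym_SigmaFinite.f_integral _ _ R (normal_prob 0 s) mu dom.
have mg : measurable_fun setT (EFin \o (normal_pdf 0 s : R -> R)).
  by apply/measurable_EFinP; exact: measurable_normal_pdf.
apply: ae_eq_integral => //.
- apply: emeasurable_funM => //; exact: (measurable_int mu).
- exact: emeasurable_funM.
- apply: ae_eqe_mul2l => /=.
  apply: integral_ae_eq => //= E _ mE.
  by rewrite -h3.
Qed.

Context d (Omega : measurableType d) (P : probability Omega R).

(** The change of variables formula restricted to an event [C] on which the law of
    [Y] is a multiple of [nu]; the typical case is [C] independent of [Y]. *)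
Lemma ge0_integral_cond (C : set Omega) (Y : Omega -> R)
    (nu : {measure set (measurableTypeR R) -> \bar R}) (k : {nonneg R}) (f : R -> \bar R) :
  measurable C -> measurable_fun setT Y ->
  (forall B, measurable B -> P (C `&` Y @^-1` B) = (k%:num%:E * nu B)%E) ->
  measurable_fun setT f -> (forall x, (0 <= f x)%E) ->
  (\int[P]_(w in C) f (Y w) = k%:num%:E * \int[nu]_x f x)%E.
Proof.
move=> mC mY HC mf f0.
have mfY : measurable_fun setT (fun w => f (Y w)) by exact: measurableT_comp.
pose Q := mrestr P mC.
have -> : (\int[P]_(w in C) f (Y w) = \int[Q]_(w in C) f (Y w))%E.
  by apply: eq_measure_integral => A mA AC /=; rewrite /Q /mrestr/= setIidl.
have -> : (\int[Q]_(w in C) f (Y w) = \int[Q]_w f (Y w))%E.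
  rewrite -[in RHS](setUv C) ge0_integral_setU//=.
  - rewrite [X in (_ + X)%E]null_set_integral ?adde0//=.
    + exact: measurableC.
    + exact: measurable_funTS.
    + by rewrite /Q /mrestr/= setICl measure0.
  - exact: measurableC.
  - by rewrite setUv.
  - by rewrite disj_set2E setICr.
pose Y' : Omega -> measurableTypeR R := Y.
have mY' : measurable_fun setT Y' by exact: mY.
have mf' : measurable_fun (setT : set (measurableTypeR R)) f by exact: mf.
have -> : (\int[Q]_w f (Y w) = \int[pushforward Q Y']_x f x)%E.
  by rewrite ge0_integral_pushforward.
rewrite -ge0_integral_mscale//.
apply: eq_measure_integral => A mA _ /=.
by rewrite /pushforward /Q /mrestr /mscale/= setIC HC.
Qed.

(** The integrands are taken nonnegative, whence [1 + cos]: no integrability has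
    to be known beforehand. *)
Lemma centered_gaussian_law (Y : Omega -> R) : centered_gaussian P Y ->
  exists (nu : {measure set (measurableTypeR R) -> \bar R}) (v : R),
  [/\ forall B, measurable B -> P (Y @^-1` B) = nu B,
      (\int[nu]_x (x ^+ 2)%:E)%E = v%:E &
      forall th, (\int[nu]_x (1 + cos (x + th))%:E)%E = (1 + cos th * expR (- (v / 2)))%:E].
Proof.
have mcos th : measurable_fun setT (fun x : R => (1 + cos (x + th))%:E).
  apply/measurable_EFinP; apply: continuous_measurable_fun => x.
  by apply: cvgD; [exact: cvg_cst|exact: continuous_cosD].
have cos0 (x th : R) : 0 <= 1 + cos (x + th) by have := cos_geN1 (x + th); lra.
have msq : measurable_fun setT (fun x : R => (x ^+ 2)%:E).
  by apply/measurable_EFinP; exact: exprn_measurable.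
move=> [s Hs]; have [s0|s0] := eqVneq s 0.
  exists (\d_(0 : measurableTypeR R)), 0; split.
  - by move=> B mB; rewrite Hs// s0 eqxx.
  - by rewrite integral_dirac//= diracT mul1e expr0n.
  - move=> th; rewrite integral_dirac//=; last exact: mcos.
    by rewrite diracT mul1e add0r mul0r oppr0 expR0 mulr1.
exists (normal_prob 0 s), (s ^+ 2); split.
- by move=> B mB; rewrite Hs// (negbTE s0).
- rewrite ge0_integral_normal_prob//; last by move=> x; rewrite lee_fin sqr_ge0.
  rewrite -(gauss_second_moment s0) /Rintegral fineK//.
  apply: integrable_fin_num => //.
  apply: (integrable_le_sqr s0); first exact: exprn_continuous.
  by move=> x; rewrite ger0_norm ?sqr_ge0// lerDr.
- move=> th; rewrite ge0_integral_normal_prob; [|exact: mcos|by move=> x; rewrite lee_fin].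
  have ig : mu.-integrable setT (fun x => (normal_pdf 0 s x)%:E).
    exact: integrable_normal_pdf.
  have ic : mu.-integrable setT (EFin \o (fun x => cos (1 * x + th) * normal_pdf 0 s x)).
    apply: (integrable_le_sqr s0).
      exact: continuous_cos_affine.
    by move=> x; rewrite (le_trans (cos_max _))// lerDl sqr_ge0.
  have := gauss_cos s0 th 1; rewrite expr1n mul1r => <-.
  rewrite EFinD -(integral_normal_pdf 0 s) /Rintegral fineK; last exact: integrable_fin_num.
  rewrite -integralD//; apply: eq_integral => x _ /=.
  by rewrite mul1r -EFinD -EFinM mulrDl mul1r.
Qed.

Lemma integral_cos_gaussian (Y : Omega -> R) :
  measurable_fun setT Y -> centered_gaussian P Y ->
  exists2 v : R, (\int[P]_w (Y w ^+ 2)%:E)%E = v%:E &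
  forall C, measurable C ->
  (forall B, measurable B -> P (C `&` Y @^-1` B) = (P C * P (Y @^-1` B))%E) ->
  forall th, \int[P]_(w in C) cos (Y w + th) = fine (P C) * (cos th * expR (- (v / 2))).
Proof.
move=> mY /centered_gaussian_law [nu [v [H1 H2 H3]]]; exists v.
  rewrite -H2.
  have := @ge0_integral_cond setT Y nu (NngNum (@ler01 R)) (fun x => (x ^+ 2)%:E) measurableT mY.
  rewrite /= mul1e; apply.
  - by move=> B mB; rewrite setTI mul1e H1.
  - by apply/measurable_EFinP; exact: exprn_measurable.
  - by move=> x; rewrite lee_fin sqr_ge0.
move=> C mC HC th.
have cos0 (x : R) : 0 <= 1 + cos (x + th) by have := cos_geN1 (x + th); lra.
have PCfin : P C \is a fin_num by exact: fin_num_measure.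
have PC0 : 0 <= fine (P C) by exact: fine_ge0.
have mcos : measurable_fun setT (fun x : R => cos (x + th)).
  apply: continuous_measurable_fun; exact: continuous_cosD.
have E : (\int[P]_(w in C) (1 + cos (Y w + th))%:E =
    (fine (P C) * (1 + cos th * expR (- (v / 2))))%:E)%E.
  have := @ge0_integral_cond C Y nu (NngNum PC0) (fun x => (1 + cos (x + th))%:E) mC mY.
  rewrite H3 EFinM /=; apply.
  - by move=> B mB; rewrite HC// H1// fineK.
  - by apply/measurable_EFinP; exact: measurable_funD.
  - by move=> x; rewrite lee_fin.
have iC : P.-integrable C (cst 1%E).
  apply/integrableP; split=> //.
  by rewrite /= normr1 integral_cst//= mul1e ltey_eq PCfin.
have icos : P.-integrable C (fun w => (cos (Y w + th))%:E).
  apply: (le_integrable mC _ _ iC).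
    apply/measurable_EFinP; apply: measurable_funTS.
    exact: (measurableT_comp mcos).
  by move=> w _ /=; rewrite lee_fin normr1 cos_max.
move: E; under eq_integral do rewrite EFinD.
rewrite integralD// integral_cst//= mul1e mulrDr mulr1 EFinD fineK//.
have ifin : (\int[P]_(w in C) (cos (Y w + th))%:E)%E \is a fin_num.
  exact: integrable_fin_num.
rewrite /Rintegral -{1 2}(fineK PCfin) -(fineK ifin) -!EFinD => -[] e.
by apply: (@addrI R (fine (P C))); rewrite e.
Qed.

End integral_law.

(** * Mean-square closure of an algebra of functions *)

Section bounded_measurable.
Context {R : realType} d (Omega : measurableType d) (P : probability Omega R).
Implicit Types f g p q : Omega -> R.

Definition bdd_meas f := measurable_fun setT f /\ exists M, forall w, `|f w| <= M.

Definition Ex f : R := \int[P]_w f w.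

Lemma bdd_meas_integrable f : bdd_meas f -> P.-integrable setT (EFin \o f).
Proof.
move=> [mf [M hM]].
have iM : P.-integrable setT (cst M%:E).
  by apply: finite_measure_integrable_cst.
apply: (le_integrable measurableT _ _ iM); first exact/measurable_EFinP.
by move=> w _ /=; rewrite lee_fin (le_trans (hM w))// ler_norm.
Qed.

Lemma bdd_meas_cst (k : R) : bdd_meas (cst k).
Proof. by split; [exact: measurable_cst|exists `|k|]. Qed.

Lemma bdd_measD f g : bdd_meas f -> bdd_meas g -> bdd_meas (fun w => f w + g w).
Proof.
move=> [mf [M hM]] [mg [N hN]]; split; first exact: measurable_funD.
by exists (M + N) => w; rewrite (le_trans (ler_normD _ _))// lerD.
Qed.

Lemma bdd_measM f g : bdd_meas f -> bdd_meas g -> bdd_meas (fun w => f w * g w).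
Proof.
move=> [mf [M hM]] [mg [N hN]]; split; first exact: measurable_funM.
by exists (M * N) => w; rewrite normrM ler_pM.
Qed.

Lemma bdd_measZ k f : bdd_meas f -> bdd_meas (fun w => k * f w).
Proof. exact/bdd_measM/bdd_meas_cst. Qed.

Lemma bdd_measB f g : bdd_meas f -> bdd_meas g -> bdd_meas (fun w => f w - g w).
Proof.
move=> hf /(bdd_measZ (- 1)) /(bdd_measD hf).
by congr bdd_meas; apply/funext => w; rewrite mulN1r.
Qed.

Lemma bdd_meas_sqr f : bdd_meas f -> bdd_meas (fun w => f w ^+ 2).
Proof.
by move=> hf; have := bdd_measM hf hf; congr bdd_meas; apply/funext => w; rewrite expr2.
Qed.

Lemma bdd_meas_indic (A : set Omega) : measurable A -> bdd_meas (\1_A).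
Proof.
move=> mA; split; first exact: measurable_indic.
by exists 1 => w; rewrite indicE; case: (_ \in _); rewrite ?normr1 ?normr0.
Qed.

Lemma bdd_meas_cos f (th : R) : measurable_fun setT f ->
  bdd_meas (fun w => cos (f w + th)).
Proof.
move=> mf; split; last by exists 1 => w; exact: cos_max.
apply: (measurableT_comp (f := cos)).
  apply: continuous_measurable_fun; exact: continuous_cos.
exact: measurable_funD.
Qed.

Lemma ExD f g : bdd_meas f -> bdd_meas g ->
  Ex (fun w => f w + g w) = Ex f + Ex g.
Proof. by move=> hf hg; rewrite /Ex RintegralD//; exact: bdd_meas_integrable. Qed.

Lemma ExZ k f : bdd_meas f -> Ex (fun w => k * f w) = k * Ex f.
Proof. by move=> hf; rewrite /Ex RintegralZl//; exact: bdd_meas_integrable. Qed.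

Lemma le_Ex f g : bdd_meas f -> bdd_meas g -> (forall w, f w <= g w) -> Ex f <= Ex g.
Proof.
by move=> hf hg fg; apply: le_Rintegral => //; exact: bdd_meas_integrable.
Qed.

Lemma Ex_ge0 f : (forall w, 0 <= f w) -> 0 <= Ex f.
Proof. by move=> f0; apply: Rintegral_ge0. Qed.

Lemma Ex_cst (k : R) : Ex (cst k) = k.
Proof.
rewrite /Ex /Rintegral.
have -> : (\int[P]_w (cst k w)%:E = k%:E * P setT)%E by exact: (@integral_cst _ _ R P setT measurableT k%:E).
by rewrite probability_setT mule1.
Qed.

Lemma Ex_indic (A : set Omega) : measurable A -> Ex (\1_A) = fine (P A).
Proof. by move=> mA; rewrite /Ex /Rintegral integral_indic// setIT. Qed.

Lemma Ex_cvg (f_ : nat -> Omega -> R) f (M : R) :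
  (forall n, measurable_fun setT (f_ n)) -> measurable_fun setT f ->
  (forall n w, `|f_ n w| <= M) -> (forall w, f_ n w @[n --> \oo] --> f w) ->
  Ex (f_ n) @[n --> \oo] --> Ex f.
Proof.
move=> mf_ mf hM cf.
have iM : P.-integrable setT (cst M%:E) by apply: finite_measure_integrable_cst.
have cE w : setT w -> (EFin \o f_ n) w @[n --> \oo] --> (EFin \o f) w.
  by move=> _; apply: cvg_EFin; [exact: nearW|exact: cf].
have bE w n : setT w -> (`|(EFin \o f_ n) w| <= cst M%:E w)%E.
  by move=> _; rewrite /= lee_fin.
have [If _ cv] := @dominated_convergence _ _ R P setT measurableT
  (fun n => EFin \o f_ n) (EFin \o f) (cst M%:E)
  (fun n => (measurable_EFinP _ _).2 (mf_ n)) ((measurable_EFinP _ _).2 mf)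
  (aeW _ cE) iM (aeW _ bE).
rewrite /Ex /Rintegral; apply: fine_cvg.
rewrite fineK; first exact: cv.
exact: integrable_fin_num.
Qed.

Section mean_square_closure.
Variable A : set (Omega -> R).
Hypothesis A_bdd : forall p, A p -> bdd_meas p.
Hypothesis A_cst : forall k, A (cst k).
Hypothesis AD : forall p q, A p -> A q -> A (fun w => p w + q w).
Hypothesis AM : forall p q, A p -> A q -> A (fun w => p w * q w).

(** The closure in mean square, restricted to bounded functions: unlike the full
    closure it is again an algebra. *)
Definition ms_closure f := bdd_meas f /\
  forall eta, 0 < eta -> exists2 p, A p & Ex (fun w => (f w - p w) ^+ 2) <= eta.

Lemma ms_closure_sub p : A p -> ms_closure p.
Proof.
move=> Ap; split; first exact: A_bdd.
move=> eta eta0; exists p => //.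
rewrite (_ : (fun _ => _) = cst 0); first by rewrite Ex_cst ltW.
by apply/funext => w; rewrite subrr expr0n.
Qed.

Lemma ms_closureD f g : ms_closure f -> ms_closure g ->
  ms_closure (fun w => f w + g w).
Proof.
move=> [bf hf] [bg hg]; split; first exact: bdd_measD.
move=> eta eta0; have e4 : 0 < eta / 4 by rewrite divr_gt0.
have [p Ap hp] := hf _ e4; have [q Aq hq] := hg _ e4.
exists (fun w => p w + q w); first exact: AD.
have bp := bdd_meas_sqr (bdd_measB bf (A_bdd Ap)).
have bq := bdd_meas_sqr (bdd_measB bg (A_bdd Aq)).
apply: (@le_trans _ _ (Ex (fun w => 2 * (f w - p w) ^+ 2 + 2 * (g w - q w) ^+ 2))).
  apply: le_Ex.
  - by apply: bdd_meas_sqr; apply: bdd_measB; apply: bdd_measD => //; exact: A_bdd.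
  - by apply: bdd_measD; exact: bdd_measZ.
  - move=> w; rewrite -subr_ge0 (_ : _ - _ = ((f w - p w) - (g w - q w)) ^+ 2); last by ring.
    exact: sqr_ge0.
rewrite ExD; [|exact: bdd_measZ|exact: bdd_measZ].
by rewrite !ExZ//; lra.
Qed.

Lemma ms_closureM f g : ms_closure f -> ms_closure g ->
  ms_closure (fun w => f w * g w).
Proof.
move=> [bf hf] [bg hg]; split; first exact: bdd_measM.
move=> eta eta0; have [_ [M hM]] := bf.
have cM : 0 < 4 * (M ^+ 2 + 1) by have := sqr_ge0 M; lra.
have [q Aq hq] := hg _ (divr_gt0 eta0 cM).
have [_ [K hK]] := A_bdd Aq.
have cK : 0 < 4 * (K ^+ 2 + 1) by have := sqr_ge0 K; lra.
have [p Ap hp] := hf _ (divr_gt0 eta0 cK).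
exists (fun w => p w * q w); first exact: AM.
have bp := bdd_meas_sqr (bdd_measB bf (A_bdd Ap)).
have bq := bdd_meas_sqr (bdd_measB bg (A_bdd Aq)).
apply: (@le_trans _ _ (Ex (fun w => 2 * M ^+ 2 * (g w - q w) ^+ 2
     + 2 * K ^+ 2 * (f w - p w) ^+ 2))).
  apply: le_Ex.
  - by apply: bdd_meas_sqr; apply: bdd_measB; apply: bdd_measM => //; exact: A_bdd.
  - by apply: bdd_measD; exact: bdd_measZ.
  - move=> w; have fM : f w ^+ 2 <= M ^+ 2.
      by rewrite -(real_normK (num_real (f w))) lerXn2r ?nnegrE ?(le_trans _ (hM w)).
    have qK : q w ^+ 2 <= K ^+ 2.
      by rewrite -(real_normK (num_real (q w))) lerXn2r ?nnegrE ?(le_trans _ (hK w)).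
    apply: (@le_trans _ _ (2 * f w ^+ 2 * (g w - q w) ^+ 2 + 2 * q w ^+ 2 * (f w - p w) ^+ 2)).
      rewrite -subr_ge0 (_ : _ - _ = (f w * (g w - q w) - q w * (f w - p w)) ^+ 2); last by ring.
      exact: sqr_ge0.
    by apply: lerD; rewrite ler_wpM2r ?sqr_ge0// ler_pM2l.
rewrite ExD; [|exact: bdd_measZ|exact: bdd_measZ].
rewrite !ExZ//; move: hp hq; rewrite !ler_pdivlMr//.
have := @Ex_ge0 (fun w => (f w - p w) ^+ 2) (fun w => sqr_ge0 _).
have := @Ex_ge0 (fun w => (g w - q w) ^+ 2) (fun w => sqr_ge0 _).
by set a := Ex _; set b := Ex _; lra.
Qed.

Lemma ms_closure_cst k : ms_closure (cst k).
Proof. exact/ms_closure_sub/A_cst. Qed.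

Lemma ms_closureZ k f : ms_closure f -> ms_closure (fun w => k * f w).
Proof. exact/ms_closureM/ms_closure_cst. Qed.

Lemma ms_closureX f n : ms_closure f -> ms_closure (fun w => f w ^+ n).
Proof.
move=> hf; elim: n => [|n IH]; first exact: ms_closure_cst.
have -> : (fun w => f w ^+ n.+1) = (fun w => f w * f w ^+ n).
  by apply/funext => w; rewrite exprS.
exact: ms_closureM.
Qed.

(** A bounded pointwise limit is a mean-square limit, by dominated convergence. *)
Lemma ms_closure_lim (f_ : nat -> Omega -> R) f (M : R) :
  (forall n, ms_closure (f_ n)) ->
  (forall n w, `|f_ n w| <= M) -> (forall w, f_ n w @[n --> \oo] --> f w) ->
  ms_closure f.
Proof.
move=> cf hM lf.
have mf_ n : measurable_fun setT (f_ n) by have [[]] := cf n.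
have mf : measurable_fun setT f.
  apply: (measurable_fun_cvg mf_) => w _; exact: lf.
have fM w : `|f w| <= M.
  have cn : `|f_ n w| @[n --> \oo] --> `|f w| by apply: cvg_norm; exact: lf.
  by apply: (cvgr_to_le cn); apply: nearW => n.
have bf : bdd_meas f by split => //; exists M.
split => // eta eta0.
have e4 : 0 < eta / 4 by rewrite divr_gt0.
have : Ex (fun w => (f w - f_ n w) ^+ 2) @[n --> \oo] --> Ex (cst 0).
  apply: (@Ex_cvg _ _ ((M + M) ^+ 2)).
  - by move=> n; have [] := bdd_meas_sqr (bdd_measB bf (cf n).1).
  - exact: measurable_cst.
  - move=> n w; rewrite normrX lerXn2r ?nnegrE//.
      by rewrite addr_ge0// (le_trans _ (fM w)).
    by rewrite (le_trans (ler_normB _ _))// lerD.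
  - move=> w; rewrite (_ : cst 0 w = (f w - f w) ^+ 2); last by rewrite subrr expr0n.
    apply: cvgM; apply: cvgB; by [exact: cvg_cst|exact: lf].
rewrite Ex_cst => /cvgr0_norm_le /(_ _ e4) [N _ /(_ N (leqnn N)) hN].
have {}hN : Ex (fun w => (f w - f_ N w) ^+ 2) <= eta / 4.
  by rewrite (le_trans (ler_norm _)).
have [bN /(_ _ e4) [p Ap hp]] := cf N; exists p => //.
have b1 := bdd_meas_sqr (bdd_measB bf bN).
have b2 := bdd_meas_sqr (bdd_measB bN (A_bdd Ap)).
apply: (@le_trans _ _ (Ex (fun w => 2 * (f w - f_ N w) ^+ 2 + 2 * (f_ N w - p w) ^+ 2))).
  apply: le_Ex.
  - by apply: bdd_meas_sqr; apply: bdd_measB => //; exact: A_bdd.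
  - by apply: bdd_measD; exact: bdd_measZ.
  - move=> w; rewrite -subr_ge0 (_ : _ - _ = ((f w - f_ N w) - (f_ N w - p w)) ^+ 2); last by ring.
    exact: sqr_ge0.
rewrite ExD; [|exact: bdd_measZ|exact: bdd_measZ].
by rewrite !ExZ//; lra.
Qed.

End mean_square_closure.
End bounded_measurable.

Section mean_square_closure_events.
Context {R : realType} d (Omega : measurableType d) (P : probability Omega R).
Implicit Types f g p q : Omega -> R.
Variable A : set (Omega -> R).
Hypothesis A_bdd : forall p, A p -> bdd_meas p.
Hypothesis A_cst : forall k, A (cst k).
Hypothesis AD : forall p q, A p -> A q -> A (fun w => p w + q w).
Hypothesis AM : forall p q, A p -> A q -> A (fun w => p w * q w).
Notation cl := (ms_closure P A).

Lemma ms_closure_expR f : cl f -> cl (fun w => expR (f w)).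
Proof.
move=> cf; have [[_ [M hM]] _] := cf.
have le_exp (x : R) n : 0 <= x -> series (exp_coeff x) n <= expR x.
  move=> x0; rewrite /expR; apply: nondecreasing_cvgn_le; last exact: is_cvg_series_exp_coeff.
  apply: nondecreasing_series => k _ _; exact: exp_coeff_ge0.
apply: (ms_closure_lim A_bdd (f_ := fun n w => series (exp_coeff (f w)) n) (M := expR M)).
- elim=> [|n IH].
    rewrite (_ : (fun _ => _) = cst 0); first exact: ms_closure_cst.
    by apply/funext => w; rewrite /series /= big_geq.
  have -> : (fun w => series (exp_coeff (f w)) n.+1) =
    (fun w => series (exp_coeff (f w)) n + n`!%:R^-1 * f w ^+ n).
    by apply/funext => w; rewrite seriesSr /exp_coeff mulrC.
  by apply: ms_closureD => //; apply: ms_closureZ => //; exact: ms_closureX.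
- move=> n w; apply: (@le_trans _ _ (series (exp_coeff `|f w|) n)).
    rewrite /series /=; apply: le_trans (ler_norm_sum _ _ _) _.
    apply: ler_sum => k _; rewrite /exp_coeff /= normrM normrX ler_wpM2l ?exprn_ge0//.
    by rewrite ger0_norm// invr_ge0.
  by apply: le_trans (le_exp _ _ (normr_ge0 _)) _; rewrite ler_expR.
- by move=> w; exact: is_cvg_series_exp_coeff.
Qed.

(** The indicator of the negative half-line as a bounded limit of compositions
    of exponentials, which the closure is stable under. *)
Lemma expR_neg_cvg (y : R) : expR (- (n.+1%:R * expR (n.+1%:R * y))) @[n --> \oo] -->
  ((y < 0)%R%:R : R).
Proof.
have [y0|y0] := ltP y 0.
  pose c := 4 / y ^+ 2.
  have c0 : 0 < y ^+ 2 by rewrite -sqrrN exprn_gt0// oppr_gt0.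
  apply: (@squeeze_cvgr _ _ _ _ (fun n : nat => 1 - c * n.+1%:R^-1) (cst 1)).
  - apply: nearW => n; have np : 0 < n.+1%:R :> R by rewrite ltr0n.
    set m : R := n.+1%:R in np *.
    rewrite -[X in _ && (_ <= X)]expR0 ler_expR oppr_le0 mulr_ge0 ?(ltW np) ?expR_ge0// andbT.
    apply: le_trans (expR_ge1Dx _); rewrite lerD2l lerN2.
    have h : expR (m * y) <= 4 / (m * y) ^+ 2.
      have -> : m * y = - (- (m * y) / 2 + - (m * y) / 2) by field.
      set z := - (m * y) / 2; have z0 : 0 < z by rewrite /z divr_gt0// oppr_gt0 pmulr_rlt0.
      clearbody z.
      have -> : (- (z + z)) ^+ 2 = 4 * z ^+ 2 by ring.
      rewrite invfM mulrA mulfV// mul1r expRN expRD lef_pV2 ?posrE ?exprn_gt0 ?mulr_gt0 ?expR_gt0//.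
      have ze : z <= expR z by apply: le_trans (expR_ge1Dx z); rewrite lerDr.
      by rewrite expr2 ler_pM// ltW.
    apply: le_trans (ler_wpM2l (ltW np) h) _.
    have yn : y != 0 by rewrite lt_eqF.
    have mn : m != 0 by rewrite gt_eqF.
    rewrite le_eqVlt; apply/orP; left; apply/eqP; rewrite /c; clearbody m.
    by field; rewrite yn mn.
  - rewrite -[X in _ --> X]subr0; apply: cvgB; first exact: cvg_cst.
    rewrite -(mulr0 c); apply: cvgMr; exact: cvg_harmonic.
  - exact: cvg_cst.
apply: (@squeeze_cvgr _ _ _ _ (cst 0) (fun n : nat => n.+1%:R^-1)).
- apply: nearW => n; rewrite expR_ge0/=.
  have np : 0 < n.+1%:R :> R by rewrite ltr0n.
  set m : R := n.+1%:R in np *.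
  rewrite expRN lef_pV2 ?posrE ?expR_gt0//.
  apply: (@le_trans _ _ (expR m)).
    by apply: le_trans (expR_ge1Dx m); rewrite lerDr.
  rewrite ler_expR ler_peMr ?(ltW np)//.
  by apply: le_trans (expR_ge1Dx _); rewrite lerDl mulr_ge0// ltW.
- exact: cvg_cst.
- exact: cvg_harmonic.
Qed.

(** These events play the role of the sigma-algebra generated by the algebra: they
    contain the events of interest, and quadratic inequalities extend to them. *)
Definition ms_event : set (set Omega) := [set B | measurable B /\ cl (\1_B)].

Lemma ms_event_lt0 g : cl g -> ms_event [set w | g w < 0].
Proof.
move=> cg; have [[mg _] _] := cg.
have mB : measurable [set w | g w < 0].
  by rewrite -[X in measurable X]setTI; exact: measurable_fun_ltr.
split => //.
apply: (ms_closure_lim A_bdd (f_ := fun n w => expR (- (n.+1%:R * expR (n.+1%:R * g w)))) (M := 1)).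
- move=> n; apply: ms_closure_expR.
  have -> : (fun w => - (n.+1%:R * expR (n.+1%:R * g w))) =
    (fun w => - n.+1%:R * expR (n.+1%:R * g w)) by apply/funext => w; rewrite mulNr.
  apply: ms_closureZ => //; apply: ms_closure_expR; exact: ms_closureZ.
- move=> n w; rewrite (ger0_norm (expR_ge0 _)).
  have : 0 <= n.+1%:R * expR (n.+1%:R * g w) by rewrite mulr_ge0// expR_ge0.
  by rewrite -oppr_le0 -ler_expR expR0.
- move=> w; rewrite indicE mem_setE /=; exact: expR_neg_cvg.
Qed.

Lemma ms_event_setC B : ms_event B -> ms_event (~` B).
Proof.
move=> [mB cB]; split; first exact: measurableC.
rewrite (_ : \1_ _ = fun w => 1 + - 1 * \1_B w).
  apply: ms_closureD => //; [exact: ms_closure_cst|exact: ms_closureZ].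
by apply/funext => w; rewrite !indicE in_setC; case: (_ \in _) => /=; ring.
Qed.

Lemma ms_event_setI B C : ms_event B -> ms_event C -> ms_event (B `&` C).
Proof.
move=> [mB cB] [mC cC]; split; first exact: measurableI.
by rewrite indicI; exact: ms_closureM.
Qed.

Lemma ms_event_setU B C : ms_event B -> ms_event C -> ms_event (B `|` C).
Proof.
move=> hB hC; rewrite -[_ `|` _]setCK setCU.
by apply: ms_event_setC; apply: ms_event_setI; exact: ms_event_setC.
Qed.

Lemma ms_event_set0 : ms_event set0.
Proof. by split => //; rewrite indic0; exact: ms_closure_cst. Qed.

Lemma ms_event_bigcup (F : nat -> set Omega) : (forall n, ms_event (F n)) ->
  ms_event (\bigcup_n F n).
Proof.
move=> hF; have mU : measurable (\bigcup_n F n).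
  by apply: bigcupT_measurable => n; have [] := hF n.
split => //; pose S n := \big[setU/set0]_(i < n) F i.
have hS n : ms_event (S n).
  elim: n => [|n IH]; first by rewrite /S big_ord0; exact: ms_event_set0.
  by rewrite /S big_ord_recr; exact: ms_event_setU.
apply: (ms_closure_lim A_bdd (f_ := fun n => \1_(S n)) (M := 1)).
- by move=> n; have [] := hS n.
- by move=> n w; rewrite indicE; case: (_ \in _); rewrite ?normr1 ?normr0.
- move=> w; apply: cvg_near_cst.
  have [[k _ Fk]|nF] := pselect ((\bigcup_n F n) w).
    near=> n; rewrite !indicE !mem_set//; first by exists k.
    rewrite /S -bigcup_mkord; exists k => //=.
    near: n; exact: nbhs_infty_gt.
  apply: nearW => n; rewrite !indicE !memNset// /S -bigcup_mkord => -[k _ Fk].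
  by apply: nF; exists k.
Unshelve. all: end_near. Qed.

Lemma ms_event_sigma_algebra : sigma_algebra setT ms_event.
Proof.
split; [exact: ms_event_set0| |exact: ms_event_bigcup].
by move=> B hB; rewrite setTD; exact: ms_event_setC.
Qed.

(** The events generated by the values of a variable whose trigonometric
    functions all belong to the closure: a half-line is the bounded limit of
    the half-planes on which [sin ((X - a) / n)] is positive. *)
Lemma ms_event_preimage (X : Omega -> R) : measurable_fun setT X ->
  (forall lam th, cl (fun w => cos (lam * X w + th))) ->
  forall B, measurable B -> ms_event (X @^-1` B).
Proof.
move=> mX hX.
have ray a : ms_event (X @^-1` `]a, +oo[%classic).
  have -> : X @^-1` `]a, +oo[%classic = [set w | a < X w].
    by apply/seteqP; split => w /=; rewrite in_itv/= andbT.
  have mray : measurable [set w | a < X w].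
    rewrite -[X in measurable X]setTI; exact: measurable_fun_ltr.
  split => //.
  pose E n := [set w | cos (n.+1%:R^-1 * X w + (- (n.+1%:R^-1 * a) + pi / 2)) < 0].
  have Esin n w : E n w = (0 < sin (n.+1%:R^-1 * (X w - a))) :> Prop.
    rewrite /E /= addrA cosDpihalf oppr_lt0; congr (is_true (0 < sin _)); ring.
  apply: (ms_closure_lim A_bdd (f_ := fun n => \1_(E n)) (M := 1)).
  - by move=> n; have [] := ms_event_lt0 (hX n.+1%:R^-1 (- (n.+1%:R^-1 * a) + pi / 2)).
  - by move=> n w; rewrite indicE; case: (_ \in _); rewrite ?normr1 ?normr0.
  - move=> w; apply: cvg_near_cst; near=> n.
    have nb : `|X w - a| < pi * n.+1%:R.
      rewrite mulrC -ltr_pdivrMr ?pi_gt0//.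
      apply: (@lt_trans _ _ n%:R); last by rewrite ltr_nat.
      near: n; exact: nbhs_infty_gtr.
    have np : 0 < n.+1%:R :> R by rewrite ltr0n.
    rewrite !indicE; congr (_%:R); congr nat_of_bool.
    have [aX|Xa] := ltP a (X w).
      rewrite !mem_set// Esin; apply: sin_gt0_pi; rewrite mulr_gt0 ?invr_gt0 ?subr_gt0//=.
      by rewrite ltr_pdivrMl// mulrC (le_lt_trans (ler_norm _) nb).
    rewrite !memNset//; first by move=> /=; rewrite ltNge Xa.
    rewrite Esin; apply/negP; rewrite -leNgt.
    have -> : n.+1%:R^-1 * (X w - a) = - (n.+1%:R^-1 * (a - X w)) by ring.
    rewrite sinN oppr_le0; apply: sin_ge0_pi.
    rewrite mulr_ge0 ?invr_ge0 ?subr_ge0//=.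
    rewrite ler_pdivrMl// mulrC; apply/ltW/(le_lt_trans _ nb).
    by rewrite distrC ler_norm.
move=> B mB.
have sub : <<s [set C | ms_event (X @^-1` C)] >> `<=` [set C | ms_event (X @^-1` C)].
  apply: smallest_sub => //; split => /=.
  - by rewrite preimage_set0; exact: ms_event_set0.
  - by move=> C hC; rewrite setTD preimage_setC; exact: ms_event_setC.
  - by move=> F hF; rewrite preimage_bigcup; exact: ms_event_bigcup.
apply: sub.
have mB' : (@RGenOInfty.G R).-sigma.-measurable B by rewrite -RGenOInfty.measurableE.
by apply: (sub_sigma_algebra2 _ mB') => C /= [x ->]; exact: ray.
Unshelve. all: end_near. Qed.

(** An indicator is its own square, so a quadratic inequality tested on mean-square
    approximations of it becomes a bound on a conditional expectation. *)
Lemma ms_event_Ex_le (g : Omega -> R) (K : R) : bdd_meas g -> (forall w, 0 <= g w) ->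
  0 <= K ->
  (forall p, A p -> Ex P (fun w => p w ^+ 2 * g w) <= K * Ex P (fun w => p w ^+ 2)) ->
  forall B, ms_event B -> Ex P (fun w => \1_B w * g w) <= K * fine (P B).
Proof.
move=> bg g0 K0 HA B [mB [bB cB]].
have [_ [G hG]] := bg.
have G0 : 0 <= G by apply: le_trans (hG point).
have main t eta : 0 < t -> 0 < eta -> Ex P (fun w => \1_B w * g w) <=
    (1 + t) ^+ 2 * K * fine (P B) + ((1 + t) * K * (1 + t^-1) + (1 + t^-1) * G) * eta.
  move=> t0 eta0; have [p Ap hp] := cB _ eta0.
  have bp := A_bdd Ap; have bp2 := bdd_meas_sqr bp.
  have be := bdd_meas_sqr (bdd_measB bB bp).
  have ti : 0 < t^-1 by rewrite invr_gt0.
  (* the leading constant tends to [1] as [t] tends to [0], so that the bound [K] is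
     recovered without loss *)
  have young (x y : R) : x ^+ 2 <= (1 + t) * y ^+ 2 + (1 + t^-1) * (x - y) ^+ 2.
    rewrite -subr_ge0 (_ : _ - _ = t^-1 * (x - (1 + t) * y) ^+ 2); last first.
      by field; rewrite gt_eqF.
    by rewrite mulr_ge0 ?sqr_ge0// ltW.
  have ind2 w : (\1_B w : R) ^+ 2 = \1_B w.
    by rewrite indicE; case: (_ \in _); rewrite ?expr1n ?expr0n.
  have h1 : Ex P (fun w => \1_B w * g w) <=
    (1 + t) * Ex P (fun w => p w ^+ 2 * g w) + (1 + t^-1) * (G * Ex P (fun w => (\1_B w - p w) ^+ 2)).
    have bpg := bdd_measM bp2 bg.
    rewrite -(ExZ _ _ be) -(ExZ _ _ (bdd_measZ G be)) -(ExZ _ _ bpg).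
    rewrite -(ExD _ (bdd_measZ (1 + t) bpg) (bdd_measZ (1 + t^-1) (bdd_measZ G be))).
    apply: le_Ex.
    - exact: bdd_measM.
    - by apply: bdd_measD; do ?apply: bdd_measZ => //; exact: bdd_measM.
    - move=> w; have b := young (\1_B w) (p w); rewrite ind2 in b.
      apply: le_trans (ler_wpM2r (g0 w) b) _.
      rewrite mulrDl -mulrA lerD2l -mulrA ler_wpM2l//; first by lra.
      by rewrite mulrC ler_wpM2r ?sqr_ge0// (le_trans (ler_norm _)).
  have h2 : Ex P (fun w => p w ^+ 2) <=
    (1 + t) * fine (P B) + (1 + t^-1) * Ex P (fun w => (\1_B w - p w) ^+ 2).
    rewrite -Ex_indic// -(ExZ _ _ be) -(ExZ _ _ bB).
    rewrite -(ExD _ (bdd_measZ (1 + t) bB) (bdd_measZ (1 + t^-1) be)).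
    apply: le_Ex => //.
    - by apply: bdd_measD; exact: bdd_measZ.
    - move=> w; have := young (p w) (\1_B w); rewrite ind2.
      by rewrite -[(p w - _) ^+ 2]sqrrN opprB.
  have h3 := HA _ Ap.
  set e := Ex P (fun w => (\1_B w - p w) ^+ 2) in hp h1 h2.
  apply: le_trans h1 _.
  apply: (@le_trans _ _ ((1 + t) * (K * ((1 + t) * fine (P B) + (1 + t^-1) * e)) + (1 + t^-1) * (G * e))).
    rewrite lerD2r ler_wpM2l//; first by lra.
    by apply: le_trans h3 _; rewrite ler_wpM2l.
  rewrite (_ : _ + _ = (1 + t) ^+ 2 * K * fine (P B) + ((1 + t) * K * (1 + t^-1) + (1 + t^-1) * G) * e); last by ring.
  rewrite lerD2l ler_wpM2l// addr_ge0// !mulr_ge0//; lra.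
have step t : 0 < t -> Ex P (fun w => \1_B w * g w) <= (1 + t) ^+ 2 * K * fine (P B).
  move=> t0; apply/ler_addgt0Pr => e e0.
  have ti : 0 < t^-1 by rewrite invr_gt0.
  set c := (1 + t) * K * (1 + t^-1) + (1 + t^-1) * G.
  have c0 : 0 <= c by rewrite /c addr_ge0// !mulr_ge0//; lra.
  have c1 : 0 < c + 1 by lra.
  apply: le_trans (main t _ t0 (divr_gt0 e0 c1)) _.
  rewrite -/c lerD2l mulrA ler_pdivrMr// mulrC ler_wpM2l ?(ltW e0)//; lra.
have PB0 : 0 <= fine (P B) by exact: fine_ge0.
have PB1 : fine (P B) <= 1.
  by rewrite -lee_fin fineK ?fin_num_measure//; exact: probability_le1.
apply/ler_addgt0Pr => e e0.
pose t := Num.min 1 (e / (3 * (K + 1))).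
have t0 : 0 < t by rewrite lt_min ltr01 divr_gt0// mulr_gt0//; lra.
have t1 : t <= 1 by rewrite ge_min lexx.
have tk : t * (3 * (K + 1)) <= e.
  by rewrite -ler_pdivlMr ?ge_min ?lexx ?orbT// mulr_gt0//; lra.
apply: le_trans (step t t0) _.
rewrite -subr_ge0 (_ : _ - _ = e - (2 * t + t ^+ 2) * (K * fine (P B))); last by ring.
rewrite subr_ge0; apply: le_trans tk.
have KP : K * fine (P B) <= K + 1 by nra.
have KP0 : 0 <= K * fine (P B) by rewrite mulr_ge0.
clearbody t; rewrite (_ : t * _ = (3 * t) * (K + 1)); last by ring.
by apply: ler_pM => //; nra.
Qed.

End mean_square_closure_events.

(** * Gaussian combinations of the process *)

Section combinations.
Context {R : realType}.
Implicit Types (l : seq (R * R)) (a k : R).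

Definition lscale k l : seq (R * R) := [seq (k * x.1, x.2) | x <- l].

Lemma covDl a l1 l2 l : cov a (l1 ++ l2) l = cov a l1 l + cov a l2 l.
Proof. by rewrite /cov big_cat. Qed.

Lemma covZl a k l1 l : cov a (lscale k l1) l = k * cov a l1 l.
Proof.
rewrite /cov big_map mulr_sumr; apply: eq_bigr => x _ /=.
by rewrite mulr_sumr; apply: eq_bigr => y _; rewrite !mulrA.
Qed.

Lemma covC a l1 l2 : cov a l1 l2 = cov a l2 l1.
Proof.
rewrite /cov exchange_big; apply: eq_bigr => x _; apply: eq_bigr => y _ /=.
by rewrite [y.1 * _]mulrC distrC [`|x.2| `^ a + _]addrC.
Qed.

Lemma covDr a l l1 l2 : cov a l (l1 ++ l2) = cov a l l1 + cov a l l2.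
Proof. by rewrite covC covDl !(covC a l). Qed.

Lemma covZr a k l l1 : cov a l (lscale k l1) = k * cov a l l1.
Proof. by rewrite covC covZl (covC a l). Qed.

Lemma cov_nilr a l : cov a l [::] = 0.
Proof. by rewrite /cov big1// => x _; rewrite big_nil. Qed.

Definition lin_closed (V : set (seq (R * R))) :=
  [/\ V [::], forall l l', V l -> V l' -> V (l ++ l') & forall k l, V l -> V (lscale k l)].

Lemma cov_orth_lin_closed a l : lin_closed [set l' | cov a l l' = 0].
Proof.
split=> /= [|l1 l2 h1 h2|k l1 h1]; first exact: cov_nilr.
- by rewrite covDr h1 h2 addr0.
- by rewrite covZr h1 mulr0.
Qed.

(** Cauchy-Schwarz at a null vector. *)
Lemma cov_null a u v : (forall l, 0 <= cov a l l) -> cov a v v = 0 -> cov a u v = 0.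
Proof.
move=> pos v0; apply/eqP; apply: contraT => n0.
have := pos (u ++ lscale (- (cov a u u + 1) / (2 * cov a u v)) v).
rewrite covDl !covDr !covZl !covZr v0 !mulr0 addr0 (covC a v u).
set c := cov a u v in n0 *; set b := cov a u u.
have -> : b + - (b + 1) / (2 * c) * c + - (b + 1) / (2 * c) * c = - 1 by field.
by rewrite ler0N1.
Qed.

(** Orthogonal projection on the span of finitely many combinations; the form
    [cov a] may be degenerate there, hence the case split on [cov a v v]. *)
Lemma cov_projection a (pos : forall l, 0 <= cov a l l) (Ls : seq (seq (R * R))) D :
  exists2 l0, (forall V, lin_closed V -> (forall l, l \in Ls -> V l) -> V l0) &
    forall l, l \in Ls -> cov a (D ++ lscale (-1) l0) l = 0.
Proof.
elim: Ls D => [|u Ls IH] D; first by exists [::] => // V [].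
have [pD pD1 pD2] := IH D; have [pu pu1 pu2] := IH u.
set D' := D ++ lscale (-1) pD in pD2; set v := u ++ lscale (-1) pu in pu2.
have vpu : cov a v pu = 0 := pu1 _ (cov_orth_lin_closed a v) pu2.
have Dpu : cov a D' pu = 0 := pu1 _ (cov_orth_lin_closed a D') pD2.
have uE l : cov a l u = cov a l v + cov a l pu.
  by rewrite /v covDr covZr mulN1r subrK.
have [v0|v0] := eqVneq (cov a v v) 0.
  exists pD => [V cV hV|l].
    by apply: pD1 => // l lL; apply: hV; rewrite inE lL orbT.
  rewrite inE => /orP[/eqP->|]; last exact: pD2.
  by rewrite -/D' uE Dpu (cov_null _ pos v0) addr0.
pose k := cov a D' v / cov a v v.
exists (pD ++ lscale k v) => [V cV hV|l].
  have [V0 VD VZ] := cV.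
  have hV' l : l \in Ls -> V l by move=> lL; apply: hV; rewrite inE lL orbT.
  apply: (VD); first exact: pD1.
  apply: (VZ); apply: (VD); first by apply: hV; rewrite inE eqxx.
  by apply: (VZ); exact: pu1.
have E z l' : cov a (D ++ lscale (-1) (pD ++ lscale k z)) l' =
    cov a (D ++ lscale (-1) pD) l' - k * cov a z l'.
  by rewrite !covDl !covZl !covDl !covZl; ring.
rewrite inE => /orP[/eqP->|lL]; rewrite E -/D'; last by rewrite pD2// pu2// mulr0 subr0.
by rewrite !uE vpu Dpu !addr0 /k divfK// subrr.
Qed.

End combinations.

Section scalar_fbm.
Context {R : realType} d (Omega : measurableType d) (P : probability Omega R).
Variables (H : R) (Z : R -> Omega -> R).
Hypothesis fZ : is_scalar_fbm P H Z.
Implicit Types l : seq (R * R).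

Definition leval l (w : Omega) : R := \sum_(x <- l) x.1 * Z x.2 w.

Lemma levalD l1 l2 w : leval (l1 ++ l2) w = leval l1 w + leval l2 w.
Proof. by rewrite /leval big_cat. Qed.

Lemma levalZ k l w : leval (lscale k l) w = k * leval l w.
Proof.
by rewrite /leval big_map mulr_sumr; apply: eq_bigr => x _ /=; rewrite mulrA.
Qed.

Lemma leval_measurable l : measurable_fun setT (leval l).
Proof.
elim: l => [|x l IH].
  rewrite (_ : leval _ = cst 0); first exact: measurable_cst.
  by apply/funext => w; rewrite /leval big_nil.
rewrite (_ : leval _ = fun w => x.1 * Z x.2 w + leval l w).
  apply: measurable_funD => //; apply: measurable_funM => //; exact: fbm_measurable fZ _.
by apply/funext => w; rewrite /leval big_cons.
Qed.

Lemma leval_gaussian l : centered_gaussian P (leval l).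
Proof.
have -> : leval l = (fun w => \sum_(k < size l) (nth (0, 0) l k).1 * Z (nth (0, 0) l k).2 w).
  by apply/funext => w; rewrite /leval (big_nth (0, 0)) big_mkord.
exact: (fbm_gaussian fZ).
Qed.

(** Integrability and value of the mean together, so that linearity needs no
    side condition. *)
Definition has_mean (f : Omega -> R) (m : R) :=
  P.-integrable setT (EFin \o f) /\ (\int[P]_w (f w)%:E)%E = m%:E.

Lemma has_meanD f g m m' : has_mean f m -> has_mean g m' ->
  has_mean (fun w => f w + g w) (m + m').
Proof.
move=> [i1 e1] [i2 e2]; split.
  rewrite (_ : _ \o _ = fun w => ((EFin \o f) w + (EFin \o g) w)%E)//.
  exact: integrableD.
under eq_integral do rewrite EFinD.
by rewrite integralD// e1 e2.
Qed.

Lemma has_meanZ k f m : has_mean f m -> has_mean (fun w => k * f w) (k * m).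
Proof.
move=> [i1 e1]; split.
  rewrite (_ : _ \o _ = fun w => (k%:E * (EFin \o f) w)%E)//.
  exact: integrableZl.
under eq_integral do rewrite EFinM.
by rewrite integralZl// e1.
Qed.

Lemma has_mean_sum (I : Type) (s : seq I) (f : I -> Omega -> R) (m : I -> R) :
  (forall i, has_mean (f i) (m i)) ->
  has_mean (fun w => \sum_(i <- s) f i w) (\sum_(i <- s) m i).
Proof.
move=> h; elim: s => [|i s IH].
  rewrite big_nil (_ : (fun _ => _) = cst 0); last by apply/funext => w; rewrite big_nil.
  split; first exact: integrable0.
  by rewrite integral0.
rewrite big_cons (_ : (fun _ => _) = fun w => f i w + \sum_(i <- s) f i w).
  exact: has_meanD.
by apply/funext => w; rewrite big_cons.
Qed.

Lemma has_mean_increment s t : has_mean (fun w => (Z t w - Z s w) ^+ 2) (`|t - s| `^ (2 * H)).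
Proof.
have e : (\int[P]_w ((Z t w - Z s w) ^+ 2)%:E)%E = (`|t - s| `^ (2 * H))%:E.
  rewrite -(fbm_increment fZ s t) unlock; apply: eq_integral => w _.
  by rewrite real_normK// num_real.
split => //; apply/integrableP; split.
  apply/measurable_EFinP; apply: measurable_funX; apply: measurable_funB; exact: fbm_measurable fZ _.
rewrite (eq_integral (fun w => ((Z t w - Z s w) ^+ 2)%:E)); first by rewrite e ltry.
by move=> w _ /=; rewrite ger0_norm ?sqr_ge0.
Qed.

(** Polarisation of the increments, one of which starts at time [0]. *)
Lemma has_mean_prod s t : has_mean (fun w => Z s w * Z t w)
  (2^-1 * (`|s| `^ (2 * H) + `|t| `^ (2 * H) - `|s - t| `^ (2 * H))).
Proof.
have -> : (fun w => Z s w * Z t w) = (fun w => 2^-1 * ((Z s w - Z 0 w) ^+ 2 +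
   (Z t w - Z 0 w) ^+ 2 + - 1 * (Z s w - Z t w) ^+ 2)).
  by apply/funext => w; rewrite (fbm_start fZ); field.
apply: has_meanZ; rewrite -[X in _ - X]mul1r -mulNr.
apply: has_meanD; last exact/has_meanZ/has_mean_increment.
by apply: has_meanD; [rewrite -[in `|s|](subr0 s)|rewrite -[in `|t|](subr0 t)]; exact: has_mean_increment.
Qed.

Lemma has_mean_leval_sqr l : has_mean (fun w => leval l w ^+ 2) (cov (2 * H) l l).
Proof.
have -> : (fun w => leval l w ^+ 2) =
  (fun w => \sum_(x <- l) \sum_(y <- l) x.1 * y.1 * (Z x.2 w * Z y.2 w)).
  apply/funext => w; rewrite expr2 /leval big_distrlr/=; apply: eq_bigr => x _.
  by apply: eq_bigr => y _; ring.
apply: has_mean_sum => x; apply: has_mean_sum => y.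
exact/has_meanZ/has_mean_prod.
Qed.

(** A covariance is a mean of squares; positivity of the form is obtained from
    the process rather than from harmonic analysis. *)
Lemma cov_ge0 l : 0 <= cov (2 * H) l l.
Proof.
have [_ e] := has_mean_leval_sqr l; rewrite -lee_fin -e.
by apply: integral_ge0 => w _; rewrite lee_fin sqr_ge0.
Qed.

Lemma Ex_indic_cos (C : set Omega) l th : measurable C ->
  (forall B, measurable B -> P (C `&` leval l @^-1` B) = (P C * P (leval l @^-1` B))%E) ->
  Ex P (fun w => \1_C w * cos (leval l w + th)) =
    fine (P C) * (cos th * expR (- (cov (2 * H) l l / 2))).
Proof.
move=> mC iC.
have [v ev hv] := integral_cos_gaussian (leval_measurable l) (leval_gaussian l).
have [_ e] := has_mean_leval_sqr l.
have -> : cov (2 * H) l l = v by apply/EFin_inj; rewrite -ev -e.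
rewrite -(hv C mC iC) /Ex [RHS]Rintegral_mkcond; apply: eq_Rintegral => w _.
by rewrite patchE indicE; case: ifPn => // _; rewrite ?mul1r ?mul0r.
Qed.

End scalar_fbm.

(** * Small ball estimate for one increment *)

Section one_increment.
Context {R : realType} d (Omega : measurableType d) (P : probability Omega R).
Variables (H : R) (Z : R -> Omega -> R).
Hypothesis fZ : is_scalar_fbm P H Z.
Implicit Types l : seq (R * R).

(** Events independent of the process, to account for the other components. *)
Variable CC : set (set Omega).
Hypothesis CC_meas : forall C, CC C -> measurable C.
Hypothesis CC_T : CC setT.
Hypothesis CC_I : forall C C', CC C -> CC C' -> CC (C `&` C').
Hypothesis CC_indep : forall C l B, CC C -> measurable B ->
  P (C `&` leval Z l @^-1` B) = (P C * P (leval Z l @^-1` B))%E.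

Notation K := (cov (2 * H)).
Notation ev := (leval Z).

(** Products of cosines are sums of cosines, so these combinations form an algebra;
    their Gaussian means are explicit. *)
Definition trig_alg (V : set (seq (R * R))) : set (Omega -> R) := [set p |
  exists (I : finType) (c : I -> R) (C : I -> set Omega) (l : I -> seq (R * R))
    (th : I -> R), [/\ forall i, CC (C i), forall i, V (l i) &
    p = fun w => \sum_i c i * (\1_(C i) w * cos (ev (l i) w + th i))]].

Lemma bdd_meas_term C l th : CC C -> bdd_meas (fun w => \1_C w * cos (ev l w + th)).
Proof.
move=> hC; apply: bdd_measM; first exact/bdd_meas_indic/CC_meas.
apply: bdd_meas_cos; exact: leval_measurable fZ _.
Qed.

Lemma bdd_meas_sum (I : Type) (s : seq I) (f : I -> Omega -> R) :
  (forall i, bdd_meas (f i)) -> bdd_meas (fun w => \sum_(i <- s) f i w).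
Proof.
move=> hf; elim: s => [|i s IH].
  rewrite (_ : (fun _ => _) = cst 0); first exact: bdd_meas_cst.
  by apply/funext => w; rewrite big_nil.
rewrite (_ : (fun _ => _) = fun w => f i w + \sum_(i <- s) f i w); first exact: bdd_measD.
by apply/funext => w; rewrite big_cons.
Qed.

Lemma Ex_sum (I : Type) (s : seq I) (f : I -> Omega -> R) :
  (forall i, bdd_meas (f i)) -> Ex P (fun w => \sum_(i <- s) f i w) = \sum_(i <- s) Ex P (f i).
Proof.
move=> hf; elim: s => [|i s IH].
  rewrite big_nil (_ : (fun _ => _) = cst 0); first exact: Ex_cst.
  by apply/funext => w; rewrite big_nil.
rewrite big_cons -IH -ExD//; last exact: bdd_meas_sum.
by congr Ex; apply/funext => w; rewrite big_cons.
Qed.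

Section algebra.
Variable V : set (seq (R * R)).
Hypothesis linV : lin_closed V.

Lemma trig_alg_bdd p : trig_alg V p -> bdd_meas p.
Proof.
move=> [I [c [C [l [th [hC hl ->]]]]]]; apply: bdd_meas_sum => i.
exact/bdd_measZ/bdd_meas_term.
Qed.

Lemma trig_alg_cos C l th : CC C -> V l ->
  trig_alg V (fun w => \1_C w * cos (ev l w + th)).
Proof.
move=> hC hl; exists unit, (fun=> 1), (fun=> C), (fun=> l), (fun=> th); split => //.
by apply/funext => w; rewrite big_const card_unit/= addr0 mul1r.
Qed.

Lemma trig_alg_cst k : trig_alg V (cst k).
Proof.
have [V0 _ _] := linV.
exists unit, (fun=> k), (fun=> setT), (fun=> [::]), (fun=> 0); split => //.
apply/funext => w; rewrite big_const card_unit/= addr0 /leval big_nil addr0 cos0.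
by rewrite indicE in_setT !mulr1.
Qed.

Lemma trig_algD p q : trig_alg V p -> trig_alg V q -> trig_alg V (fun w => p w + q w).
Proof.
move=> [I [c [C [l [th [hC hl ->]]]]]] [J [c' [C' [l' [th' [hC' hl' ->]]]]]].
exists (I + J)%type, (fun k => match k with inl i => c i | inr j => c' j end),
  (fun k => match k with inl i => C i | inr j => C' j end),
  (fun k => match k with inl i => l i | inr j => l' j end),
  (fun k => match k with inl i => th i | inr j => th' j end); split.
- by case.
- by case.
- by apply/funext => w; rewrite big_sumType.
Qed.

Lemma cosM (x y : R) : cos x * cos y = 2^-1 * (cos (x + y) + cos (x - y)).
Proof. by rewrite cosD cosB; field. Qed.

Lemma indicM (A B : set Omega) w : \1_A w * \1_B w = \1_(A `&` B) w :> R.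
Proof. by rewrite indicI. Qed.

Lemma trig_algM p q : trig_alg V p -> trig_alg V q -> trig_alg V (fun w => p w * q w).
Proof.
have [V0 VD VZ] := linV.
move=> [I [c [C [l [th [hC hl ->]]]]]] [J [c' [C' [l' [th' [hC' hl' ->]]]]]].
exists (I * J * bool)%type, (fun k => 2^-1 * (c k.1.1 * c' k.1.2)),
  (fun k => C k.1.1 `&` C' k.1.2),
  (fun k => l k.1.1 ++ (if k.2 then l' k.1.2 else lscale (-1) (l' k.1.2))),
  (fun k => th k.1.1 + (if k.2 then th' k.1.2 else - th' k.1.2)); split.
- by move=> k; exact: CC_I.
- move=> [[i j] b] /=; apply: (VD) => //; case: b => //; exact: (VZ).
apply/funext => w; rewrite big_distrlr/= pair_big/=.
rewrite -(pair_big xpredT xpredT (fun ij b => 2^-1 * (c ij.1 * c' ij.2) *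
  (\1_(C ij.1 `&` C' ij.2) w * cos (ev (l ij.1 ++ (if b then l' ij.2 else lscale (-1) (l' ij.2))) w
   + (th ij.1 + (if b then th' ij.2 else - th' ij.2))))))/=.
apply: eq_bigr => -[i j] _ /=; rewrite big_bool/= !levalD levalZ -indicM.
set x := ev (l i) w; set y := ev (l' j) w.
have := cosM (x + th i) (y + th' j).
have -> : x + th i + (y + th' j) = x + y + (th i + th' j) by ring.
have -> : x + th i - (y + th' j) = x + -1 * y + (th i - th' j) by ring.
move=> e; rewrite (_ : _ * _ = c i * c' j * (\1_(C i) w * \1_(C' j) w) *
  (cos (x + th i) * cos (y + th' j))); last by ring.
by rewrite e; ring.
Qed.

End algebra.

(** Write [D = l0 + (D - l0)]. The second part is uncorrelated with [l] and [l0],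
    hence independent of them, and only contributes the factor given by its
    variance. *)
Lemma Ex_cos_orth C l D l0 (xi th th' : R) : CC C ->
  K (D ++ lscale (-1) l0) l = 0 -> K (D ++ lscale (-1) l0) l0 = 0 ->
  Ex P (fun w => \1_C w * cos (ev l w + th) * cos (xi * ev D w + th')) =
  expR (- (xi ^+ 2 * K (D ++ lscale (-1) l0) (D ++ lscale (-1) l0) / 2)) *
  Ex P (fun w => \1_C w * cos (ev l w + th) * cos (xi * ev l0 w + th')).
Proof.
move=> hC o1 o2.
have split_cos D1 : Ex P (fun w => \1_C w * cos (ev l w + th) * cos (xi * ev D1 w + th')) =
  2^-1 * (fine (P C) * (cos (th + th') * expR (- (K (l ++ lscale xi D1) (l ++ lscale xi D1) / 2))) +
   fine (P C) * (cos (th - th') * expR (- (K (l ++ lscale (- xi) D1) (l ++ lscale (- xi) D1) / 2)))).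
  have h x t := @Ex_indic_cos _ _ _ _ _ _ fZ C (l ++ lscale x D1) t (CC_meas hC)
     (fun B mB => CC_indep (l ++ lscale x D1) hC mB).
  rewrite -!h -ExD; [|exact: bdd_meas_term|exact: bdd_meas_term].
  rewrite -ExZ; last by apply: bdd_measD; exact: bdd_meas_term.
  congr Ex; apply/funext => w; rewrite !levalD !levalZ -mulrA cosM.
  have -> : ev l w + th + (xi * ev D1 w + th') = ev l w + xi * ev D1 w + (th + th') by ring.
  have -> : ev l w + th - (xi * ev D1 w + th') = ev l w + - xi * ev D1 w + (th - th') by ring.
  ring.
rewrite !split_cos.
set s2 := K (D ++ lscale (-1) l0) (D ++ lscale (-1) l0).
have e1 : K D l = K l0 l by move: o1; rewrite covDl covZl; lra.
have e2 : K D l0 = K l0 l0 by move: o2; rewrite covDl covZl; lra.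
have e3 : s2 = K D D - K l0 l0.
  by rewrite /s2 !covDl !covDr !covZl !covZr (covC _ l0 D) e2; lra.
have fac x : x ^+ 2 = xi ^+ 2 ->
  expR (- (K (l ++ lscale x D) (l ++ lscale x D) / 2)) =
  expR (- (xi ^+ 2 * s2 / 2)) * expR (- (K (l ++ lscale x l0) (l ++ lscale x l0) / 2)).
  move=> x2; rewrite -expRD; congr expR.
  by rewrite !covDl !covDr !covZl !covZr (covC _ l D) (covC _ l l0) e1 e3 -x2; field.
rewrite (fac xi)// (fac (- xi)) ?sqrrN//; ring.
Qed.

Variable V : set (seq (R * R)).
Hypothesis linV : lin_closed V.
Variables (D : seq (R * R)) (sigma : R).
Hypothesis sigma0 : 0 < sigma.
Hypothesis lndD : forall l, V l ->
  sigma ^+ 2 <= K (D ++ lscale (-1) l) (D ++ lscale (-1) l).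

(** Conditionally on the variables in [V] and on the independent events, the
    characteristic function of [D] is at most that of a Gaussian variable of
    standard deviation [sigma]: [D] is projected on the combinations occurring
    in [p], and the remainder has variance at least [sigma ^+ 2]. *)
Lemma trig_alg_Ex_le p (xi th' : R) : trig_alg V p ->
  Ex P (fun w => p w ^+ 2 * (1 + cos (xi * ev D w + th'))) <=
  (1 + expR (- (xi ^+ 2 * sigma ^+ 2 / 2))) * Ex P (fun w => p w ^+ 2).
Proof.
move=> hp; have [I [c [C [l [th [hC hl pE]]]]]] := hp.
have [l0 l0V l0orth] := cov_projection (cov_ge0 fZ) [seq l i | i <- enum I] D.
have lin_orth := cov_orth_lin_closed (2 * H) (D ++ lscale (-1) l0).
have [V0 VD VZ] := linV.
have [W0 WD WZ] := lin_orth.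
have Vl0 : V l0 by apply: l0V => // l' /mapP[i _ ->].
have ol i : K (D ++ lscale (-1) l0) (l i) = 0.
  by apply: l0orth; apply/mapP; exists i; rewrite ?mem_enum.
have ol0 : K (D ++ lscale (-1) l0) l0 = 0.
  exact: (l0V _ lin_orth).
pose W : set (seq (R * R)) := [set l' | V l' /\ K (D ++ lscale (-1) l0) l' = 0].
have linW : lin_closed W.
  split => //=.
  - by move=> l1 l2 [? ?] [? ?]; split; [exact: (VD)|exact: (WD)].
  - by move=> k l1 [? ?]; split; [exact: (VZ)|exact: (WZ)].
have hpW : trig_alg W p by exists I, c, C, l, th; split.
have := trig_algM linW hpW hpW; rewrite (_ : (fun _ => _) = fun w => p w ^+ 2); last first.
  by apply/funext => w; rewrite expr2.
have bp2 := bdd_meas_sqr (trig_alg_bdd hp).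
move=> [J [c' [C' [l' [tt [hC' hl' qE]]]]]].
have bcos D1 : bdd_meas (fun w => cos (xi * ev D1 w + th')).
  apply: bdd_meas_cos; apply: measurable_funM => //; exact: leval_measurable fZ _.
set s2 := K (D ++ lscale (-1) l0) (D ++ lscale (-1) l0).
have key D1 : Ex P (fun w => p w ^+ 2 * cos (xi * ev D1 w + th')) =
  \sum_j c' j * Ex P (fun w => \1_(C' j) w * cos (ev (l' j) w + tt j) * cos (xi * ev D1 w + th')).
  rewrite (_ : (fun _ => _) = fun w => \sum_j c' j * (\1_(C' j) w * cos (ev (l' j) w + tt j) * cos (xi * ev D1 w + th'))).
    rewrite Ex_sum; last first.
      by move=> j; apply: bdd_measZ; apply: bdd_measM => //; exact: bdd_meas_term.
    by apply: eq_bigr => j _; rewrite ExZ//; apply: bdd_measM => //; exact: bdd_meas_term.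
  apply/funext => w; have := congr1 (fun f => f w) qE => /= ->.
  by rewrite mulr_suml; apply: eq_bigr => j _; rewrite !mulrA.
have E1 : Ex P (fun w => p w ^+ 2 * cos (xi * ev D w + th')) =
  expR (- (xi ^+ 2 * s2 / 2)) * Ex P (fun w => p w ^+ 2 * cos (xi * ev l0 w + th')).
  rewrite !key mulr_sumr; apply: eq_bigr => j _.
  have [_ oj] := hl' j.
  by rewrite (Ex_cos_orth _ _ _ (hC' j) oj ol0) mulrCA.
have E2 : Ex P (fun w => p w ^+ 2 * cos (xi * ev l0 w + th')) <= Ex P (fun w => p w ^+ 2).
  apply: le_Ex => //; first exact: bdd_measM.
  by move=> w; rewrite ler_piMr ?sqr_ge0// cos_le1.
have E3 : 0 <= Ex P (fun w => p w ^+ 2) by apply: Ex_ge0 => w; exact: sqr_ge0.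
rewrite (_ : (fun w => p w ^+ 2 * _) = fun w => p w ^+ 2 + p w ^+ 2 * cos (xi * ev D w + th')).
  rewrite ExD//; last exact: bdd_measM.
  rewrite mulrDl mul1r lerD2l E1; apply: le_trans (ler_wpM2l (expR_ge0 _) E2) _.
  rewrite ler_wpM2r// ler_expR lerN2 ler_pM2r// ler_wpM2l ?sqr_ge0//.
  exact: lndD.
by apply/funext => w; rewrite mulrDr mulr1.
Qed.

Lemma cos_ge_half (x : R) : `|x| <= 2^-1 -> 2^-1 <= cos x.
Proof.
move=> hx; have pi2 := pi_ge2 R.
move: hx; rewrite ler_norml => /andP[x1 x2].
have c0 : 0 <= cos x by apply: cos_ge0_pihalf; apply/andP; split; lra.
have c2 : 0 <= cos (x + x) by apply: cos_ge0_pihalf; apply/andP; split; lra.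
move: c2; rewrite -mulr2n cos_mulr2n; set z := cos x in c0 * => c2.
rewrite leNgt; apply/negP => zlt; move: c2; rewrite mulr2n; nra.
Qed.

Notation events := (ms_event P (trig_alg V)).

(** A window of width comparable to the conditional standard deviation has
    conditional probability at most [3 / 4]: on it [1 + cos (xi (D - c))] is at
    least [3 / 2], while its conditional mean is at most [9 / 8]. *)
Lemma one_increment_cst B (c : R) : events B ->
  (P (B `&` [set w | (`|ev D w - c| <= sigma / 6)%R]) <= (3 / 4)%:E * P B)%E.
Proof.
move=> hB; have [mB _] := hB.
(* [xi] is so large that the characteristic function is at most [1 / 8], and the
   window so small that the angle stays below [1 / 2] *)
pose xi := 3 / sigma; pose g (w : Omega) : R := 1 + cos (xi * ev D w + - (xi * c)).
have xi0 : 0 < xi by exact: divr_gt0.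
have bg : bdd_meas g.
  apply: bdd_measD; first exact: bdd_meas_cst.
  by apply: bdd_meas_cos; apply: measurable_funM => //; exact: leval_measurable fZ _.
have g0 w : 0 <= g w by have := cos_geN1 (xi * ev D w + - (xi * c)); rewrite /g; lra.
have K0 : 0 <= 1 + expR (- (xi ^+ 2 * sigma ^+ 2 / 2)) by rewrite addr_ge0// expR_ge0.
have := ms_event_Ex_le (@trig_alg_bdd V) bg g0 K0
  (fun p hp => trig_alg_Ex_le xi (- (xi * c)) hp) hB.
set W := [set w | _]; have mW : measurable W.
  rewrite /W -[X in measurable X]setTI; apply: measurable_fun_ler => //.
  apply: measurableT_comp => //; apply: measurable_funB => //; exact: leval_measurable fZ _.
have mBW : measurable (B `&` W) by exact: measurableI.
have h1 : 3 / 2 * fine (P (B `&` W)) <= Ex P (fun w => \1_B w * g w).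
  rewrite -Ex_indic// -ExZ; last exact: bdd_meas_indic.
  apply: le_Ex.
  - exact/bdd_measZ/bdd_meas_indic.
  - by apply: bdd_measM => //; exact: bdd_meas_indic.
  - move=> w; rewrite -indicM !indicE; case: (w \in B); rewrite ?mul0r ?mulr0// !mul1r.
    have [wW|wW] := boolP (w \in W); last by rewrite mulr0.
    rewrite mulr1 /g; have : `|xi * ev D w + - (xi * c)| <= 2^-1.
      move: wW; rewrite inE /W /= => wW.
      rewrite -mulrN -mulrDr normrM (gtr0_norm xi0) /xi.
      rewrite -ler_pdivlMl ?divr_gt0//; apply: le_trans wW _.
      by rewrite le_eqVlt; apply/orP; left; apply/eqP; field; rewrite gt_eqF.
    by move/cos_ge_half; lra.
move=> h2; have PB0 : 0 <= fine (P B) by exact: fine_ge0.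
have e18 : expR (- (xi ^+ 2 * sigma ^+ 2 / 2)) <= 1 / 8.
  have -> : xi ^+ 2 * sigma ^+ 2 / 2 = 3 / 2 + 3 / 2 + 3 / 2 :> R.
    by rewrite /xi; field; rewrite gt_eqF.
  have e1 : 5 / 2 <= expR (3 / 2 : R) by have := expR_ge1Dx (3 / 2 : R); lra.
  rewrite expRN !expRD div1r lef_pV2 ?posrE ?mulr_gt0 ?expR_gt0//.
  by set z := expR _ in e1 *; nra.
have h3 : fine (P (B `&` W)) <= 3 / 4 * fine (P B).
  have := le_trans h1 h2; nra.
by rewrite -(fineK (fin_num_measure P _ mB)) -(fineK (fin_num_measure P _ mBW)) -EFinM lee_fin.
Qed.

End one_increment.

(** * From constant to random centres *)

Section random_centre.
Context {R : realType} d (Omega : measurableType d) (P : probability Omega R).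
Variables (EE : set (set Omega)).
Hypothesis EE_meas : forall B, EE B -> measurable B.
Hypothesis EE_I : forall B C, EE B -> EE C -> EE (B `&` C).

(** A window with a constant centre is replaced by one of half the width with
    a random centre, by splitting according to a discretisation of the centre. *)
Lemma random_centre (Y m : Omega -> R) (rho q : R) B :
  0 < rho -> 0 <= q -> measurable_fun setT Y -> measurable_fun setT m ->
  (forall B c, EE B -> (P (B `&` [set w | (`|Y w - c| <= rho + rho)%R]) <= q%:E * P B)%E) ->
  (forall A, measurable A -> EE (m @^-1` A)) -> EE B ->
  (P (B `&` [set w | (`|Y w - m w| <= rho)%R]) <= q%:E * P B)%E.
Proof.
move=> rho0 q0 mY mm hY hm hB.
pose cell n : set R := [set x | pickle (Num.floor (x / rho)) = n].
have mcell n : measurable (cell n).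
  case e : (@pickle_inv int n) => [z|]; last first.
    rewrite (_ : cell n = set0)//; apply/seteqP; split => // x /= xn.
    by have := pickleK_inv (Num.floor (x / rho)); rewrite xn e.
  rewrite (_ : cell n = `[z%:~R * rho, (z + 1)%:~R * rho[%classic); first exact: measurable_itv.
  apply/seteqP; split => x /=; rewrite in_itv/=.
    move=> xn; have := pickleK_inv (Num.floor (x / rho)); rewrite xn e => -[ze].
    have := floor_itv (x / rho); rewrite -ze => /andP[h1 h2].
    by rewrite -ler_pdivlMr// h1 -ltr_pdivrMr.
  rewrite -ler_pdivlMr// -ltr_pdivrMr// => h.
  rewrite /cell /= (floor_def h).
  by have := @pickle_invK int n; rewrite e.
pose F n := B `&` m @^-1` cell n.
pose W := [set w | `|Y w - m w| <= rho].
have mB := EE_meas hB.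
have mW : measurable W.
  rewrite /W -[X in measurable X]setTI; apply: measurable_fun_ler => //.
  by apply: measurableT_comp => //; exact: measurable_funB.
have mF n : measurable (F n).
  by apply: measurableI => //; rewrite -[X in measurable X]setTI; exact: mm.
have trivc (G : set Omega) : trivIset setT (fun n => G `&` m @^-1` cell n).
  apply/trivIsetP => i j _ _ ij; apply/seteqP; split => // w [[_ /= h1] [_ h2]].
  by move/eqP: ij; apply; rewrite -h1 -h2.
have decomp G : G = \bigcup_n (G `&` m @^-1` cell n).
  by apply/seteqP; split => [w Gw|w [n _ []]//]; exists (pickle (Num.floor (m w / rho))).
have PE G : measurable G -> P G = (\sum_(n <oo) P (G `&` m @^-1` cell n))%E.
  move=> mG; rewrite {1}(decomp G) measure_bigcup//.
    by apply: eq_eseriesl => n; rewrite in_setT.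
  by move=> n _; apply: measurableI => //; rewrite -[X in measurable X]setTI; exact: mm.
rewrite (PE _ (measurableI _ _ mB mW)) (PE _ mB) -nneseriesZl//.
apply: lee_nneseries => [n _ _|n _]; first exact: measure_ge0.
have [[w [_ wn]]|ne] := pselect (exists w, F n w); last first.
  rewrite (_ : _ `&` _ = set0) ?measure0; last first.
    by apply/seteqP; split => // w [[Bw _] cw]; apply: ne; exists w.
  by rewrite mule_ge0// lee_fin.
apply: (@le_trans _ _ (P (F n `&` [set v | `|Y v - m w| <= rho + rho]))).
  apply: le_measure; rewrite ?inE.
  - by apply: measurableI; [exact: measurableI|rewrite -[X in measurable X]setTI; exact: mm].
  - apply: measurableI => //; rewrite -[X in measurable X]setTI.
    by apply: measurable_fun_ler => //; apply: measurableT_comp => //; exact: measurable_funB.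
  - move=> v [[Bv Wv] cv]; split => //=.
    have -> : Y v - m w = (Y v - m v) + (m v - m w) by ring.
    apply: le_trans (ler_normD _ _) _; apply: lerD => //.
    have fvw : Num.floor (m v / rho) = Num.floor (m w / rho).
      by apply: (pcan_inj (@pickleK int)); rewrite cv wn.
    have /andP[a1 a2] := floor_itv (m v / rho).
    have /andP[b1 b2] := floor_itv (m w / rho).
    rewrite fvw in a1 a2; move: a1 a2 b1 b2; set z := (Num.floor _).
    rewrite intrD => a1 a2 b1 b2.
    have : `|m v / rho - m w / rho| <= 1 by rewrite ler_norml; apply/andP; split; lra.
    by rewrite -mulrBl normrM normfV (gtr0_norm rho0) ler_pdivrMr// mul1r.
by apply: hY; apply: EE_I => //; exact: hm.
Qed.

End random_centre.

Section iteration.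
Context {R : realType} d (Omega : measurableType d) (P : probability Omega R).
Variables (I : eqType) (EE : I -> set (set Omega)) (W : I -> set Omega) (q : R).
Hypothesis EE_I : forall k B C, EE k B -> EE k C -> EE k (B `&` C).
Hypothesis q0 : 0 <= q.

Lemma bigcap_seq_cons (z : I) zs : \bigcap_(k in [set` z :: zs]) W k =
  W z `&` \bigcap_(k in [set` zs]) W k.
Proof.
apply/seteqP; split=> w /=.
  move=> h; split; first by apply: h; rewrite /= inE eqxx.
  by move=> k /= kz; apply: h; rewrite /= inE kz orbT.
by move=> [h1 h2] k /=; rewrite inE => /orP[/eqP->//|]; exact: h2.
Qed.

Lemma bigcap_seq_nil : \bigcap_(k in [set` ([::] : seq I)]) W k = setT.
Proof. by apply/seteqP; split. Qed.

(** Conditioning on the events [W k'] with [k' != k] does not affect the bound for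
    [W k], as [EE k] contains them: the factors multiply. *)
Lemma iterated_increments (ks : seq I) B : uniq ks ->
  (forall k, k \in ks -> EE k B) ->
  (forall k k', k \in ks -> k' \in ks -> k != k' -> EE k (W k')) ->
  (forall k C, k \in ks -> EE k C -> (P (C `&` W k) <= q%:E * P C)%E) ->
  (P (B `&` \bigcap_(k in [set` ks]) W k) <= (q ^+ size ks)%:E * P B)%E.
Proof.
elim: ks => [|k ks IH] /=; first by rewrite bigcap_seq_nil setIT mul1e.
move=> /andP[kks uks] hB hW hP.
have sub z : z \in ks -> z \in k :: ks by move=> zks; rewrite inE zks orbT.
pose C := B `&` \bigcap_(k in [set` ks]) W k.
have hC : EE k C.
  rewrite /C; have : forall z, z \in ks -> EE k (W z).
    move=> z zks; apply: hW; rewrite ?inE ?eqxx// ?zks ?orbT//.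
    by apply: contraNneq kks => ->.
  have : EE k B by apply: hB; rewrite inE eqxx.
  clear - EE_I; elim: ks => [|z zs IH] hB hz; first by rewrite bigcap_seq_nil setIT.
  rewrite bigcap_seq_cons setICA setIC; apply: EE_I.
    by apply: IH => // y yzs; apply: hz; rewrite inE yzs orbT.
  by apply: hz; rewrite inE eqxx.
rewrite bigcap_seq_cons setICA setIC.
apply: le_trans (hP k C _ hC) _; first by rewrite inE eqxx.
rewrite exprS EFinM -muleA; apply: lee_wpmul2l; first by rewrite lee_fin.
apply: IH => //.
- by move=> z zks; apply: hB; exact: sub.
- by move=> z z' zks z'ks; apply: hW; exact: sub.
- by move=> z D zks; apply: hP; exact: sub.
Qed.

End iteration.

(** * Measurability and independence of the components *)

(** Inversion is total with [0^-1 = 0], and is the pointwise limit of the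
    continuous functions [x / (x ^+ 2 + n^-1)]. *)
Lemma measurable_invr (R : realType) : measurable_fun setT (GRing.inv : R -> R).
Proof.
apply: (measurable_fun_cvg (h := fun n (x : R) => x / (x ^+ 2 + n.+1%:R^-1))).
  move=> n; apply: continuous_measurable_fun => x.
  have p : 0 < x ^+ 2 + n.+1%:R^-1 :> R by rewrite ltr_wpDl ?sqr_ge0// invr_gt0.
  apply: cvgM; first exact: cvg_id.
  apply: cvgV; first by rewrite gt_eqF.
  by apply: cvgD; [exact: exprn_continuous|exact: cvg_cst].
move=> x _; have [->|x0] := eqVneq x 0.
  by rewrite invr0; under eq_fun do rewrite mul0r; exact: cvg_cst.
have -> : x^-1 = x / (x ^+ 2 + 0) by rewrite addr0 expr2 invfM mulrA mulfV// mul1r.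
apply: cvgMr; apply: cvgV; first by rewrite addr0 sqrf_eq0.
by apply: cvgD; [exact: cvg_cst|exact: cvg_harmonic].
Qed.

Section sub_measurability.
Context {R : realType} (T : pointedType) (EE : set (set T)).

(** Measurability with respect to a class of events that is known to be a
    sigma-algebra, without a dedicated measurable type. *)
Definition sub_meas (f : T -> R) := forall B, measurable B -> EE (f @^-1` B).

Hypothesis sE : sigma_algebra setT EE.

Lemma sub_measP f : sub_meas f <-> measurable_fun (setT : set (g_sigma_algebraType EE)) f.
Proof.
split=> h.
  move=> _ B mB; rewrite setTI; apply: sub_sigma_algebra; exact: h.
move=> B mB; have := h measurableT B mB; rewrite setTI.
by rewrite /measurable /= sigma_algebra_id.
Qed.

Lemma sub_meas_cst k : sub_meas (cst k).
Proof. apply/sub_measP; exact: measurable_cst. Qed.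

Lemma sub_measD f g : sub_meas f -> sub_meas g -> sub_meas (fun w => f w + g w).
Proof. by move=> /sub_measP hf /sub_measP hg; apply/sub_measP; exact: measurable_funD. Qed.

Lemma sub_measM f g : sub_meas f -> sub_meas g -> sub_meas (fun w => f w * g w).
Proof. by move=> /sub_measP hf /sub_measP hg; apply/sub_measP; exact: measurable_funM. Qed.

Lemma sub_meas_comp f (h : R -> R) : measurable_fun setT h -> sub_meas f ->
  sub_meas (fun w => h (f w)).
Proof. by move=> mh /sub_measP hf; apply/sub_measP; exact: (measurableT_comp mh). Qed.

Lemma sub_measN f : sub_meas f -> sub_meas (fun w => - f w).
Proof. by apply: sub_meas_comp; exact: oppr_measurable. Qed.

Lemma sub_measV f : sub_meas f -> sub_meas (fun w => (f w)^-1).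
Proof. by apply: sub_meas_comp; exact: measurable_invr. Qed.

Lemma sub_meas_det n (M : T -> 'M[R]_n) : (forall a b, sub_meas (fun w => M w a b)) ->
  sub_meas (fun w => \det (M w)).
Proof.
move=> hM; apply/sub_measP; apply: measurable_sum => s.
apply: measurable_funM; first exact: measurable_cst.
by apply: measurable_prod => i _; apply/sub_measP; exact: hM.
Qed.

End sub_measurability.

Section fbm_increments.
Context {R : realType} (n : nat) d (Omega : measurableType d) (P : probability Omega R).
Variables (H : R) (X : R -> Omega -> 'rV[R]_n).
Hypothesis fX : is_fbm P H X.

Notation Z i := (fun t w => X t w ord0 i).
Notation comp_sigma j := (sigma_process setT [set j] X).

Lemma sigma_process_algebra D (I : set 'I_n) : sigma_algebra setT (sigma_process D I X).
Proof. exact: smallest_sigma_algebra. Qed.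

Lemma sigma_process_gen (D : set R) (I : set 'I_n) t j B : D t -> I j -> measurable B ->
  sigma_process D I X (Z j t @^-1` B).
Proof. by move=> Dt Ij mB; apply: sub_sigma_algebra; exists t, j, B. Qed.

Lemma measurable_component j t : measurable_fun setT (Z j t).
Proof. exact: fbm_measurable (fbm_component fX j) t. Qed.

Lemma sigma_process_measurable (D : set R) (I : set 'I_n) A :
  sigma_process D I X A -> measurable A.
Proof.
move: A; apply: smallest_sub; first exact: sigma_algebra_measurable.
move=> A [t [j [B [_ _ mB ->]]]].
rewrite -[X in measurable X]setTI; exact: measurable_component.
Qed.

(** Products of events of the components other than the [i]-th one: a class stable
    under intersection is enough for [trig_alg], and independence of the
    [i]-th component is then immediate. *)
Definition others i : set (set Omega) := [set C | exists A : 'I_n -> set Omega,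
  [/\ forall j, comp_sigma j (A j), A i = setT & C = \bigcap_(j in [set: 'I_n]) A j]].

Lemma others_meas i C : others i C -> measurable C.
Proof.
move=> [A [hA _ ->]]; apply: fin_bigcap_measurable => // j _.
exact: sigma_process_measurable (hA j).
Qed.

Lemma others_T i : others i setT.
Proof.
exists (fun=> setT); split => // [j|]; last by rewrite bigcapT.
by have [h0 hC _] := sigma_process_algebra setT [set j]; have := hC _ h0; rewrite setTD setC0.
Qed.

Lemma sigma_process_setI D (I : set 'I_n) A B : sigma_process D I X A ->
  sigma_process D I X B -> sigma_process D I X (A `&` B).
Proof.
have -> : sigma_process D I X = measurable :> set (set (g_sigma_algebraType
  [set A | exists t i (B : set R), [/\ D t, I i, measurable B & A = Z i t @^-1` B]])) by [].
exact: measurableI.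
Qed.

Lemma others_I i C C' : others i C -> others i C' -> others i (C `&` C').
Proof.
move=> [A [hA Ai ->]] [A' [hA' A'i ->]]; exists (fun j => A j `&` A' j); split.
- by move=> j; exact: sigma_process_setI.
- by rewrite Ai A'i setIT.
- by rewrite bigcapI.
Qed.

Lemma leval_sigma i l B : measurable B -> comp_sigma i (leval (Z i) l @^-1` B).
Proof.
move: B; have := sigma_process_algebra setT [set i] => sA.
rewrite -/(sub_meas (comp_sigma i) _).
elim: l => [|x l IH].
  rewrite (_ : leval _ _ = cst 0); first exact: sub_meas_cst.
  by apply/funext => w; rewrite /leval big_nil.
rewrite (_ : leval _ _ = fun w => x.1 * X x.2 w ord0 i + leval (Z i) l w); last first.
  by apply/funext => w; rewrite /leval big_cons.
apply: sub_measD => //; apply: sub_measM => //; first exact: sub_meas_cst.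
by move=> B mB; exact: sigma_process_gen.
Qed.

Lemma others_indep i C l B : others i C -> measurable B ->
  P (C `&` leval (Z i) l @^-1` B) = (P C * P (leval (Z i) l @^-1` B))%E.
Proof.
move=> [A [hA Ai ->]] mB; set Y := leval (Z i) l @^-1` B.
have hY : comp_sigma i Y by exact: leval_sigma.
pose A' j := if j == i then Y else A j.
have -> : \bigcap_(j in [set: 'I_n]) A j `&` Y = \bigcap_(j in [set: 'I_n]) A' j.
  apply/seteqP; split => w /=.
    by move=> [h Yw] j _; rewrite /A'; case: eqP => // _; exact: h.
  move=> h; split; last by have := h i I; rewrite /A' eqxx.
  by move=> j _; have := h j I; rewrite /A'; case: eqP => // ->; rewrite Ai.
rewrite (fbm_indep fX) ?(fbm_indep fX)//; last first.
  by move=> j; rewrite /A'; case: eqP => // ->.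
rewrite (bigD1 i)//= [X in (_ = X * _)%E](bigD1 i)//= {1}/A' eqxx Ai probability_setT mul1e muleC.
congr (_ * _)%E; apply: eq_bigr => j ji; by rewrite /A' (negbTE ji).
Qed.

End fbm_increments.

(** * Almost maximal minors *)

Section minors.
Context {R : realType} (N n : nat).
Implicit Types G : 'M[R]_(N, n).

(** The new index comes first, so that expanding a determinant along its first row
    isolates the corresponding entry. *)
Definition ext (T : Type) (r : nat) (k : T) (J : 'I_r -> T) (a : 'I_r.+1) : T :=
  if unlift ord0 a is Some a' then J a' else k.

Definition minor G (r : nat) (J : 'I_r -> 'I_N) (S : 'I_r -> 'I_n) : R :=
  \det (mxsub J S G).

Definition corner0 (r : nat) (M : 'M[R]_r.+1) : 'M[R]_r.+1 :=
  \matrix_(a, b) (if (a == ord0) && (b == ord0) then 0 else M a b).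

Lemma det_corner (r : nat) (M : 'M[R]_r.+1) :
  \det M = M ord0 ord0 * \det (row' ord0 (col' ord0 M)) + \det (corner0 M).
Proof.
rewrite (expand_det_row _ ord0) [X in _ + X](expand_det_row _ ord0).
rewrite !big_ord_recl !mxE /= mul0r add0r.
rewrite {1}/cofactor/= addn0 expr0 mul1r; congr (_ + _).
apply: eq_bigr => j _; rewrite mxE /=; congr (_ * (_ * \det _)).
by apply/matrixP => a b; rewrite !mxE -[_ == ord0]/(lift _ _ == ord0) eq_sym (negbTE (neq_lift _ _)).
Qed.

(** The extended minor is affine in the new entry [G k i]; the other term does not
    involve that entry. *)
Lemma minor_ext G r (J : 'I_r -> 'I_N) (S : 'I_r -> 'I_n) k i :
  minor G (ext k J) (ext i S) = G k i * minor G J S +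
    \det (corner0 (mxsub (ext k J) (ext i S) G)).
Proof.
rewrite /minor det_corner mxE {1 2}/ext unlift_none; congr (_ * _ + _).
congr determinant.
by apply/matrixP => a b; rewrite !mxE /ext !liftK.
Qed.

End minors.

Section small_kernel.
Context {R : realType}.

Lemma minor_inj N n (G : 'M[R]_(N, n)) r (J : 'I_r -> 'I_N) (S : 'I_r -> 'I_n) :
  minor G J S != 0 -> injective S.
Proof.
move=> D0 b b' Sb; apply/eqP; apply: contraNT D0 => bb.
rewrite /minor -det_tr (determinant_alternate bb)// => c.
by rewrite !mxE Sb.
Qed.

(** If [G] nearly annihilates a unit vector, then some nonzero minor of less
    than full size is almost maximal among its one-row one-column extensions
    by a fixed new column [i]: among all minors, maximise the absolute value
    divided by [tau] to the power of the size; by Cramer's rule the maximum is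
    not reached at a minor of full size. *)
Lemma small_kernel_minor N n (G : 'M[R]_(N, n)) (phi : 'I_n -> R) (e tau : R) :
  0 <= e -> 0 < tau -> n%:R ^+ 2 * e < tau ->
  \sum_i phi i ^+ 2 = 1 -> (forall k, `|\sum_i phi i * G k i| <= e) ->
  exists (r : 'I_n) (J : {ffun 'I_r -> 'I_N}) (S : {ffun 'I_r -> 'I_n}) (i : 'I_n),
    [/\ forall b, S b != i, minor G J S != 0 &
        forall k, `|minor G (ext k J) (ext i S)| <= tau * `|minor G J S|].
Proof.
move=> e0 tau0 etau phi1 hphi.
pose T := {r : 'I_n.+1 & ({ffun 'I_r -> 'I_N} * {ffun 'I_r -> 'I_n})%type}.
pose wt (t : T) : R := tau ^- (tag t) * `|minor G (tagged t).1 (tagged t).2|.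
pose t0 : T := existT _ ord0 (ffun0 (card_ord 0), ffun0 (card_ord 0)).
have wt0 : wt t0 = 1 by rewrite /wt /minor /= det_mx00 normr1 expr0 invr1 mulr1.
have [[r [J S]] _ maxt] : exists2 t : T, True & forall t', wt t' <= wt t.
  by case: (@arg_maxP _ _ T t0 xpredT wt isT) => t _ mt; exists t => // t'; exact: mt.
have taur m : 0 < tau ^- m by rewrite invr_gt0 exprn_gt0.
have D0 : minor G J S != 0.
  apply/eqP => D0; have := maxt t0; rewrite wt0 /wt /= D0 normr0 mulr0.
  by rewrite ler10.
have Sinj := minor_inj D0.
have Dp : 0 < `|minor G J S| by rewrite normr_gt0.
have [rn|nr] := ltnP r n.
  have [i /forallP iS] : exists i, [forall b, S b != i].
    apply/existsP; apply: contraT => /existsPn h.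
    suff : (n <= r)%N by rewrite leqNgt rn.
    rewrite -[X in (X <= _)%N](card_ord n) -[X in (_ <= X)%N](card_ord r).
    rewrite -(card_codom Sinj); apply: subset_leq_card; apply/fintype.subsetP => i _.
    have /forallPn [b] := h i; rewrite negbK => /eqP <-; exact: codom_f.
  exists (Ordinal rn), J, S, i; split => // k.
  have rn1 : (r.+1 < n.+1)%N by rewrite ltnS.
  have := maxt (existT _ (Ordinal rn1) (finfun (ext k J), finfun (ext i S))).
  rewrite /wt /=.
  have -> : minor G (finfun (ext k J)) (finfun (ext i S)) = minor G (ext k J) (ext i S).
    by congr determinant; apply/matrixP => a b; rewrite !mxE !ffunE.
  rewrite exprS invfM -mulrA [X in X <= _]mulrCA ler_pM2l//.
  by rewrite ler_pdivrMl.
exfalso; have {nr} rn : nat_of_ord r = n.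
  by apply/eqP; rewrite eqn_leq nr andbT -ltnS ltn_ord.
case: r J S maxt D0 Sinj Dp rn => m hm /= J S maxt D0 Sinj Dp rn; subst m.
have n0 : (0 < n)%N.
  rewrite lt0n; apply/eqP => n0; move: phi1; rewrite big1 => [/eqP|[i ip]].
    by rewrite eq_sym oner_eq0.
  exfalso; have : (i < n)%N by exact: ip.
  by rewrite n0.
have [n' nE] : exists n', n = n'.+1 by exists n.-1; rewrite prednK.
subst n.
pose M : 'M[R]_n'.+1 := mxsub J S G.
pose v (b : 'I_n'.+1) := phi (S b).
have Sbij : bijective S by exact: injF_bij.
have Mv a : `|\sum_b M a b * v b| <= e.
  rewrite (_ : \sum_b _ = \sum_i phi i * G (J a) i) ?hphi//.
  rewrite [RHS](reindex S); last exact: onW_bij.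
  by apply: eq_bigr => b _; rewrite mxE mulrC.
have cof a b : `|cofactor M a b| <= `|\det M| / tau.
  rewrite /cofactor normrM normrX normrN1 expr1n mul1r.
  have hn' : (n' < n'.+2)%N by exact: ltnW.
  have := maxt (existT _ (Ordinal hn') (finfun (fun x => J (lift a x)), finfun (fun x => S (lift b x)))).
  rewrite /wt /=.
  have -> : minor G (finfun (fun x => J (lift a x))) (finfun (fun x => S (lift b x)))
    = \det (row' a (col' b M)).
    by congr determinant; apply/matrixP => x y; rewrite !mxE !ffunE.
  by rewrite exprS invfM -mulrA [X in _ <= X]mulrCA ler_pM2l// mulrC.
have bound b : `|v b| <= n'.+1%:R * e / tau.
  have E : \det M * v b = \sum_a \adj M b a * (\sum_c M a c * v c).
    pose V : 'cV[R]_n'.+1 := \col_c v c.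
    have := congr1 (fun A : 'M[R]_(n'.+1) => (A *m V) b ord0) (mul_adj_mx M).
    rewrite -mulmxA mul_scalar_mx !mxE => <-.
    apply: eq_bigr => a _; rewrite !mxE; congr (_ * _).
    by apply: eq_bigr => c _; rewrite !mxE.
  have : `|\det M| * `|v b| <= `|\det M| * (n'.+1%:R * e / tau).
    rewrite -normrM E; apply: le_trans (ler_norm_sum _ _ _) _.
    apply: (@le_trans _ _ (\sum_(a < n'.+1) `|\det M| / tau * e)).
      by apply: ler_sum => a _; rewrite normrM !mxE ler_pM.
    rewrite sumr_const card_ord -mulr_natl le_eqVlt; apply/orP; left; apply/eqP.
    by field; rewrite gt_eqF.
  by rewrite ler_pM2l.
set u := n'.+1%:R * e / tau in bound.
have nu : n'.+1%:R * u < 1.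
  by rewrite /u mulrA mulrA -expr2 ltr_pdivrMr// mul1r.
have u0 : 0 <= u by rewrite /u divr_ge0 ?mulr_ge0// ltW.
have u1 : u < 1.
  by apply: le_lt_trans nu; rewrite ler_peMl// ler1n.
move: phi1; rewrite (reindex S); last exact: onW_bij.
move=> phi1; have : 1 <= n'.+1%:R * u * u.
  rewrite -[leLHS]phi1; apply: (@le_trans _ _ (\sum_(b < n'.+1) u ^+ 2)).
    apply: ler_sum => b _; rewrite -(real_normK (num_real _)) lerXn2r ?nnegrE//.
    exact: bound.
  by rewrite sumr_const card_ord -mulrA -expr2 mulr_natl.
set x := n'.+1%:R * u in nu *; move=> h.
have x0 : 0 <= x by rewrite mulr_ge0.
have : x * u < 1 * 1 by apply: ltr_pM.
by rewrite mulr1 ltNge h.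
Qed.
End small_kernel.

(** * Blocks on which some direction is flat *)

Section gap.
Context {R : realType}.

(** When a combination is expanded over successive increments from time [0], the
    coefficient of the increment over [[p, p + h]] is the sum of the coefficients
    on its right: these combinations do not involve that increment. *)
Definition gap_comb (p h : R) : set (seq (R * R)) := [set l : seq (R * R) |
  (forall x, x \in l -> x.2 <= p \/ p + h <= x.2) /\
  \sum_(x <- l | p + h <= x.2) x.1 = 0].

Lemma gap_comb_lin p h : lin_closed (gap_comb p h).
Proof.
split; first by split => //; rewrite big_nil.
- move=> l l' [h1 e1] [h2 e2]; split; last by rewrite big_cat/= e1 e2 addr0.
  by move=> x; rewrite mem_cat => /orP[]; [exact: h1|exact: h2].
- move=> k l [h1 e1]; split; last by rewrite big_map -mulr_sumr e1 mulr0.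
  by move=> x /mapP[y yl ->] /=; exact: h1.
Qed.

Definition increment (p h : R) : seq (R * R) := [:: (1, p + h); (-1, p)].

Lemma increment_lnd (H : R) : 0 < H <= 1 / 2 -> exists2 c : R, 0 < c &
  forall p h l, 0 <= p -> 0 < h -> gap_comb p h l ->
  (c * h `^ H) ^+ 2 <= cov (2 * H) (increment p h ++ lscale (-1) l)
     (increment p h ++ lscale (-1) l).
Proof.
move=> /andP[H0 H1]; have [c c0 hc] := @cov_lnd R (2 * H) ltac:(apply/andP; split; lra).
exists (Num.sqrt c); first by rewrite sqrtr_gt0.
move=> p h l p0 h0 [l1 l2].
have -> : (Num.sqrt c * h `^ H) ^+ 2 = c * h `^ (2 * H).
  rewrite exprMn sqr_sqrtr ?(ltW c0)//; congr (_ * _).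
  by rewrite -powR_mulrn ?powR_ge0// -powRrM mulrC.
apply: (hc _ p) => //.
- move=> x; rewrite mem_cat => /orP[|/mapP[y yl ->]/=]; last exact: l1.
  by rewrite !inE => /orP[]/eqP->/=; [right|left].
- rewrite big_cat/= big_map -mulr_sumr l2 mulr0 addr0.
  rewrite /increment !big_cons big_nil/= lexx ifF ?addr0//.
  by apply/negbTE; rewrite -ltNge ltrDl.
Qed.

Lemma increment_gap_comb p h p' h' : 0 < h' -> (p' + h' <= p \/ p + h <= p') ->
  0 < h -> gap_comb p h (increment p' h').
Proof.
move=> h'0 sep h0; split.
  move=> x; rewrite !inE => /orP[]/eqP->/=; case: sep => s; [left|right|left|right] => //; lra.
rewrite /increment !big_cons big_nil/=; case: sep => s.
  rewrite !ifF//; apply/negbTE; rewrite -ltNge; lra.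
rewrite !ifT ?addr0 ?subrr//; lra.
Qed.

End gap.

Section fbm_block.
Context {R : realType} (n : nat) d (Omega : measurableType d) (P : probability Omega R).
Variables (H : R) (X : R -> Omega -> 'rV[R]_n).
Hypothesis fX : is_fbm P H X.
Notation Z i := (fun t w => X t w ord0 i).

Variables (c0 : R) (c0p : 0 < c0).
Hypothesis lnd : forall p h l, 0 <= p -> 0 < h -> gap_comb p h l ->
  (c0 * h `^ H) ^+ 2 <= cov (2 * H) (increment p h ++ lscale (-1) l)
     (increment p h ++ lscale (-1) l).

Variables (a h : R) (N : nat).
Hypotheses (a0 : 0 <= a) (h0 : 0 < h).

Definition node (k : nat) : R := a + k%:R * h.

Definition incr (k : nat) (j : 'I_n) (w : Omega) : R :=
  X (node k + h) w ord0 j - X (node k) w ord0 j.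

Lemma node_ge0 k : 0 <= node k.
Proof. by rewrite addr_ge0// mulr_ge0// ltW. Qed.

Lemma leval_increment i k w : leval (Z i) (increment (node k) h) w = incr k i w.
Proof. by rewrite /leval /increment !big_cons big_nil /= /incr; ring. Qed.

Notation Alg i k := (trig_alg (Z i) (others X i) (gap_comb (node k) h)).

(** The events known from everything but the [k]-th increment of the [i]-th
    component: past, other components and other increments. *)
Definition rest (i : 'I_n) (k : nat) : set (set Omega) := ms_event P (Alg i k).

Let Alg_bdd i k p : Alg i k p -> bdd_meas p.
Proof. exact: (trig_alg_bdd (fbm_component fX i) (@others_meas _ _ _ _ _ _ _ fX i)). Qed.

Let Alg_cst i k q : Alg i k (cst q).
Proof. apply: trig_alg_cst; [exact: others_T|exact: gap_comb_lin]. Qed.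

Let AlgD i k p q : Alg i k p -> Alg i k q -> Alg i k (fun w => p w + q w).
Proof. exact: trig_algD. Qed.

Let AlgM i k p q : Alg i k p -> Alg i k q -> Alg i k (fun w => p w * q w).
Proof. apply: trig_algM; [exact: others_I|exact: gap_comb_lin]. Qed.

Lemma rest_sigma_algebra i k : sigma_algebra setT (rest i k).
Proof. exact: (ms_event_sigma_algebra _ (@Alg_bdd i k) (@Alg_cst i k) (@AlgD i k) (@AlgM i k)). Qed.

Lemma rest_setI i k B C : rest i k B -> rest i k C -> rest i k (B `&` C).
Proof. exact: (ms_event_setI (@Alg_bdd i k) (@AlgM i k)). Qed.

Lemma rest_leval i k l : gap_comb (node k) h l -> sub_meas (rest i k) (leval (Z i) l).
Proof.
move=> hl; have [_ _ VZ] := gap_comb_lin (node k) h.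
apply: (ms_event_preimage (@Alg_bdd i k) (@Alg_cst i k) (@AlgD i k) (@AlgM i k)).
  exact: leval_measurable (fbm_component fX i) _.
move=> lam th; apply: ms_closure_sub; first exact: Alg_bdd.
rewrite (_ : (fun _ => _) = fun w => \1_setT w * cos (leval (Z i) (lscale lam l) w + th)).
  apply: trig_alg_cos; [exact: others_T|exact: VZ].
by apply/funext => w; rewrite indicE in_setT mul1r levalZ.
Qed.

Lemma rest_other i k j t : j != i -> sub_meas (rest i k) (Z j t).
Proof.
move=> ji B mB.
have hC : others X i (Z j t @^-1` B).
  exists (fun j' => if j' == j then Z j t @^-1` B else setT); split.
  - move=> j'; case: eqP => [->|_]; first exact: sigma_process_gen.
    by have [h1 hC _] := sigma_process_algebra X setT [set j']; have := hC _ h1; rewrite setTD setC0.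
  - by rewrite eq_sym (negbTE ji).
  - apply/seteqP; split => w /=; first by move=> Bw j' _; case: eqP.
    by move=> /(_ j I); rewrite eqxx.
split; first exact: (others_meas fX hC).
apply: ms_closure_sub; first exact: Alg_bdd.
rewrite (_ : \1_ _ = fun w => \1_(Z j t @^-1` B) w * cos (leval (Z i) [::] w + 0)).
  by apply: trig_alg_cos => //; have [] := gap_comb_lin (node k) h.
by apply/funext => w; rewrite /leval big_nil addr0 cos0 mulr1.
Qed.

Lemma rest_past i k A : past X A -> rest i k A.
Proof.
move: A; apply: smallest_sub; first exact: rest_sigma_algebra.
move=> A [t [j [B [/= t0 _ mB ->]]]].
have [->|ji] := eqVneq j i; last exact: rest_other.
have -> : Z i t = leval (Z i) [:: (1, t)].
  by apply/funext => w; rewrite /leval big_cons big_nil/= mul1r addr0.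
apply: rest_leval => //; have nk := node_ge0 k; split.
  by move=> x; rewrite inE => /eqP->/=; left; exact: le_trans nk.
rewrite big_cons big_nil/= ifF//; apply/negbTE; rewrite -ltNge.
by apply: le_lt_trans t0 _; rewrite ltr_wpDl.
Qed.

Lemma rest_incr i k j k' : (j != i) || (k' != k) -> sub_meas (rest i k) (incr k' j).
Proof.
have [->/= kk|ji _] := eqVneq j i.
  have -> : incr k' i = leval (Z i) (increment (node k') h).
    by apply/funext => w; rewrite leval_increment.
  apply: rest_leval; apply: increment_gap_comb => //; rewrite /node.
  move: kk; rewrite neq_ltn => /orP[lt|lt]; [left|right];
  by rewrite -addrA lerD2l -{2}[h]mul1r -mulrDl ler_pM2r// natr1 ler_nat.
have sE := rest_sigma_algebra i k.
apply: sub_measD => //; first exact: rest_other.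
by apply: sub_measN => //; exact: rest_other.
Qed.

(** Given everything else, an increment is not concentrated near any centre that
    is itself computed from everything else. *)
Lemma rest_small i k B (m : Omega -> R) : rest i k B -> sub_meas (rest i k) m ->
  (P (B `&` [set w | (`|incr k i w - m w| <= c0 / 12 * h `^ H)%R]) <= (3 / 4)%:E * P B)%E.
Proof.
move=> hB hm; have hH : 0 < h `^ H by exact: powR_gt0.
have s0 : 0 < c0 * h `^ H by exact: mulr_gt0.
have mI : measurable_fun setT (incr k i).
  by apply: measurable_funB; exact: (measurable_component fX).
apply: (random_centre (EE := rest i k)) => //.
- by move=> C [].
- exact: rest_setI.
- by rewrite mulr_gt0// divr_gt0.
- by move=> _ A mA; rewrite setTI; have [] := hm A mA.
- move=> C x hC.
  have := @one_increment_cst _ _ _ P H (Z i) (fbm_component fX i) (others X i)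
    (@others_meas _ _ _ _ _ _ _ fX i) (@others_I _ _ _ _ X i)
    (fun C l B => @others_indep _ _ _ _ P H X fX i C l B) _ (gap_comb_lin (node k) h)
    (increment (node k) h) _ s0
    (fun l hl => lnd (node_ge0 k) h0 hl) C x hC.
  have -> : c0 / 12 * h `^ H + c0 / 12 * h `^ H = c0 * h `^ H / 6 by field.
  by under eq_set do rewrite leval_increment.
Qed.

Definition incr_mx (w : Omega) : 'M[R]_(N, n) := \matrix_(k, j) incr k j w.

Definition almost_maximal (tau : R) (r : nat) (J : 'I_r -> 'I_N) (S : 'I_r -> 'I_n)
  (i : 'I_n) : set Omega := [set w | minor (incr_mx w) J S != 0 /\
    forall k, `|minor (incr_mx w) (ext k J) (ext i S)| <= tau * `|minor (incr_mx w) J S|].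

(** The value of the new entry for which the extended minor vanishes. *)
Let centre (r : nat) (J : 'I_r -> 'I_N) (S : 'I_r -> 'I_n) (i : 'I_n) (k : 'I_N) (w : Omega) : R :=
  - (\det (corner0 (mxsub (ext k J) (ext i S) (incr_mx w))) * (minor (incr_mx w) J S)^-1).

Let rest_minor r (J : 'I_r -> 'I_N) (S : 'I_r -> 'I_n) i k : (forall b, S b != i) ->
  sub_meas (rest i k) (fun w => minor (incr_mx w) J S).
Proof.
move=> Si; apply: sub_meas_det; first exact: rest_sigma_algebra.
move=> x y; rewrite (_ : (fun w => _) = incr (J x) (S y)); last first.
  by apply/funext => w; rewrite !mxE.
by apply: rest_incr; rewrite Si.
Qed.

Let rest_centre r (J : 'I_r -> 'I_N) (S : 'I_r -> 'I_n) i (k k' : 'I_N) :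
  (forall b, S b != i) -> (forall x, J x != k) ->
  sub_meas (rest i k) (centre J S i k').
Proof.
move=> Si Jk; have sE := rest_sigma_algebra i k.
apply: sub_measN => //; apply: sub_measM => //; last first.
  by apply: sub_measV => //; exact: rest_minor.
apply: sub_meas_det => // x y.
rewrite (_ : (fun w => _) = fun w => if (x == ord0) && (y == ord0) then 0
    else incr (ext k' J x) (ext i S y) w); last first.
  by apply/funext => w; rewrite !mxE.
case: (boolP ((x == ord0) && (y == ord0))) => [_|xy]; first exact: sub_meas_cst.
apply: rest_incr; move: xy; rewrite /ext.
case: (unliftP ord0 x) => [x' ->|->]; case: (unliftP ord0 y) => [y' ->|->] //=.
- by rewrite Si.
- by rewrite Jk orbT.
- by rewrite Si.
Qed.

Lemma incr_meas k j : measurable_fun setT (incr k j).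
Proof. by apply: measurable_funB; exact: (measurable_component fX). Qed.

Lemma measurable_det q (M : Omega -> 'M[R]_q) :
  (forall x y, measurable_fun setT (fun w => M w x y)) ->
  measurable_fun setT (fun w => \det (M w)).
Proof.
move=> hM _ B mB; rewrite setTI.
apply: (@sub_meas_det _ _ measurable) => //; first exact: sigma_algebra_measurable.
by move=> x y C mC; rewrite -[X in measurable X]setTI; exact: hM.
Qed.

Let minor_meas r (J : 'I_r -> 'I_N) (S : 'I_r -> 'I_n) :
  measurable_fun setT (fun w => minor (incr_mx w) J S).
Proof.
apply: measurable_det => x y; rewrite (_ : (fun w => _) = incr (J x) (S y)).
  exact: incr_meas.
by apply/funext => w; rewrite !mxE.
Qed.

Let minor_neq0E r (J : 'I_r -> 'I_N) (S : 'I_r -> 'I_n) :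
  [set w | minor (incr_mx w) J S != 0] = (fun w => minor (incr_mx w) J S) @^-1` ~` [set 0].
Proof. by apply/seteqP; split => w /= /eqP. Qed.

Let minor_neq0_meas r (J : 'I_r -> 'I_N) (S : 'I_r -> 'I_n) :
  measurable [set w | minor (incr_mx w) J S != 0].
Proof.
rewrite minor_neq0E -[X in measurable X]setTI; apply: minor_meas => //.
by apply: measurableC; exact: measurable_set1.
Qed.

Let centre_meas r (J : 'I_r -> 'I_N) (S : 'I_r -> 'I_n) i k :
  measurable_fun setT (centre J S i k).
Proof.
apply: measurableT_comp; first exact: oppr_measurable.
apply: measurable_funM; last first.
  by apply: measurableT_comp; [exact: measurable_invr|exact: minor_meas].
apply: measurable_det => x y; rewrite (_ : (fun w => _) = fun w =>
    if (x == ord0) && (y == ord0) then 0 else incr (ext k J x) (ext i S y) w).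
  case: (boolP ((x == ord0) && (y == ord0))) => _; first exact: measurable_cst.
  exact: incr_meas.
by apply/funext => w; rewrite !mxE.
Qed.

Lemma almost_maximal_meas tau r (J : 'I_r -> 'I_N) (S : 'I_r -> 'I_n) i :
  measurable (almost_maximal tau J S i).
Proof.
rewrite (_ : almost_maximal _ _ _ _ = [set w | minor (incr_mx w) J S != 0] `&`
  \bigcap_(k in [set: 'I_N]) [set w | `|minor (incr_mx w) (ext k J) (ext i S)| <=
     tau * `|minor (incr_mx w) J S|]); last first.
  by apply/seteqP; split => w [h1 h2]; split => // k; [move=> _|]; exact: h2.
apply: measurableI; first exact: minor_neq0_meas.
apply: fin_bigcap_measurable => // k _.
rewrite -[X in measurable X]setTI; apply: measurable_fun_ler => //.
  by apply: measurableT_comp.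
by apply: measurable_funM => //; apply: measurableT_comp.
Qed.

(** Each row outside the pivots [J] costs a factor [3 / 4]: on this event the
    [k]-th increment of the [i]-th component is close to a centre computed from
    the other components and from the pivot rows. *)
Lemma almost_maximal_prob r (J : 'I_r -> 'I_N) (S : 'I_r -> 'I_n) i A :
  past X A -> (forall b, S b != i) ->
  (P (A `&` almost_maximal (c0 / 12 * h `^ H) J S i) <= ((3 / 4) ^+ (N - r))%:E * P A)%E.
Proof.
move=> hA Si.
have mA : measurable A by exact: (sigma_process_measurable fX) hA.
set tau := c0 / 12 * h `^ H.
pose ks := [seq k <- enum 'I_N | [forall x, J x != k]].
pose B := A `&` [set w | minor (incr_mx w) J S != 0].
have mB : measurable B by rewrite /B; exact: measurableI.
pose W (k : 'I_N) := [set w | `|incr k i w - centre J S i k w| <= tau].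
have inks k : k \in ks -> forall x, J x != k.
  by rewrite mem_filter => /andP[/forallP].
have restB (k : 'I_N) : rest i k B.
  apply: rest_setI; first exact: rest_past.
  rewrite minor_neq0E.
  by apply: rest_minor => //; apply: measurableC; exact: measurable_set1.
have restW (k k' : 'I_N) : k \in ks -> k != k' -> rest i k (W k').
  move=> kks kk'; have sE := rest_sigma_algebra i k.
  have h1 : sub_meas (rest i k) (fun w => `|incr k' i w - centre J S i k' w|).
    apply: (sub_meas_comp sE (h := fun x => `|x|)); first exact: normr_measurable.
    apply: sub_measD => //; first by apply: rest_incr; rewrite eq_sym kk' orbT.
    by apply: sub_measN => //; apply: rest_centre => //; exact: inks.
  have := h1 `]-oo, tau]%classic (measurable_itv _).
  by congr (rest _ _ _); apply/seteqP; split => w /=; rewrite in_itv.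
have mW k : measurable (W k).
  rewrite /W -[X in measurable X]setTI; apply: measurable_fun_ler => //.
  by apply: measurableT_comp => //; apply: measurable_funB; [exact: incr_meas|exact: centre_meas].
have sz : (N - r <= size ks)%N.
  have hE : (size ks + size [seq k <- enum 'I_N | k \in codom J])%N = N.
    rewrite !size_filter -[RHS]card_ord cardE -(count_predC (mem (codom J))) addnC.
    congr addn; apply: eq_count => k /=; apply/forallP/idP => [Jk|Jk x].
      by apply/negP => /codomP[x kJ]; have := Jk x; rewrite kJ eqxx.
    by apply: contra Jk => /eqP <-; exact: codom_f.
  rewrite leq_subLR -{1}hE addnC leq_add2r.
  apply: leq_trans (_ : #|codom J| <= r)%N; last first.
    by rewrite -[X in (_ <= X)%N](card_ord r); exact: leq_image_card.
  by rewrite cardE enumT.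
apply: (@le_trans _ _ (P (B `&` \bigcap_(k in [set` ks]) W k))).
  apply: le_measure; rewrite ?inE.
  - by apply: measurableI => //; exact: almost_maximal_meas.
  - apply: measurableI => //.
    by apply: fin_bigcap_measurable => //; exact: finite_seq.
  - move=> w [Aw [m0 hm]]; split; first by split.
    move=> k /= kks; rewrite /W /=.
    have := hm k; rewrite minor_ext -/(centre J S i k w).
    set D := minor _ _ _ in m0 *; set E := \det _ => hE.
    have Dp : 0 < `|D| by rewrite normr_gt0.
    rewrite /centre -/D -/E opprK.
    have -> : incr k i w + E * D^-1 = (incr_mx w k i * D + E) / D.
      by rewrite mxE; field.
    by rewrite normrM normfV ler_pdivrMr.
apply: le_trans (iterated_increments (EE := fun k : 'I_N => rest i k) (q := 3 / 4) _ _ _ _ _ _) _.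
- by move=> k; exact: rest_setI.
- by rewrite divr_ge0.
- by rewrite filter_uniq ?enum_uniq.
- by move=> k _; exact: restB.
- by move=> k k' kks _; exact: restW.
- move=> k C kks hC; apply: rest_small => //.
  apply: rest_centre => //; exact: inks.
apply: (@le_trans _ _ (((3 / 4) ^+ size ks)%:E * P A)%E).
  apply: lee_wpmul2l; first by rewrite lee_fin exprn_ge0// divr_ge0.
  by apply: le_measure; rewrite ?inE// => w [].
apply: lee_wpmul2r => //; rewrite lee_fin.
by apply: ler_wiXn2l => //; lra.
Qed.
End fbm_block.

Lemma finite_union_prob {R : realType} d (Omega : measurableType d)
    (P : probability Omega R) (I : finType) (B : I -> set Omega) A (q : R) :
  0 <= q -> measurable A -> (forall i, measurable (B i)) ->
  (forall i, P (A `&` B i) <= q%:E * P A)%E ->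
  (P (A `&` \bigcup_i B i) <= (#|I|%:R * q)%:E * P A)%E.
Proof.
move=> q0 mA mB hB.
have hs (s : seq I) : (P (A `&` \big[setU/set0]_(i <- s) B i) <= ((size s)%:R * q)%:E * P A)%E.
  elim: s => [|i s IH]; first by rewrite big_nil setI0 measure0 mul0r mul0e.
  have mU : measurable (\big[setU/set0]_(j <- s) B j) by exact: bigsetU_measurable.
  rewrite big_cons setIUr; apply: (@le_trans _ _ (P (A `&` B i) + P (A `&` \big[setU/set0]_(j <- s) B j))%E).
    by apply: measureU2; exact: measurableI.
  rewrite /= -natr1 mulrDl mul1r addrC EFinD.
  by rewrite ge0_muleDl ?lee_fin ?mulr_ge0//; exact: leeD.
have -> : \bigcup_i B i = \big[setU/set0]_(i <- enum I) B i.
  rewrite -bigcup_seq; apply/seteqP; split => w [i _ Bw]; exists i => //=.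
  by rewrite mem_enum.
by rewrite cardE; exact: hs.
Qed.

Section flat_block.
Context {R : realType} (n : nat) d (Omega : measurableType d) (P : probability Omega R).
Variables (H : R) (X : R -> Omega -> 'rV[R]_n).
Hypothesis fX : is_fbm P H X.
Variables (c0 : R) (c0p : 0 < c0).
Hypothesis lnd : forall p h l, 0 <= p -> 0 < h -> gap_comb p h l ->
  (c0 * h `^ H) ^+ 2 <= cov (2 * H) (increment p h ++ lscale (-1) l)
     (increment p h ++ lscale (-1) l).

Definition flat (a h e : R) (N : nat) : set Omega := [set w | exists2 phi : 'I_n -> R,
  \sum_i phi i ^+ 2 = 1 &
  forall k, (k < N)%N -> `|\sum_i phi i * incr X a h k i w| <= e].

(** A union bound over the finitely many minors: the random direction [phi] has
    been replaced by a number of choices that is polynomial in [N]. *)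
Lemma flat_prob (a h e : R) (N : nat) : 0 <= a -> 0 < h -> 0 <= e -> (0 < N)%N ->
  n%:R ^+ 2 * e < c0 / 12 * h `^ H ->
  exists U, [/\ measurable U, flat a h e N `<=` U & forall A, past X A ->
    (P (A `&` U) <= (((n ^ n.+2) * N ^ n)%:R * (3 / 4) ^+ (N - n))%:E * P A)%E].
Proof.
move=> a0 h0 e0 N0 he; set tau := c0 / 12 * h `^ H in he.
have tau0 : 0 < tau by rewrite mulr_gt0 ?powR_gt0// divr_gt0.
pose T : finType := {r : 'I_n & ({ffun 'I_r -> 'I_N} * {ffun 'I_r -> 'I_n} * 'I_n)%type}.
pose B (t : T) := let: (J, K, i) := tagged t in
  if [forall b, K b != i] then almost_maximal X a h tau J K i else set0.
have mB t : measurable (B t).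
  case: t => r [[J S] i]; rewrite /B /=; case: ifPn => // _.
  exact: (almost_maximal_meas fX).
exists (\bigcup_t B t); split.
- by apply: fin_bigcup_measurable => //; exact: finite_finset.
- move=> w [phi phi1 hphi].
  have [|r [J [S [i [Si m0 hm]]]]] := small_kernel_minor (G := incr_mx X a h N w) e0 tau0 he phi1.
    move=> k; rewrite (eq_bigr (fun i => phi i * incr X a h k i w)); first exact: hphi.
    by move=> i _; rewrite mxE.
  exists (existT _ r (J, S, i)) => //; rewrite /B /= ifT//.
  exact/forallP.
move=> A hA; have mA := sigma_process_measurable fX hA.
have cT : (#|{: T}| <= n ^ n.+2 * N ^ n)%N.
  have n0 : (n <= n)%N by [].
  have bnd (r : 'I_n) : (#|{: {ffun 'I_r -> 'I_N} * {ffun 'I_r -> 'I_n} * 'I_n}| <= N ^ n * n ^ n * n)%N.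
    rewrite !card_prod !card_ffun !card_ord leq_mul2r; apply/orP; right.
    have np : (0 < n)%N by apply: leq_ltn_trans (ltn_ord r).
    by apply: leq_mul; apply: leq_pexp2l => //; exact: ltnW.
  rewrite card_tagged; apply: (@leq_trans (n * (N ^ n * n ^ n * n))%N); last first.
    by rewrite !expnS; lia.
  rewrite sumnE big_map -[X in (_ <= X * _)%N](card_ord n) cardE -sum1_size big_distrl /=.
  by apply: leq_sum => r _; rewrite mul1n; exact: bnd.
apply: (@le_trans _ _ ((#|{: T}|%:R * (3 / 4) ^+ (N - n))%:E * P A)%E).
  apply: finite_union_prob => //.
  move=> [r [[J S] i]]; rewrite /B /=; case: ifPn => Si; last first.
    by rewrite setI0 measure0 mule_ge0// lee_fin exprn_ge0// divr_ge0.
  have := almost_maximal_prob fX c0p lnd a0 h0 J hA (fun b => forallP Si b).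
  move=> /le_trans; apply.
  apply: lee_wpmul2r => //; rewrite lee_fin; apply: ler_wiXn2l; [lra|lra|].
  by rewrite leq_sub2l// ltnW.
apply: lee_wpmul2r => //; rewrite lee_fin ler_wpM2r ?exprn_ge0 ?divr_ge0//.
by rewrite ler_nat.
Qed.
End flat_block.

(** * Summation over the dyadic intervals *)

Section exponential_bounds.
Context {R : realType}.
Implicit Types a z rho : R.

Lemma exprn_le_expR a z k : 0 < a -> 0 <= z -> z ^+ k <= (k%:R / a) ^+ k * expR (a * z).
Proof.
move=> a0 z0; case: k => [|k]; first by rewrite !expr0 mul1r -expR0 ler_expR mulr_ge0// ltW.
have k0 : 0 < k.+1%:R :> R by rewrite ltr0n.
have -> : expR (a * z) = expR (a * z / k.+1%:R) ^+ k.+1.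
  by rewrite -expRM_natr; congr expR; field; rewrite gt_eqF.
rewrite -exprMn; apply: lerXn2r; rewrite ?nnegrE//.
  by rewrite mulr_ge0 ?expR_ge0// divr_ge0// ltW.
apply: (@le_trans _ _ (k.+1%:R / a * (a * z / k.+1%:R))).
  by rewrite le_eqVlt; apply/orP; left; apply/eqP; field; rewrite !gt_eqF.
rewrite ler_wpM2l ?divr_ge0 ?(ltW a0)//.
by apply: le_trans (expR_ge1Dx _); rewrite lerDr.
Qed.

(** The polynomial number of choices does not spoil the geometric decay. *)
Lemma polynomial_geometric_le n : exists2 C : R, 0 < C & forall N : nat,
  N.+1%:R ^+ n * (3 / 4) ^+ (N - n) <= C * expR (- (N.+1%:R / 8)).
Proof.
exists ((4 / 3) ^+ n * expR (1 / 4) * (n%:R / (1 / 8)) ^+ n + 1).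
  by rewrite ltr_wpDl// !mulr_ge0 ?expR_ge0 ?exprn_ge0 ?divr_ge0.
move=> N; have z0 : 0 <= N.+1%:R :> R by [].
have h1 : (3 / 4) ^+ (N - n) <= (4 / 3) ^+ n * (3 / 4 : R) ^+ N.
  have e1 k : (4 / 3) ^+ k * (3 / 4) ^+ k = 1 :> R.
    by rewrite -exprMn (_ : 4 / 3 * (3 / 4) = 1) ?expr1n//; field.
  have [nN|Nn] := leqP n N.
    by rewrite -[in X in _ <= X](subnK nN) exprD mulrCA e1 mulr1.
  rewrite (_ : (N - n = 0)%N) ?expr0; last by apply/eqP; rewrite subn_eq0 ltnW.
  rewrite -[leLHS](e1 N) ler_wpM2r ?exprn_ge0 ?divr_ge0//.
  by apply: ler_weXn2l; [lra|exact: ltnW].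
have h2 : (3 / 4 : R) ^+ N <= expR (1 / 4) * expR (- (N.+1%:R / 4)).
  have -> : expR (1 / 4 : R) * expR (- (N.+1%:R / 4)) = expR (- (1 / 4)) ^+ N.
    rewrite -expRD -expRM_natr -natr1; congr expR; by field.
  apply: lerXn2r; rewrite ?nnegrE ?expR_ge0 ?divr_ge0//.
  by apply: le_trans (expR_ge1Dx _); lra.
have h3 := @exprn_le_expR (1 / 8) _ n ltac:(lra) z0.
set z := N.+1%:R in h2 h3 z0 *.
have e2 : expR (1 / 8 * z) * expR (- (z / 4)) = expR (- (z / 8)).
  by rewrite -expRD; congr expR; field.
apply: (@le_trans _ _ (((n%:R / (1 / 8)) ^+ n * expR (1 / 8 * z)) *
   ((4 / 3) ^+ n * (expR (1 / 4) * expR (- (z / 4)))))).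
  apply: ler_pM => //; rewrite ?exprn_ge0 ?divr_ge0//.
  by apply: le_trans h1 _; rewrite ler_wpM2l ?exprn_ge0 ?divr_ge0.
rewrite (_ : _ * _ = (4 / 3) ^+ n * expR (1 / 4) * (n%:R / (1 / 8)) ^+ n *
   (expR (1 / 8 * z) * expR (- (z / 4)))); last by ring.
by rewrite e2 ler_wpM2r ?expR_ge0// lerDl.
Qed.

(** The number [2 ^+ m] of dyadic intervals is absorbed, with a factor [2 ^- m] to
    spare for the sum over [m], by half of the exponent; the other half is
    kept for the tail. *)
Lemma dyadic_expR_le rho z0 : 1 < rho -> 0 < z0 -> exists2 C : R, 0 < C &
  forall m z, z0 <= z -> 2 ^+ m * expR (- (z * rho ^+ m)) <= C * expR (- (z / 2)) / 2 ^+ m.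
Proof.
move=> rho1 z00.
have [k hk] : exists k, 4 <= rho ^+ k.
  have rp : 0 < rho - 1 by lra.
  pose k := (Num.truncn (4 / (rho - 1))).+1; exists k.
  have hk : 4 / (rho - 1) <= k%:R by apply/ltW; exact: truncnS_gt.
  have : 1 + k%:R * (rho - 1) <= rho ^+ k.
    clearbody k; elim: k {hk} => [|k IH]; first by rewrite mul0r addr0 expr0.
    rewrite exprS -natr1; have k0 : 0 <= k%:R :> R by [].
    apply: le_trans (ler_wpM2l _ IH); last by lra.
    by have := mulr_ge0 k0 (sqr_ge0 (rho - 1)); nra.
  by move: hk; rewrite ler_pdivrMr//; lra.
pose a := z0 / 2; have a0 : 0 < a by rewrite divr_gt0.
exists ((k%:R / a) ^+ k + 1).
  by rewrite ltr_wpDl// exprn_ge0// divr_ge0// ltW.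
move=> m z zz.
have r1 : 1 <= rho ^+ m by rewrite exprn_ege1// ltW.
have r0 : 0 <= rho ^+ m by lra.
have h1 := @exprn_le_expR a _ k a0 r0.
have h2 : 4 ^+ m <= (rho ^+ m) ^+ k :> R.
  by rewrite -exprM mulnC exprM lerXn2r// nnegrE; lra.
rewrite ler_pdivlMr ?exprn_gt0//.
have -> : 2 ^+ m * expR (- (z * rho ^+ m)) * 2 ^+ m = 4 ^+ m * expR (- (z * rho ^+ m)).
  by rewrite mulrAC -exprMn (_ : 2 * 2 = 4)//; ring.
apply: (@le_trans _ _ ((k%:R / a) ^+ k * expR (a * rho ^+ m) * expR (- (z / 2 + a * rho ^+ m)))).
  apply: ler_pM; rewrite ?exprn_ge0 ?expR_ge0//; first exact: le_trans h1.
  by rewrite ler_expR lerN2 /a; nra.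
rewrite -mulrA -expRD (_ : a * rho ^+ m - (z / 2 + a * rho ^+ m) = - (z / 2)); last by ring.
by rewrite ler_wpM2r ?expR_ge0// lerDl.
Qed.

End exponential_bounds.

Section dyadic_reduction.
Context {R : realType} (n : nat).
Implicit Types (x : R -> 'rV[R]_n) (theta T q : R).

Lemma enorm1_sum (u : 'rV[R]_n) : enorm u = 1 -> \sum_i u ord0 i ^+ 2 = 1.
Proof.
move=> u1; have <- : dotp u u = \sum_i u ord0 i ^+ 2 by apply: eq_bigr => i _; rewrite expr2.
have d0 : 0 <= dotp u u by apply: sumr_ge0 => i _; rewrite -expr2 sqr_ge0.
by rewrite -(sqr_sqrtr d0) -/(enorm u) u1 expr1n.
Qed.

(** A scale [e] at which roughness fails contains a dyadic interval of comparable
    length through the time [s]. *)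
Lemma not_rough_dyadic x theta T q : 0 < T -> 0 <= q -> 0 < theta < 1 ->
  ~ rough_const theta T x q ->
  exists m j (phi : 'I_n -> R), [/\ (j < 2 ^ m)%N, \sum_i phi i ^+ 2 = 1 &
    forall u v, let D := T / 2 ^+ m in
      j%:R * D <= u <= j.+1%:R * D -> j%:R * D <= v <= j.+1%:R * D ->
      `|\sum_i phi i * (x u ord0 i - x v ord0 i)| <= 4 * q * D `^ theta].
Proof.
move=> T0 q0 /andP[th0 th1] nR.
have [s [e [phi [/andP[s0 sT] /andP[e0 eT] phi1 hphi]]]] : exists s e phi,
  [/\ 0 <= s <= T, 0 < e <= T / 2, enorm phi = 1 & forall t, 0 <= t <= T -> `|t - s| <= e ->
     `|dotp phi (x t - x s)| <= q * e `^ theta].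
  apply: contrapT => h; apply: nR => s e phi hs he hphi; apply: contrapT => h'.
  apply: h; exists s, e, phi; split => // t tT ts; rewrite leNgt; apply/negP => lt.
  by apply: h'; exists t.
have exm : exists m, T / 2 ^+ m <= e.
  exists (Num.truncn (T / e)).+1; set k := (Num.truncn _).+1.
  have Tk : T / e <= k%:R by apply/ltW; exact: truncnS_gt.
  have k2 : k%:R <= 2 ^+ k :> R by rewrite -natrX ler_nat ltnW// ltn_expl.
  rewrite ler_pdivrMr ?exprn_gt0// mulrC -ler_pdivrMr//; exact: le_trans k2.
case: (ex_minnP exm) => m Tm minm.
have D0 : 0 < T / 2 ^+ m by rewrite divr_gt0// exprn_gt0.
have e2D : e <= 2 * (T / 2 ^+ m).
  case: m minm {Tm D0} => [|m] minm; first by rewrite expr0; lra.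
  have /negP : ~ T / 2 ^+ m <= e by move=> /minm; rewrite ltnn.
  rewrite -ltNge => /ltW /le_trans; apply; rewrite exprS.
  by rewrite le_eqVlt; apply/orP; left; apply/eqP; field; rewrite expf_neq0.
set D := T / 2 ^+ m in D0 e2D Tm.
have TD : T = (2 ^ m)%:R * D by rewrite natrX /D; field; rewrite expf_neq0.
have [j [j2 js sj]] : exists j, [/\ (j < 2 ^ m)%N, j%:R * D <= s & s <= j.+1%:R * D].
  have [sT'|Ts] := ltP s T.
    have sD0 : 0 <= s / D by rewrite divr_ge0// ltW.
    have /andP[h1 h2] := truncn_itv sD0.
    exists (Num.truncn (s / D)); split.
    - by rewrite truncn_lt_nat// ltr_pdivrMr// -TD.
    - by rewrite -ler_pdivlMr.
    - by rewrite -ler_pdivrMr// ltW.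
  have p2 : (0 < 2 ^ m)%N by rewrite expn_gt0.
  exists (2 ^ m).-1; rewrite prednK// -TD; split => //; apply: le_trans Ts.
  by rewrite TD ler_pM2r// ler_nat leq_pred.
exists m, j, (fun i => phi ord0 i); split => //; first exact: enorm1_sum.
have jT : j.+1%:R * D <= T by rewrite TD ler_pM2r// ler_nat.
have jD : 0 <= j%:R * D by rewrite mulr_ge0// ltW.
have near_s u : j%:R * D <= u <= j.+1%:R * D -> `|dotp phi (x u - x s)| <= q * e `^ theta.
  rewrite -natr1 in sj jT *; move=> /andP[u1 u2]; apply: hphi; first by apply/andP; split; lra.
  by apply: le_trans Tm; rewrite ler_norml; apply/andP; split; lra.
move=> u v /= /near_s hu /near_s hv.
have -> : \sum_i phi ord0 i * (x u ord0 i - x v ord0 i) = dotp phi (x u - x s) - dotp phi (x v - x s).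
  by rewrite /dotp -sumrB; apply: eq_bigr => i _; rewrite !mxE; ring.
apply: (le_trans (ler_normB _ _)).
have eth : q * e `^ theta <= q * (2 * D `^ theta).
  rewrite ler_wpM2l//; apply: (@le_trans _ _ ((2 * D) `^ theta)).
    by apply: ge0_ler_powR; rewrite ?nnegrE; lra.
  rewrite powRM; [|lra|exact: ltW]; rewrite ler_wpM2r ?powR_ge0//.
  by rewrite -[leRHS]powRr1; [apply: ler_powR; lra|lra].
by apply: le_trans (lerD hu hv) _; lra.
Qed.

End dyadic_reduction.

Lemma nneseries_geometric_le {R : realType} (u : nat -> \bar R) (C : R) (x : \bar R) :
  0 <= C -> (0 <= x)%E -> (forall m, 0 <= u m)%E ->
  (forall m, u m <= (C / 2 ^+ m)%:E * x)%E ->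
  (\sum_(m <oo) u m <= (2 * C)%:E * x)%E.
Proof.
move=> C0 x0 u0 hu; apply: lime_le; first by apply: is_cvg_nneseries => m _ _.
apply: nearW => k.
apply: (@le_trans _ _ ((C * (2 - 2 / 2 ^+ k))%:E * x)%E); last first.
  apply: lee_wpmul2r => //; rewrite lee_fin mulrC ler_wpM2r// lerBlDr lerDl.
  by rewrite divr_ge0// exprn_ge0.
elim: k => [|k IH].
  by rewrite big_geq// expr0 divr1 subrr mulr0 mul0e.
rewrite big_nat_recr//=; apply: le_trans (leeD IH (hu k)) _.
have p2 : 0 < 2 ^+ k :> R by rewrite exprn_gt0.
have i0 : 0 < (2 ^+ k)^-1 :> R by rewrite invr_gt0.
rewrite -ge0_muleDl ?lee_fin.
- apply: lee_wpmul2r => //; rewrite -EFinD lee_fin le_eqVlt; apply/orP; left; apply/eqP.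
  by rewrite exprS; field; rewrite gt_eqF.
- rewrite mulr_ge0// subr_ge0 ler_pdivrMr// ler_peMr//.
  by rewrite exprn_ege1//; lra.
- by rewrite divr_ge0// ltW.
Qed.

Lemma geometric_union_prob {R : realType} d (Omega : measurableType d)
    (P : probability Omega R) (V : nat -> set Omega) A (C : R) :
  0 <= C -> measurable A -> (forall m, measurable (V m)) ->
  (forall m, P (A `&` V m) <= (C / 2 ^+ m)%:E * P A)%E ->
  (P (A `&` \bigcup_m V m) <= (2 * C)%:E * P A)%E.
Proof.
move=> C0 mA mV hV.
apply: (@le_trans _ _ (\sum_(m <oo) P (A `&` V m))%E); last exact: nneseries_geometric_le.
rewrite setI_bigcupr; apply: measure_sigma_subadditive => //.
  by move=> m; exact: measurableI.
by apply: bigcup_measurable => m _; exact: measurableI.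
Qed.

Section window.
Context {R : realType}.
Variables (H theta T c0 : R) (n : nat).
Hypotheses (hH : 0 < H <= 1 / 2) (hT : 0 < T) (hth : H < theta < 1) (c00 : 0 < c0).

(** The number of pieces of a dyadic interval of length [T / 2 ^+ m] is
    [mesh_cst * eps ^- 2 * mesh_ratio ^+ m]: few enough for the oscillation
    allowed on the interval to stay below the standard deviation of the
    increments over the pieces. The ratio exceeds [1] because
    [theta > H]. *)
Definition mesh_cst : R := (c0 / (192 * (n%:R ^+ 2 + 1)) * T `^ (H - theta)) `^ H^-1.

Definition mesh_ratio : R := 2 `^ (theta / H - 1).

Let H0 : 0 < H. Proof. by case/andP: hH. Qed.
Let k0 : 0 < c0 / (192 * (n%:R ^+ 2 + 1)) * T `^ (H - theta).
Proof. by rewrite mulr_gt0 ?powR_gt0// divr_gt0// mulr_gt0// ltr_wpDl// exprn_ge0. Qed.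

Lemma mesh_cst_gt0 : 0 < mesh_cst.
Proof. exact: powR_gt0. Qed.

Lemma mesh_ratio_gt1 : 1 < mesh_ratio.
Proof.
have /andP[h1 h2] := hth.
rewrite /mesh_ratio /powR gt_eqF// expR_gt1 mulr_gt0 ?ln_gt0 ?ltr1n//.
by rewrite subr_gt0 ltr_pdivlMr// mul1r.
Qed.

(** This is where [H <= 1 / 2] enters: the exact number of pieces would involve
    [eps `^ (- H^-1)], which is at least [eps ^- 2]. *)
Lemma mesh_window eps m N : 0 < eps < 1 -> (0 < N)%N ->
  N%:R <= mesh_cst * eps ^- 2 * mesh_ratio ^+ m ->
  n%:R ^+ 2 * (4 * (2 * eps) * (T / 2 ^+ m) `^ theta) < c0 / 12 * (T / 2 ^+ m / N%:R) `^ H.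
Proof.
move=> /andP[e0 e1] N0 hN; set D := T / 2 ^+ m.
have /andP[h1 h2] := hth; have /andP[_ H2] := hH.
have p0 : 0 < 2 ^+ m :> R by rewrite exprn_gt0.
have D0 : 0 < D by rewrite divr_gt0.
have NR : 0 < N%:R :> R by rewrite ltr0n.
pose s := theta - H.
have DN : (D / N%:R) `^ H * N%:R `^ H = D `^ H.
  have DN0 : 0 <= D / N%:R by rewrite divr_ge0// ltW.
  by rewrite -powRM// divfK// gt_eqF.
have NH : N%:R `^ H <= c0 / (192 * (n%:R ^+ 2 + 1)) * T `^ (H - theta) * eps^-1 * (2 ^+ m) `^ s.
  apply: (@le_trans _ _ ((mesh_cst * eps ^- 2 * mesh_ratio ^+ m) `^ H)).
    apply: ge0_ler_powR; rewrite ?nnegrE ?(ltW H0)//.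
    exact: le_trans hN.
  have m0 := mesh_cst_gt0; have r0 : 0 < mesh_ratio by exact: powR_gt0.
  have ei : 0 < eps ^- 2 by rewrite invr_gt0 exprn_gt0.
  rewrite powRM ?mulr_ge0 ?exprn_ge0 ?(ltW m0) ?(ltW r0) ?(ltW ei)//.
  rewrite powRM ?(ltW m0) ?(ltW ei)//.
  have -> : mesh_cst `^ H = c0 / (192 * (n%:R ^+ 2 + 1)) * T `^ (H - theta).
    by rewrite -powRrM mulVf ?gt_eqF// powRr1// ltW.
  have -> : (mesh_ratio ^+ m) `^ H = (2 ^+ m) `^ s.
    have -> : mesh_ratio ^+ m = (2 ^+ m) `^ (theta / H - 1).
      rewrite -(powR_mulrn m (ltW r0)) -(powR_mulrn m (ler0n R 2)) /mesh_ratio.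
      by rewrite -[LHS]powRrM -[RHS]powRrM mulrC.
    rewrite -powRrM; congr (_ `^ _); rewrite /s; field.
    by rewrite gt_eqF.
  rewrite ler_wpM2r ?powR_ge0// ler_wpM2l ?(ltW k0)//.
  have ie : 0 < eps^-1 by rewrite invr_gt0.
  have -> : eps ^- 2 = eps^-1 `^ 2%:R by rewrite powR_mulrn ?exprVn// ltW.
  rewrite -powRrM -[leRHS]powRr1 ?(ltW ie)//; apply: ler_powR; last by lra.
  by rewrite -invr1 lef_pV2 ?posrE// ltW.
have DD : D `^ theta * (2 ^+ m) `^ s = D `^ H * T `^ s.
  have -> : theta = H + s by rewrite /s; lra.
  rewrite powRD; last by rewrite (gt_eqF D0) implybT.
  by rewrite -mulrA -powRM ?(ltW D0) ?(ltW p0)// divfK// gt_eqF.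
have TT : T `^ (H - theta) * T `^ s = 1.
  rewrite -powRD; last by rewrite (gt_eqF hT) implybT.
  by rewrite /s (_ : _ + _ = 0) ?powRr0//; ring.
have NN : 0 < N%:R `^ H by exact: powR_gt0.
rewrite -(ltr_pM2r NN) -[X in _ < X]mulrA DN.
apply: (@le_lt_trans _ _ (n%:R ^+ 2 * (4 * (2 * eps) * D `^ theta) *
   (c0 / (192 * (n%:R ^+ 2 + 1)) * T `^ (H - theta) * eps^-1 * (2 ^+ m) `^ s))).
  by rewrite ler_wpM2l// !mulr_ge0 ?powR_ge0 ?exprn_ge0// ltW.
have -> : n%:R ^+ 2 * (4 * (2 * eps) * D `^ theta) *
   (c0 / (192 * (n%:R ^+ 2 + 1)) * T `^ (H - theta) * eps^-1 * (2 ^+ m) `^ s)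
  = (n%:R ^+ 2 / (n%:R ^+ 2 + 1)) * (c0 / 24) * (eps * eps^-1) * (T `^ (H - theta) * (D `^ theta * (2 ^+ m) `^ s)).
  have q0 : 0 < n%:R ^+ 2 + 1 :> R by rewrite ltr_wpDl// exprn_ge0.
  by field; rewrite !gt_eqF.
rewrite DD mulfV ?gt_eqF// mulr1 [D `^ H * _]mulrC [T `^ _ * _]mulrA TT mul1r.
rewrite ltr_pM2r ?powR_gt0//.
have n2 : 0 <= n%:R ^+ 2 :> R by exact: exprn_ge0.
have : n%:R ^+ 2 / (n%:R ^+ 2 + 1) <= 1 :> R by rewrite ler_pdivrMr; lra.
move=> /(ler_wpM2r (ltW c00)).
rewrite mul1r (mulrA _ c0); set x := _ * c0. have := c00. lra.
Qed.

End window.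

Lemma roughness_le_not_rough {R : realType} n (x : R -> 'rV[R]_n) theta T eps q :
  eps < q -> 0 < q -> (roughness theta T x <= eps%:E)%E -> ~ rough_const theta T x q.
Proof.
move=> eq q0; rewrite /roughness ge_max => /andP[_ hsup] hq.
have : (q%:E <= eps%:E)%E by apply: le_trans hsup; apply: ereal_sup_ubound; exists q.
by rewrite lee_fin leNgt eq.
Qed.

(** Conditional probabilities are replaced by the bounds
    [P (A `&` E) <= k * P A] for all [A] in the past. The event is only
    covered by a measurable set here. *)
Lemma roughness_tail {R : realType} (n : nat) (H T theta : R) :
  0 < H <= 1 / 2 -> 0 < T -> H < theta < 1 ->
  exists M c : R, [/\ 0 < M, 0 < c &
    forall (d : measure_display) (Omega : measurableType d)
      (P : probability Omega R) (X : R -> Omega -> 'rV[R]_n), is_fbm P H X ->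
    forall eps, 0 < eps < 1 -> exists U, [/\ measurable U,
      [set w | (roughness theta T (fun t => X t w) <= eps%:E)%E] `<=` U &
      forall A, past X A -> (P (A `&` U) <= (M * expR (- (c * eps ^- 2)))%:E * P A)%E]].
Proof.
move=> hH hT hth; have [c0 c00 lnd] := increment_lnd hH.
have /andP[H0 _] := hH; have /andP[Hth th1] := hth.
have [C1 C10 hC1] := @polynomial_geometric_le R n.
pose K := mesh_cst H theta T c0 n; pose rho := mesh_ratio H theta.
have K0 : 0 < K by exact: mesh_cst_gt0.
have rho1 : 1 < rho by exact: mesh_ratio_gt1.
have K80 : 0 < K / 8 by rewrite divr_gt0.
have [C2 C20 hC2] := dyadic_expR_le rho1 K80.
pose C3 := (n ^ n.+2)%:R * C1 + expR (1 / 8).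
have C30 : 0 < C3 by rewrite ltr_wpDl ?expR_gt0// mulr_ge0// ltW.
exists (2 * (C3 * C2)), (K / 16); split; [by rewrite !mulr_gt0|by rewrite divr_gt0|].
move=> d Omega P X fX eps /andP[e0 e1].
pose z := K * eps ^- 2 / 8.
have ie : 1 <= eps ^- 2 by rewrite -invr1 lef_pV2 ?posrE// ?exprn_ile1 ?exprn_gt0// ltW.
have zK : K / 8 <= z by rewrite /z ler_pM2r// ler_peMr// ltW.
have z0 : 0 < z by apply: lt_le_trans zK; rewrite divr_gt0.
pose y m := K * eps ^- 2 * rho ^+ m; pose N m := Num.truncn (y m).
have y0 m : 0 <= y m by rewrite !mulr_ge0 ?invr_ge0 ?exprn_ge0 ?ltW//; lra.
pose D m := T / 2 ^+ m.
have D0 m : 0 < D m by rewrite divr_gt0// exprn_gt0.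
pose e m := 4 * (2 * eps) * D m `^ theta.
have yz m : y m / 8 = z * rho ^+ m by rewrite /y /z; field; rewrite gt_eqF.
(* when [N m = 0] the bound is at least [1], and the whole space will do *)
have main (t : nat * nat) : exists U, [/\ measurable U,
    flat X (t.2%:R * D t.1) (D t.1 / (N t.1)%:R) (e t.1) (N t.1) `<=` U &
    forall A, past X A -> (P (A `&` U) <= (C3 * expR (- (z * rho ^+ t.1)))%:E * P A)%E].
  case: t => m j /=.
  have yN : y m < (N m).+1%:R by exact: truncnS_gt.
  have [N0|Np] := posnP (N m).
    exists setT; split => // A _; rewrite setIT -[leLHS]mul1e lee_wpmul2r// lee_fin.
    apply: (@le_trans _ _ (expR (1 / 8) * expR (- (z * rho ^+ m)))).
      rewrite -expRD -[leLHS]expR0 ler_expR -yz; move: yN; rewrite N0; lra.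
    by rewrite ler_wpM2r ?expR_ge0// lerDr mulr_ge0// ltW.
  have a0 : 0 <= j%:R * D m by rewrite mulr_ge0// ltW.
  have h0 : 0 < D m / (N m)%:R by rewrite divr_gt0// ltr0n.
  have em0 : 0 <= e m by rewrite /e !mulr_ge0 ?powR_ge0// ltW.
  have yNm : (N m)%:R <= y m by rewrite truncn_le.
  have win := mesh_window hH hT hth c00 (n := n) (introT andP (conj e0 e1)) Np yNm.
  have [U [mU FU hU]] := flat_prob fX c00 lnd a0 h0 em0 Np win.
  exists U; split => // A hA; apply: le_trans (hU A hA) _; apply: lee_wpmul2r => //.
  rewrite lee_fin natrM -mulrA; apply: (@le_trans _ _ ((n ^ n.+2)%:R * (C1 * expR (- (z * rho ^+ m))))).
    rewrite ler_wpM2l//; apply: (@le_trans _ _ (C1 * expR (- ((N m).+1%:R / 8)))).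
      apply: le_trans (hC1 (N m)); rewrite natrX ler_wpM2r ?exprn_ge0 ?divr_ge0//.
      by apply: lerXn2r; rewrite ?nnegrE// ler_nat.
    rewrite ler_pM2l// ler_expR lerN2 -yz; lra.
  by rewrite mulrA ler_wpM2r ?expR_ge0// lerDl expR_ge0.
have [U hU] := choice main.
pose V m := \bigcup_(j in [set: 'I_(2 ^ m)]) U (m, val j).
have mV m : measurable (V m).
  apply: fin_bigcup_measurable => [|j _]; first exact: finite_finset.
  by have [] := hU (m, val j).
exists (\bigcup_m V m); split.
- by apply: bigcup_measurable => m _; exact: mV.
- move=> w /= Lw.
  have q0 : 0 < 2 * eps by lra.
  have eq : eps < 2 * eps by lra.
  have th01 : 0 < theta < 1 by apply/andP; split; lra.
  have [m [j [phi [j2 phi1 hphi]]]] :=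
    not_rough_dyadic hT (ltW q0) th01 (roughness_le_not_rough eq q0 Lw).
  exists m => //; exists (Ordinal j2) => //=.
  have [_ FU _] := hU (m, j); apply: FU; exists phi => //= k kN.
  have Np : 0 < (N m)%:R :> R by rewrite ltr0n; case: (N m) kN.
  have hk (i : nat) : (i <= N m)%N -> j%:R * D m <= j%:R * D m + i%:R * (D m / (N m)%:R) <= j.+1%:R * D m.
    move=> iN; have i0 : 0 <= i%:R / (N m)%:R :> R by exact: divr_ge0.
    have i1 : i%:R / (N m)%:R <= 1 :> R by rewrite ler_pdivrMr// mul1r ler_nat.
    rewrite mulrA mulrAC -natr1; have := D0 m; move: (_ / (N m)%:R) i0 i1 => u; nra.
  have := hphi _ _ (hk k.+1 kN) (hk k (ltnW kN)); rewrite /e.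
  congr (_ <= _); congr (`| _ |); apply: eq_bigr => i _; rewrite /incr /node.
  by rewrite -natr1 mulrDl mul1r addrA.
- move=> A hA; have mA := sigma_process_measurable fX hA.
  have := @geometric_union_prob _ _ _ P V A (C3 * C2 * expR (- (z / 2))) _ mA mV.
  rewrite (_ : z / 2 = K / 16 * eps ^- 2) ?mulrA; last by rewrite /z; field; rewrite gt_eqF.
  apply; first by rewrite !mulr_ge0 ?expR_ge0// ltW.
  move=> m; apply: le_trans (finite_union_prob (q := C3 * expR (- (z * rho ^+ m))) _ mA _ _) _.
  - by rewrite mulr_ge0 ?expR_ge0// ltW.
  - by move=> j; have [] := hU (m, val j).
  - by move=> j; have [_ _ h] := hU (m, val j); exact: h.
  apply: lee_wpmul2r => //; rewrite lee_fin card_ord natrX.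
  rewrite (_ : K / 16 * eps ^- 2 = z / 2); last by rewrite /z; field; rewrite gt_eqF.
  have := hC2 m z zK; move=> /(ler_wpM2l (ltW C30)).
  by congr (_ <= _); ring.
Qed.

(** * Measurability of the roughness *)

Section dot_product.
Context {R : realType} (n : nat).
Implicit Types u v : 'rV[R]_n.

Lemma dotpC u v : dotp u v = dotp v u.
Proof. by apply: eq_bigr => i _; rewrite mulrC. Qed.

Lemma dotpZl a u v : dotp (a *: u) v = a * dotp u v.
Proof. by rewrite /dotp mulr_sumr; apply: eq_bigr => i _; rewrite mxE mulrA. Qed.

End dot_product.

Section countable_quantifiers.
Context d (Omega : measurableType d).

Lemma measurable_exists (U : countType) (Q : U -> set Omega) :
  (forall u, measurable (Q u)) -> measurable [set w | exists u, Q u w].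
Proof.
move=> mQ; rewrite (_ : [set w | _] = \bigcup_u Q u).
  by apply: countable_bigcupT_measurable => //; exact: countableP.
by apply/seteqP; split => w [u]; [exists u|move=> _; exists u].
Qed.

Lemma measurable_forall (U : countType) (Q : U -> set Omega) :
  (forall u, measurable (Q u)) -> measurable [set w | forall u, Q u w].
Proof.
move=> mQ; rewrite (_ : [set w | _] = ~` [set w | exists u, (~` Q u) w]).
  by apply: measurableC; apply: measurable_exists => u; exact: measurableC.
apply/seteqP; split => w /=; first by move=> h [u]; apply.
by move=> h u; apply: contrapT => nQ; apply: h; exists u.
Qed.

Lemma measurable_guard_imp (C : Prop) (Q : set Omega) :
  measurable Q -> measurable [set w | C -> Q w].
Proof.
move=> mQ; have [hC|nC] := pselect C.
  by rewrite (_ : [set w | _] = Q)//; apply/seteqP; split => w /=; [apply|].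
by rewrite (_ : [set w | _] = setT)//; apply/seteqP; split => // w _ /nC.
Qed.

Lemma measurable_guard_and (C : Prop) (Q : set Omega) :
  measurable Q -> measurable [set w | C /\ Q w].
Proof.
move=> mQ; have [hC|nC] := pselect C.
  by rewrite (_ : [set w | _] = Q)//; apply/seteqP; split => w /=; [case|].
by rewrite (_ : [set w | _] = set0)//; apply/seteqP; split => // w [].
Qed.

End countable_quantifiers.

Section rational_roughness.
Context {R : realType} (n : nat).
Variables (theta T : R).
Hypotheses (th0 : 0 < theta) (T0 : 0 < T).
Implicit Types (x : R -> 'rV[R]_n).

Definition rat_vec (psi : {ffun 'I_n -> rat}) : 'rV[R]_n := \row_i ratr (psi i).

(** Roughness tested on rational times, scales and directions. It is homogeneous
    in the direction, as rational unit vectors need not approximate all unit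
    vectors conveniently; the inequality is weak, the slack being taken from the
    constant. *)
Definition rat_rough x (q : R) : Prop :=
  forall (s e : rat) (psi : {ffun 'I_n -> rat}),
    0 <= (ratr s : R) <= T /\ 0 < (ratr e : R) <= T / 2 ->
    exists t : rat, (0 <= (ratr t : R) <= T /\ `|ratr t - ratr s : R| <= ratr e) /\
      q * ratr e `^ theta * enorm (rat_vec psi) <=
        `|dotp (rat_vec psi) (x (ratr t) - x (ratr s))|.

Lemma rat_near s (Q : set R) : 0 <= s <= T -> (\forall u \near s, Q u) ->
  exists2 r : rat, 0 <= (ratr r : R) <= T & Q (ratr r).
Proof.
move=> /andP[s0 sT] /nbhs_ballP[r /= r0 hr].
have lt : Num.max 0 (s - r) < Num.min T (s + r).
  by rewrite lt_min !gt_max T0 /=; apply/andP; split; [|apply/andP; split]; lra.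
have [u] := rat_in_itvoo lt.
rewrite in_itv/= lt_min gt_max => /andP[/andP[u0 us] /andP[uT ur]].
exists u; first by rewrite !ltW.
by apply: hr; rewrite /ball/= ltr_norml; apply/andP; split; lra.
Qed.

(** Shrinking a scale by a fixed factor costs an arbitrarily small part of the
    constant. *)
Lemma scale_slack q q' : 0 < q' -> q' < q ->
  exists2 k : R, 0 < k < 1 & forall e, 0 <= e -> q * (k * e) `^ theta = q' * e `^ theta.
Proof.
move=> q'0 qq; have q0 : 0 < q by exact: lt_trans qq.
have r0 : 0 < q' / q by exact: divr_gt0.
exists ((q' / q) `^ theta^-1).
  rewrite powR_gt0//= /powR gt_eqF// expR_lt1 pmulr_rlt0 ?invr_gt0//.
  by apply: ln_lt0; rewrite r0 ltr_pdivrMr// mul1r.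
move=> e e0; rewrite powRM ?powR_ge0// -powRrM mulVf ?gt_eqF// powRr1 ?(ltW r0)//.
by rewrite mulrA mulrCA mulfV ?gt_eqF// mulr1.
Qed.

Section path.
Variable x : R -> 'rV[R]_n.
Hypothesis cx : forall i, continuous (fun t => x t ord0 i).

Lemma dotp_continuous (u v : 'rV[R]_n) : continuous (fun t => dotp u (x t - v)).
Proof.
move=> t; rewrite /dotp (_ : (fun _ => _) = fun t => \sum_(i < n) u ord0 i * (x t ord0 i - v ord0 i)).
  apply: cvg_big => [|i _]; [exact: add_continuous|apply: cvgM; first exact: cvg_cst].
  by apply: cvgB; [exact: cx|exact: cvg_cst].
by apply/funext => t'; apply: eq_bigr => i _; rewrite !mxE.
Qed.

Lemma rat_rough_of_rough q q' : 0 < q' < q -> rough_const theta T x q -> rat_rough x q'.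
Proof.
move=> /andP[q'0 qq] hq s e psi [sT /andP[e0 eT]].
have q0 : 0 < q by exact: lt_trans qq.
have [p0|p0] := eqVneq (enorm (rat_vec psi)) 0.
  by exists s; rewrite p0 mulr0 subrr normr0 (ltW e0); split; first by split.
have pp : 0 < enorm (rat_vec psi) by rewrite lt_neqAle eq_sym p0 sqrtr_ge0.
set N := enorm (rat_vec psi) in p0 pp *.
pose phi := N^-1 *: rat_vec psi.
have phiE v : dotp phi v = N^-1 * dotp (rat_vec psi) v.
  exact: dotpZl.
have phi1 : enorm phi = 1.
  have d0 : 0 <= dotp (rat_vec psi) (rat_vec psi).
    by apply: sumr_ge0 => i _; rewrite -expr2 sqr_ge0.
  rewrite /enorm (_ : dotp phi phi = 1) ?sqrtr1//.
  by rewrite phiE dotpC phiE -(sqr_sqrtr d0) -/(enorm _) -/N; field.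
have [k /andP[k0 k1] qk] := scale_slack q'0 qq.
have ke : 0 < k * ratr e <= T / 2.
  by rewrite mulr_gt0//=; apply: le_trans eT; rewrite ger_pMl// ltW.
have [t [tT ts ht]] := hq (ratr s) (k * ratr e) phi sT ke phi1.
rewrite qk ?(ltW e0)// in ht.
have nearQ : \forall u \near t, `|u - ratr s| <= ratr e /\
   q' * ratr e `^ theta < `|dotp phi (x u - x (ratr s))|.
  have cv : `|dotp phi (x u - x (ratr s))| @[u --> t] --> `|dotp phi (x t - x (ratr s))|.
    by apply: cvg_norm; exact: dotp_continuous.
  near=> u; split; near: u; last exact: (cvgr_gt _ cv).
  have lt : `|t - ratr s| < ratr e by apply: le_lt_trans ts _; rewrite gtr_pMl.
  have /cvgr_lt /(_ _ lt) : `|u - ratr s| @[u --> t] --> `|t - ratr s|.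
    by apply: cvg_norm; apply: cvgB; [exact: cvg_id|exact: cvg_cst].
  by apply: filterS => u /ltW.
have [t' t'T [h1 h2]] := rat_near tT nearQ.
exists t'; split; first by split.
rewrite -ler_pdivlMr//; apply: ltW; move: h2.
by rewrite phiE normrM (gtr0_norm (_ : 0 < N^-1)) ?invr_gt0// [N^-1 * _]mulrC.
Unshelve. all: end_near. Qed.

Lemma path_bounded : exists2 B, 0 <= B & forall t i, 0 <= t <= T -> `|x t ord0 i| <= B.
Proof.
have hB i : exists B, forall t, 0 <= t <= T -> `|x t ord0 i| <= B.
  have cN : {within `[0, T], continuous (fun t => `|x t ord0 i|)}.
    apply: continuous_subspaceT => t; apply: cvg_norm; exact: cx.
  have [c _ hc] := EVT_max (ltW T0) cN.
  by exists `|x c ord0 i| => t tT; apply: hc; rewrite in_itv.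
have [B {}hB] := choice hB.
exists (\sum_i `|B i|); first exact: sumr_ge0.
move=> t i tT; apply: le_trans (hB i t tT) _; rewrite (bigD1 i)//=.
by apply: le_trans (ler_norm _) _; rewrite lerDl sumr_ge0.
Qed.

Lemma enorm_perturb (phi psi : 'rV[R]_n) del : enorm phi = 1 -> 0 <= del ->
  (forall i, `|psi ord0 i - phi ord0 i| <= del) -> 1 - 2 * n%:R * del <= enorm psi.
Proof.
move=> phi1 del0 hd.
have s1 := enorm1_sum phi1.
have phi_le i : `|phi ord0 i| <= 1.
  rewrite -(ler_pXn2r (n := 2))// ?nnegrE// real_normK ?num_real// expr1n -s1 (bigD1 i)//= lerDl.
  by apply: sumr_ge0 => j _; exact: sqr_ge0.
have sq : 1 - 2 * n%:R * del <= dotp psi psi.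
  rewrite /dotp -[X in X - _]s1 (_ : 2 * n%:R * del = \sum_(i < n) 2 * del); last first.
    by rewrite sumr_const card_ord -[RHS]mulr_natr; ring.
  rewrite -sumrB; apply: ler_sum => i _.
  have := hd i; have := phi_le i; rewrite !ler_norml.
  set a := phi ord0 i => /andP[a1 a2]; have -> : psi ord0 i = a + (psi ord0 i - a) by ring.
  rewrite addrAC subrr add0r; move: (psi ord0 i - a) => u /andP[b1 b2].
  by have := sqr_ge0 u; have [u0|u0] := leP 0 u; nra.
have [h|h] := leP (1 - 2 * n%:R * del) 0; first by apply: le_trans h _; exact: sqrtr_ge0.
rewrite /enorm -[leLHS]ger0_norm ?(ltW h)// -sqrtr_sqr; apply: ler_wsqrtr.
apply: le_trans sq; rewrite expr2 ger_pMl//.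
by have := mulr_ge0 (ler0n R n) del0; lra.
Qed.

(** The data [s], [e], [phi] are approximated by rational ones; the path is
    bounded and continuous, so that the errors are smaller than the gap between
    the two constants. *)
Lemma rough_of_rat_rough q q' : 0 < q' < q -> rat_rough x q -> rough_const theta T x q'.
Proof.
move=> /andP[q'0 qq] hq s e phi sT /andP[e0 eT] phi1.
have [B B0 hB] := path_bounded.
pose q1 := (q + q') / 2.
have q10 : 0 < q1 by rewrite /q1; lra.
have q1q : q1 < q by rewrite /q1; lra.
have [k /andP[k0 k1] qk] := scale_slack q10 q1q.
have q0 : 0 < q by lra.
have ke : k * e < e by rewrite gtr_pMl.
have [r] := rat_in_itvoo ke; rewrite in_itv/= => /andP[r1 r2].
have r0 : 0 < ratr r :> R by apply: lt_trans r1; rewrite mulr_gt0.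
set Q := q1 * e `^ theta.
have Q0 : 0 <= Q by rewrite mulr_ge0 ?powR_ge0// ltW.
have Qr : Q <= q * ratr r `^ theta.
  rewrite /Q -qk ?(ltW e0)// ler_pM2l//; apply: ge0_ler_powR; rewrite ?nnegrE ?(ltW th0) ?(ltW r0) ?(ltW r1)//.
  by rewrite mulr_ge0// ltW.
have gap : 0 < Q - q' * e `^ theta.
  by rewrite -mulrBl mulr_gt0 ?powR_gt0// /q1; lra.
pose c : R := 2 * n%:R * Q + n%:R * (2 * B) + n%:R.
have c0 : 0 <= c.
  have nn : 0 <= n%:R :> R by [].
  by have := mulr_ge0 nn Q0; have := mulr_ge0 nn B0; rewrite /c; lra.
pose del : R := (Q - q' * e `^ theta) / (c + 1).
have del0 : 0 < del by rewrite divr_gt0//; lra.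
have cdel : c * del < Q - q' * e `^ theta.
  by rewrite /del mulrA ltr_pdivrMr; [rewrite mulrC ltr_pM2l//; lra|lra].
have nearQ : \forall u \near s, `|u - s| <= e - ratr r /\
    forall i, `|x u ord0 i - x s ord0 i| <= del.
  near=> u; split; near: u.
    have er : 0 < e - ratr r by lra.
    by apply: filterS (nbhsx_ballx s _ er) => u; rewrite /ball/= distrC => /ltW.
  apply: filter_forall => i; have /cvgr_dist_lt /(_ _ del0) := @cx i s.
  by apply: filterS => u /ltW; rewrite distrC.
have [s' s'T [ss' hs']] := rat_near sT nearQ.
have [psi hpsi] : exists psi : {ffun 'I_n -> rat}, forall i, `|rat_vec psi ord0 i - phi ord0 i| <= del.
  have : forall i : 'I_n, exists r : rat, `|ratr r - phi ord0 i| <= del.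
    move=> i; have lt : phi ord0 i - del < phi ord0 i + del by lra.
    have [y] := rat_in_itvoo lt; rewrite in_itv/= => /andP[y1 y2]; exists y.
    by rewrite ler_norml; apply/andP; split; lra.
  by move=> /choice[f hf]; exists [ffun i => f i] => i; rewrite mxE ffunE.
have [t [[tT ts] ht]] := hq s' r psi ltac:(split => //; rewrite r0 /=; lra).
exists (ratr t); split => //.
  by rewrite (_ : _ - s = (ratr t - ratr s') + (ratr s' - s)); [apply: le_trans (ler_normD _ _) _; lra|ring].
have np := enorm_perturb phi1 (ltW del0) hpsi.
have main : Q * (1 - 2 * n%:R * del) <= `|dotp (rat_vec psi) (x (ratr t) - x (ratr s'))|.
  apply: le_trans ht; apply: (@le_trans _ _ (Q * enorm (rat_vec psi))); first exact: ler_wpM2l.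
  by apply: ler_wpM2r => //; exact: sqrtr_ge0.
have e1 : `|dotp (rat_vec psi) (x (ratr t) - x (ratr s')) - dotp phi (x (ratr t) - x s)|
    <= n%:R * (2 * B) * del + n%:R * del.
  rewrite /dotp -sumrB; apply: (le_trans (ler_norm_sum _ _ _)).
  rewrite (_ : n%:R * (2 * B) * del + n%:R * del = \sum_(i < n) (2 * B * del + del)); last first.
    by rewrite sumr_const card_ord -[RHS]mulr_natr; ring.
  apply: ler_sum => i _.
  rewrite (_ : _ - _ = (rat_vec psi ord0 i - phi ord0 i) * (x (ratr t) ord0 i - x (ratr s') ord0 i)
     - phi ord0 i * (x (ratr s') ord0 i - x s ord0 i)); last by rewrite !mxE; ring.
  apply: le_trans (ler_normB _ _) _; rewrite !normrM; apply: lerD.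
    rewrite mulrC; apply: ler_pM => //.
    apply: le_trans (ler_normB _ _) _; have := hB _ i tT; have := hB _ i s'T; lra.
  rewrite -[leRHS]mul1r; apply: ler_pM => //.
  rewrite -(ler_pXn2r (n := 2))// ?nnegrE// real_normK ?num_real// expr1n -(enorm1_sum phi1) (bigD1 i)//= lerDl.
  by apply: sumr_ge0 => j _; exact: sqr_ge0.
have := lerB_dist (dotp (rat_vec psi) (x (ratr t) - x (ratr s'))) (dotp phi (x (ratr t) - x s)).
move: cdel main e1; rewrite /c; set u := `|dotp (rat_vec psi) _|.
set v := `|_ - _|; set z := `|dotp phi _| => b1 b2 b3 b4.
have : Q * (1 - 2 * n%:R * del) - z <= n%:R * (2 * B) * del + n%:R * del by lra.
by lra.
Unshelve. all: end_near. Qed.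

Lemma roughness_gt_rat a : 0 <= a -> (a%:E < roughness theta T x)%E <->
  exists q : rat, a < ratr q /\ rat_rough x (ratr q).
Proof.
move=> a0; split.
  rewrite /roughness lt_max lte_fin (ltNge a 0) a0 /= => /ereal_sup_gt[_ [q [q0 hq] <-]].
  rewrite lte_fin => aq; have [r] := rat_in_itvoo aq; rewrite in_itv/= => /andP[r1 r2].
  exists r; split => //; apply: rat_rough_of_rough hq; rewrite r2 andbT; exact: le_lt_trans r1.
move=> [q [aq hq]]; pose q' := (a + ratr q) / 2.
have q'0 : 0 < q' by rewrite /q'; lra.
apply: (@lt_le_trans _ _ q'%:E); first by rewrite lte_fin /q'; lra.
rewrite /roughness le_max; apply/orP; right; apply: ereal_sup_ubound; exists q' => //; split => //.
by apply: rough_of_rat_rough hq; rewrite q'0 /q' /=; lra.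
Qed.

Lemma roughness_ge0 : (0 <= roughness theta T x)%E.
Proof. by rewrite /roughness le_max lexx. Qed.

Lemma roughness_gt0_holder : (0 < roughness theta T x)%E -> holder_rough theta T x.
Proof.
rewrite /roughness lt_max ltxx /= => /ereal_sup_gt[_ [q [q0 hq] _] _]; by exists q.
Qed.

End path.
End rational_roughness.

(** The rational test only involves countably many quantifiers. *)
Lemma roughness_measurable {R : realType} (n : nat) (theta T : R) d (Omega : measurableType d)
    (X : R -> Omega -> 'rV[R]_n) : 0 < theta -> 0 < T ->
  (forall i t, measurable_fun setT (fun w => X t w ord0 i)) ->
  (forall i w, continuous (fun t => X t w ord0 i)) ->
  measurable_fun setT (fun w => roughness theta T (fun t => X t w)).
Proof.
move=> th0 T0 mX cX.
apply: (measurability _ (ErealGenOInfty.measurableE R)) => _ [_ [a ->] <-].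
rewrite setTI; have [a0|a0] := leP 0 a; last first.
  rewrite (_ : _ @^-1` _ = setT)//; apply/seteqP; split => // w _ /=.
  by rewrite in_itv/= andbT; apply: lt_le_trans (roughness_ge0 _ _ _); rewrite lte_fin.
rewrite (_ : _ @^-1` _ = [set w | exists q : rat, a < ratr q /\ rat_rough theta T (fun t => X t w) (ratr q)]); last first.
  apply/seteqP; split => w /=; rewrite in_itv/= andbT;
    by move=> /(roughness_gt_rat th0 T0 (fun i => cX i w) a0).
apply: measurable_exists => q; apply: measurable_guard_and.
apply: measurable_forall => s; apply: measurable_forall => e; apply: measurable_forall => psi.
apply: measurable_guard_imp; apply: measurable_exists => t; apply: measurable_guard_and.
rewrite -[X in measurable X]setTI; apply: measurable_fun_ler => //.
apply: measurableT_comp; first exact: normr_measurable.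
apply: measurable_sum => i; apply: measurable_funM => //.
rewrite (_ : (fun w => _) = fun w => X (ratr t) w ord0 i - X (ratr s) w ord0 i).
  exact: measurable_funB.
by apply/funext => w; rewrite !mxE.
Qed.

(** * Conditional expectations *)

Section conditional_expectation.
Context {R : realType} d (Omega : measurableType d) (P : probability Omega R).
Variables (G : set (set Omega)) (f : Omega -> \bar R).
Hypotheses (sG : sigma_algebra setT G) (mG : G `<=` measurable).

Section existence.
Hypotheses (mf : measurable_fun setT f) (f0 : forall w, (0 <= f w)%E).
Hypothesis fint : (\int[P]_w f w < +oo)%E.
Local Notation T' := (g_sigma_algebraType G).

Let measurable_sub (A : set T') : measurable A -> G A.
Proof. by rewrite /measurable/= sigma_algebra_id. Qed.

Let trace_prob (A : set T') : \bar R := P A.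

Let trace_prob0 : trace_prob set0 = 0%E.
Proof. exact: measure0. Qed.

Let trace_prob_ge0 A : (0 <= trace_prob A)%E.
Proof. exact: measure_ge0. Qed.

Let trace_prob_additive : semi_sigma_additive trace_prob.
Proof.
move=> F mF tF mU; apply: (@measure_semi_sigma_additive _ _ _ P) => //.
  by move=> i; apply: mG; apply: measurable_sub.
by apply: mG; apply: measurable_sub.
Qed.

HB.instance Definition _ := isMeasure.Build _ _ _ trace_prob
  trace_prob0 trace_prob_ge0 trace_prob_additive.

Let trace_prob_fin : fin_num_fun trace_prob.
Proof. by move=> A mA; apply: fin_num_measure; apply: mG; exact: measurable_sub. Qed.

HB.instance Definition _ := @Measure_isFinite.Build _ _ _ trace_prob trace_prob_fin.

Let trace_int (A : set T') : \bar R := (\int[P]_(w in A) f w)%E.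

Let trace_int0 : trace_int set0 = 0%E.
Proof. exact: integral_set0. Qed.

Let trace_int_ge0 A : (0 <= trace_int A)%E.
Proof. by apply: integral_ge0. Qed.

Let trace_int_additive : semi_sigma_additive trace_int.
Proof.
move=> F mF tF mU; rewrite /trace_int ge0_integral_bigcup//.
- by apply: is_cvg_ereal_nneg_natsum => n _; exact: integral_ge0.
- by move=> n; apply: mG; exact: measurable_sub.
- exact: measurable_funTS.
Qed.

HB.instance Definition _ := isMeasure.Build _ _ _ trace_int
  trace_int0 trace_int_ge0 trace_int_additive.

Let trace_int_fin : fin_num_fun trace_int.
Proof.
move=> A mA; rewrite ge0_fin_numE ?integral_ge0//; apply: le_lt_trans fint.
by apply: ge0_subset_integral => //; apply: mG; exact: measurable_sub.
Qed.

HB.instance Definition _ := @Measure_isFinite.Build _ _ _ trace_int trace_int_fin.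

(** Radon-Nikodym on the sub-sigma-algebra [G], applied to the integral of [f] with
    respect to the trace of [P]. *)
Lemma cond_expectation_exists : exists Y, is_cond_expectation P G f Y.
Proof.
have dom : trace_int `<< trace_prob.
  apply/null_content_dominatesP => A mA PA0; rewrite /trace_int.
  apply: null_set_integral => //; first by apply: mG; exact: measurable_sub.
  exact: measurable_funTS.
have [Y [Y0 iY hY]] := radon_nikodym_finite dom.
have mY : measurable_fun (setT : set T') Y by case/integrableP: iY.
exists Y; split => //.
- by move=> B mB; apply: measurable_sub; rewrite -[X in measurable X]setTI; exact: mY.
- move=> A GA; have mA : measurable (A : set T').
    by rewrite /measurable/= sigma_algebra_id.
  rewrite -/(trace_int A) hY//.
  have mid : measurable_fun (setT : set Omega) (id : Omega -> T').
    by move=> _ B mB; rewrite setTI; apply: mG; exact: measurable_sub.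
  rewrite -(ge0_integral_pushforward mid P mA (measurable_funTS mY)).
    by apply: eq_measure_integral.
  by move=> w _; exact: Y0.
Qed.

End existence.

Section versions.
Variable Y : Omega -> \bar R.
Hypothesis hY : is_cond_expectation P G f Y.

Lemma cond_expectation_measurable : measurable_fun setT Y.
Proof. by move=> _ B mB; rewrite setTI; apply: mG; exact: cexp_version_measurable hY B mB. Qed.

(** Test the bound on the events where [Y] exceeds [k] by at least [j.+1%:R^-1]. *)
Lemma cond_expectation_le (k : R) : 0 <= k ->
  (forall A, G A -> (\int[P]_(w in A) f w <= k%:E * P A)%E) ->
  {ae P, forall w, (Y w <= k%:E)%E}.
Proof.
move=> k0 hk; pose A j := Y @^-1` [set y | ((k + j.+1%:R^-1)%:E <= y)%E].
have GA j : G (A j).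
  apply: (cexp_version_measurable hY).
  rewrite (_ : [set y | _] = `[(k + j.+1%:R^-1)%:E, +oo[%classic); first exact: emeasurable_itv.
  by apply/seteqP; split => y /=; rewrite in_itv/= andbT.
have PA j : P (A j) = 0%E.
  have mA := mG (GA j).
  have h1 : ((k + j.+1%:R^-1)%:E * P (A j) <= k%:E * P (A j))%E.
    apply: le_trans (hk _ (GA j)); rewrite -(cexp_integral hY (GA j)).
    rewrite -integral_cst//; apply: ge0_le_integral => //.
    - by move=> w _; rewrite lee_fin addr_ge0.
    - exact: measurable_funTS cond_expectation_measurable.
  have fA : P (A j) \is a fin_num by exact: fin_num_measure.
  move: h1; rewrite -(fineK fA) -!EFinM !lee_fin mulrDl gerDl => h1.
  congr (_%:E); apply/eqP; rewrite eq_le fine_ge0// andbT.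
  by move: h1; rewrite pmulr_rle0// invr_gt0.
exists (\bigcup_j A j); split.
- by apply: bigcup_measurable => j _; exact: mG.
- apply/eqP; rewrite eq_le measure_ge0 andbT.
  have : (P (\bigcup_j A j) <= \sum_(j <oo) P (A j))%E.
    apply: measure_sigma_subadditive => //; first by move=> j; exact: mG.
    by apply: bigcup_measurable => j _; exact: mG.
  by move=> /le_trans; apply; rewrite eseries0.
- move=> w /= /negP; rewrite -ltNge => kY.
  have [j hj] : exists j, ((k + j.+1%:R^-1)%:E <= Y w)%E.
    case: (Y w) kY => [y| |//]; last by exists 0%N; rewrite leey.
    rewrite lte_fin -subr_gt0 => y0; exists (Num.truncn (y - k)^-1).
    have lt := truncnS_gt (y - k)^-1.
    rewrite lee_fin -lerBrDl invf_ple ?posrE//; last exact: ltW.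
  by exists j.
Qed.

Lemma cond_expectation_fin : (\int[P]_w f w < +oo)%E -> {ae P, forall w, (Y w < +oo)%E}.
Proof.
move=> fint; have [h0 hC _] := sG.
have GT : G setT by have := hC _ h0; rewrite setTD setC0.
have iY : P.-integrable setT Y.
  apply/integrableP; split; first exact: cond_expectation_measurable.
  under eq_integral do rewrite gee0_abs ?(cexp_version_ge0 hY)//.
  by rewrite (cexp_integral hY GT).
have := integrable_ae measurableT iY; apply: filterS => w /(_ I).
by rewrite ge0_fin_numE// (cexp_version_ge0 hY).
Qed.

End versions.
End conditional_expectation.

(** * Negative moments *)

Lemma neg_powe_measurable {R : realType} d (Omega : measurableType d)
    (L : Omega -> \bar R) (p : R) :
  measurable_fun setT L -> measurable_fun setT (fun w => neg_powe (L w) p).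
Proof.
move=> mL; pose g w := (L w `^ p)%E.
have mg : measurable_fun setT g by exact: (measurableT_comp (measurable_poweR p) mL).
apply: (measurability _ (ErealGenOInfty.measurableE R)) => _ [_ [a ->] <-].
rewrite setTI; have [a0|a0] := leP 0 a; last first.
  rewrite (_ : _ @^-1` _ = setT)//; apply/seteqP; split => // w _ /=.
  rewrite in_itv/= andbT; apply: (@lt_le_trans _ _ 0%E); first by rewrite lte_fin.
  by rewrite /neg_powe inve_ge0 poweR_ge0.
have := emeasurable_fun_infty_o measurableT mg (a%:E^-1)%E.
rewrite setTI; congr (measurable _); apply/seteqP; split => w /=;
  by rewrite in_itv/= andbT /neg_powe inve_pgt// inE ?poweR_ge0 ?lee_fin.
Qed.

Section neg_moment.
Context {R : realType} d (Omega : measurableType d) (P : probability Omega R).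
Variables (L : Omega -> \bar R) (M c : R).
Hypotheses (mL : measurable_fun setT L) (L0 : forall w, (0 <= L w)%E).
Hypotheses (M0 : 0 < M) (c0 : 0 < c).
Hypothesis tail : forall eps, 0 < eps < 1 ->
  (P [set w | (L w <= eps%:E)%E] <= (M * expR (- (c * eps ^- 2)))%:E)%E.

Let meas_le (a : \bar R) : measurable [set w | (L w <= a)%E].
Proof. by have := emeasurable_fun_infty_c measurableT mL a; rewrite setTI. Qed.

(** The tail is at most [M / c * eps ^+ 2], which tends to [0]. *)
Lemma tail_pos : {ae P, forall w, (0 < L w)%E}.
Proof.
exists [set w | (L w <= 0)%E]; split => //; last by move=> w /= /negP; rewrite -leNgt.
set x := P _; have xf : x \is a fin_num by exact: fin_num_measure.
have hx eps : 0 < eps < 1 -> fine x <= M / c * eps ^+ 2.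
  move=> /[dup] /andP[e0 _] /tail h.
  have e2 : 0 < eps ^+ 2 by rewrite exprn_gt0.
  rewrite -lee_fin fineK//; apply: le_trans (le_trans _ h) _.
    apply: le_measure; rewrite ?inE// => w /= /le_trans; apply; by rewrite lee_fin ltW.
  rewrite lee_fin -mulrA ler_pM2l// expRN -[leRHS]invrK lef_pV2 ?posrE ?expR_gt0//; last first.
    by rewrite invr_gt0 mulr_gt0// invr_gt0.
  by rewrite invfM invrK; apply: le_trans (expR_ge1Dx _); rewrite lerDr.
have K0 : 0 < M / c by rewrite divr_gt0.
have x0 : 0 <= fine x by apply: fine_ge0; exact: measure_ge0.
rewrite -(fineK xf); congr (_%:E); apply/eqP; rewrite eq_le x0 andbT leNgt; apply/negP => xp.
pose eps := Num.min (1 / 2) (fine x / (M / c)).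
have e0 : 0 < eps by rewrite lt_min !divr_gt0.
have e1 : eps <= 1 / 2 by rewrite ge_min lexx.
have e2 : M / c * eps <= fine x by rewrite mulrC -ler_pdivlMr// ge_min lexx orbT.
have := hx eps ltac:(apply/andP; split; lra).
by move: (M / c) e2 => K e2; nra.
Qed.

(** Outside a null set, [L] lies above [2 ^- k.+1] and below [2 ^- k] for some [k],
    or above [1 / 2]; the tail beats every power of [2 ^+ k]. *)
Lemma neg_powe_moment p : 0 < p -> (\int[P]_w neg_powe (L w) p < +oo)%E.
Proof.
move=> p0; pose N := (Num.truncn p).+1.
have pN : p <= N%:R by apply/ltW; exact: truncnS_gt.
pose a k : R := (2 ^+ k.+1) ^+ N.
have a0 k : 0 <= a k by rewrite !exprn_ge0.
pose E k := if k is k'.+1 then [set w | (L w <= (2 ^- k)%:E)%E] else setT.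
have mE k : measurable (E k) by case: k => [|k]; [exact: measurableT|exact: meas_le].
pose g k w := ((a k)%:E * (\1_(E k) w)%:E)%E.
pose D := 2 ^+ N + 2 ^+ N * M * (N.+1%:R / c) ^+ N.+1.
have D1 : 0 <= 2 ^+ N * M * (N.+1%:R / c) ^+ N.+1.
  have Nc : 0 <= N.+1%:R / c by rewrite divr_ge0// ltW.
  apply: mulr_ge0; last exact: exprn_ge0.
  by apply: mulr_ge0; [exact: exprn_ge0|exact: ltW].
have D0 : 0 <= D by rewrite addr_ge0// exprn_ge0.
have mg k : measurable_fun setT (g k).
  apply: measurable_funeM; apply/measurable_EFinP; exact: measurable_indic.
have g0 k w : (0 <= g k w)%E by rewrite mule_ge0 ?lee_fin.
apply: (@le_lt_trans _ _ (\int[P]_w \sum_(k <oo) g k w)%E).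
  apply: ae_ge0_le_integral => //.
  - by move=> w _; rewrite /neg_powe inve_ge0 poweR_ge0.
  - exact: neg_powe_measurable.
  - by move=> w _; apply: nneseries_ge0 => k _ _.
  - apply: ge0_emeasurable_sum => //.
  - apply: filterS tail_pos => w Lw _.
    have [k [wE Lk]] : exists k, E k w /\ ((2 ^- k.+1)%:E <= L w)%E.
      have exm : exists m, ((2 ^- m.+1)%:E <= L w)%E.
        case: (L w) Lw => [r| |//]; last by exists 0%N; rewrite leey.
        rewrite lte_fin => r0; exists (Num.truncn r^-1); set m := Num.truncn _.
        have rm : r^-1 <= m.+1%:R by apply/ltW; exact: truncnS_gt.
        have m2 : m.+1%:R <= 2 ^+ m.+1 :> R by rewrite -natrX ler_nat ltnW// ltn_expl.
        rewrite lee_fin -[leRHS]invrK lef_pV2 ?posrE ?exprn_gt0 ?invr_gt0//.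
        exact: le_trans m2.
      case: (ex_minnP exm) => k hk mink; exists k; split => //.
      case: k hk mink => [//|k] hk mink; rewrite /E /= leNgt; apply/negP => lt.
      by have := mink k (ltW lt); rewrite ltnn.
    apply: (@le_trans _ _ (g k w)).
      rewrite /g indicE mem_set// mule1 /neg_powe inve_ple ?inE ?poweR_ge0 ?lee_fin//.
      pose rho : R := 2 ^- k.+1.
      have rho0 : 0 < rho by rewrite invr_gt0 exprn_gt0.
      have rho1 : rho <= 1 by rewrite invf_le1 ?exprn_gt0// exprn_ege1//; lra.
      apply: (@le_trans _ _ (rho%:E `^ p)%E); last first.
        by apply: gt0_ler_poweR; rewrite ?in_itv/= ?leey ?L0 ?andbT ?lee_fin// ltW.
      rewrite poweR_EFin inver gt_eqF ?exprn_gt0 ?exprn_gt0// lee_fin.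
      have -> : (a k)^-1 = rho `^ N%:R by rewrite powR_mulrn ?(ltW rho0)// /rho exprVn.
      by apply: ger_powR; rewrite ?rho0.
    apply: le_trans (nneseries_lim_ge k.+1 _); last by move=> i _ _.
    by rewrite big_nat_recr//= leeDr// sume_ge0.
rewrite integral_nneseries//.
apply: (@le_lt_trans _ _ ((2 * D)%:E * 1)%E); last by rewrite mule1 ltry.
apply: nneseries_geometric_le => //.
  by move=> k; apply: integral_ge0 => w _.
move=> k; rewrite ge0_integralZl//; last first.
- by rewrite lee_fin.
- by apply/measurable_EFinP; exact: measurable_indic.
rewrite integral_indic// setIT mule1.
have [k0|k0] := posnP k.
  have PE0 : (P (E 0%N) = 1)%E by exact: (probability_setT P).
  rewrite k0 [X in (_ * X <= _)%E]PE0 mule1 lee_fin expr0 divr1 /a expr1 /D lerDl; exact: D1.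
have Ek : E k = [set w | (L w <= (2 ^- k)%:E)%E] by rewrite /E; case: k k0.
have k2 : 0 < 2 ^+ k :> R by rewrite exprn_gt0.
have eps01 : 0 < (2 ^- k : R) < 1.
  by rewrite invr_gt0 k2/= invf_lt1// -natrX ltr1n -(expn0 2) ltn_exp2l.
rewrite Ek; apply: (@le_trans _ _ ((a k)%:E * (M * expR (- (c * (2 ^- k) ^- 2)))%:E)%E).
  by apply: lee_wpmul2l; [rewrite lee_fin|exact: tail].
rewrite -EFinM lee_fin.
set z : R := 2 ^+ k in k2 *.
have -> : z^-1 ^- 2 = z ^+ 2 by rewrite exprVn invrK.
have h := @exprn_le_expR R c (z ^+ 2) N.+1 c0 (exprn_ge0 _ (ltW k2)).
have hz : expR (- (c * z ^+ 2)) <= (N.+1%:R / c) ^+ N.+1 / (z ^+ 2) ^+ N.+1.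
  by rewrite expRN ler_pdivlMr ?exprn_gt0// mulrC ler_pdivrMr ?expR_gt0.
have -> : a k = 2 ^+ N * z ^+ N by rewrite /a exprS exprMn.
apply: (@le_trans _ _ (2 ^+ N * z ^+ N * (M * ((N.+1%:R / c) ^+ N.+1 / (z ^+ 2) ^+ N.+1)))).
  rewrite ler_wpM2l ?ler_wpM2l ?(ltW M0)//.
  by apply: mulr_ge0; apply: exprn_ge0 => //; exact: ltW.
have z1 : 1 <= z by rewrite /z exprn_ege1//; lra.
apply: (@le_trans _ _ ((2 ^+ N * M * (N.+1%:R / c) ^+ N.+1) / z)); last first.
  by rewrite ler_pM2r ?invr_gt0// /D lerDr exprn_ge0.
have -> : 2 ^+ N * z ^+ N * (M * ((N.+1%:R / c) ^+ N.+1 / (z ^+ 2) ^+ N.+1)) =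
   (2 ^+ N * M * (N.+1%:R / c) ^+ N.+1) * (z ^+ N / (z ^+ 2) ^+ N.+1) by ring.
rewrite ler_wpM2l//.
rewrite ler_pdivrMr ?exprn_gt0// mulrC ler_pdivlMr// -exprM mulrC -exprS.
by apply: ler_weXn2l => //; lia.
Qed.

End neg_moment.

(** * Tail of the roughness given the past *)

Theorem lemma3 (R : realType) (n : nat) (H T theta : R)
    (hH : 0 < H <= 1 / 2) (hT : 0 < T) (htheta : H < theta < 1) :
  exists M c : R, [/\ 0 < M, 0 < c &
    forall (d : measure_display) (Omega : measurableType d)
      (P : probability Omega R) (X : R -> Omega -> 'rV[R]_n),
      is_fbm P H X ->
      let L := fun w => roughness theta T (fun t => X t w) in
      [/\ {ae P, forall w, holder_rough theta T (fun t => X t w)},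
          forall eps : R, 0 < eps < 1 ->
            cond_probability_as P (past X) [set w | (L w <= eps%:E)%E]
              (fun q => (q <= (M * expR (- (c * eps ^- 2)))%:E)%E) &
          forall p : R, 0 < p ->
            cond_expectation_as P (past X) (fun w => neg_powe (L w) p)
              (fun q => (q < +oo)%E)]].
Proof.
have [M [c [M0 c0 tail]]] := roughness_tail n hH hT htheta.
exists M, c; split=> // d Omega P X fX L.
have th0 : 0 < theta by case/andP: hH htheta => H0 _ /andP[+ _]; exact: lt_trans.
have mL : measurable_fun setT L.
  apply: roughness_measurable => // [i t|i w]; first exact: (measurable_component fX).
  exact: (fbm_continuous (fbm_component fX i)).
have L0 w : (0 <= L w)%E by exact: roughness_ge0.
have mle a : measurable [set w | (L w <= a)%E].
  by have := emeasurable_fun_infty_c measurableT mL a; rewrite setTI.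
have sG : sigma_algebra setT (past X) by exact: sigma_process_algebra.
have mG : past X `<=` measurable by move=> A; exact: (sigma_process_measurable fX).
have condtail eps A : 0 < eps < 1 -> past X A ->
    (P (A `&` [set w | (L w <= eps%:E)%E]) <= (M * expR (- (c * eps ^- 2)))%:E * P A)%E.
  move=> eps01 hA; have [U [mU LU hU]] := tail _ _ _ _ fX eps eps01.
  apply: le_trans (hU A hA); apply: le_measure; rewrite ?inE.
  - by apply: measurableI => //; exact: mG.
  - by apply: measurableI => //; exact: mG.
  - by move=> w [Aw Lw]; split => //; exact: LU.
have ltail eps : 0 < eps < 1 ->
    (P [set w | (L w <= eps%:E)%E] <= (M * expR (- (c * eps ^- 2)))%:E)%E.
  move=> eps01; have pT : past X setT.
    by have [h0 hC _] := sG; have := hC _ h0; rewrite setTD setC0.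
  by have := condtail eps setT eps01 pT; rewrite setTI probability_setT mule1.
split.
- by apply: filterS (tail_pos mL M0 c0 ltail) => w; exact: roughness_gt0_holder.
- move=> eps eps01; set E := [set w | _].
  have mE : measurable E by exact: mle.
  have mI : measurable_fun setT (fun w => (\1_E w)%:E : \bar R).
    by apply/measurable_EFinP; exact: measurable_indic.
  split.
    apply: cond_expectation_exists => //.
    rewrite integral_indic// setIT; apply: le_lt_trans (probability_le1 P mE) _.
    by rewrite ltry.
  move=> Y hY; apply: (cond_expectation_le mG hY).
    by rewrite mulr_ge0 ?expR_ge0// ltW.
  by move=> A hA; rewrite integral_indic//; [rewrite setIC; exact: condtail|exact: mG].
- move=> p p0; have fin := neg_powe_moment mL L0 M0 c0 ltail p0; split.
    apply: cond_expectation_exists => //; first exact: neg_powe_measurable.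
    by move=> w; rewrite /neg_powe inve_ge0 poweR_ge0.
  by move=> Y hY; exact: (cond_expectation_fin sG mG hY fin).
Qed.
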